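(* Let $d\geq 3$ and let $B$ be a smooth, closed and compactly supported $2$-form on $\mathbb{R}^d$. Fix $r\in(0,\infty)$. With the notation of the context, the following statements are equivalent: (i) $\nu_B(r)=0$. (ii) The system $\mathrm{d}'\varphi - i\mathsf{A}(\cdot,r)\varphi=0$ on $S^{d-1}$ admits a smooth (complex-valued) solution $\varphi\neq 0$. (iii) $\mathsf{A}(\cdot,r)$ is exact on $S^{d-1}$, i.e. $\mathsf{A}(\cdot,r)=\mathrm{d}'f$ for some smooth function $f$ on $S^{d-1}$. (iv) $\mathsf{A}(\cdot,r)$ is closed on $S^{d-1}$, i.e. $\mathsf{B}'(\cdot,r):=\mathrm{d}'\mathsf{A}(\cdot,r)=0$ as a $2$-form on $S^{d-1}$. (v) The Hodge dual on $S^{d-1}$ satisfies ${}^{*}\mathsf{B}'(\cdot,r)=0$. (vi) The Hodge dual on $\mathbb{R}^d$, written in spherical coordinates, satisfies ${}^{*}\mathsf{B}^{\lambda_1\dots\lambda_{d-3}d}(\cdot,r)=0$ for every $\lambda_1,\dots,\lambda_{d-3}\in\{1,\dots,d-1\}$.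
   Context: Poincaré gauge: $A_j(x) := \int_0^1 \sum_l x^l B_{lj}(xu)\,u\,\mathrm{d}u$, a smooth $1$-form on $\mathbb{R}^d$ with $\mathrm{d}A=B$ (i.e. $B_{jk}=\partial_jA_k-\partial_kA_j$) and $x\cdot A(x)=0$. Spherical coordinates: $\pi:S^{d-1}\times(0,\infty)\to\mathbb{R}^d$, $\pi(\sigma,r)=\sigma r$, with local coordinates $q=(\theta^1,\dots,\theta^{d-1},r)$, where $\theta^1,\dots,\theta^{d-1}$ are local coordinates on $S^{d-1}$ and index $d$ denotes the radial coordinate $q^d=r$. $\mathsf{A}:=\pi^*A$ and $\mathsf{B}:=\pi^*B$ denote the pulled-back forms. The radial component of $\mathsf{A}$ vanishes, so for fixed $r>0$, $\mathsf{A}(\cdot,r)$ is a $1$-form on $S^{d-1}$: $\mathsf{A}(\sigma,r)(X)=r\,A(r\sigma)\cdot X$ for $X\in T_\sigma S^{d-1}$. $\mathrm{d}'$ is the exterior derivative on $S^{d-1}$. $$\nu_B(r) := \inf_{\varphi\in H^1(S^{d-1}),\ \varphi\neq 0} \frac{\int_{S^{d-1}} |(\mathrm{d}'-i\mathsf{A}(\sigma,r))\varphi(\sigma)|_{S^{d-1}}^2\,\mathrm{d}\sigma}{\int_{S^{d-1}}|\varphi(\sigma)|^2\,\mathrm{d}\sigma},$$ where $|\cdot|_{S^{d-1}}$ is the norm of (complex) covectors for the round metric. Hodge duals are contravariant tensors. In spherical coordinates the Euclidean metric is $g=r^2\gamma+\mathrm{d}r^2$ with $\gamma$ the round metric of $S^{d-1}$,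 and ${}^{*}\mathsf{B}^{l_1\dots l_{d-2}} = \frac{1}{2}\sum_{j,k}\varepsilon^{l_1\dots l_{d-2}jk}\mathsf{B}_{jk}$ with $\varepsilon^{l_1\dots l_{d-2}jk}$ equal to $(\det g)^{-1/2}$ times the Levi-Civita permutation symbol (indices from $1$ to $d$). On $S^{d-1}$, ${}^{*}\mathsf{B}'^{\lambda_1\dots\lambda_{d-3}} = \frac12\sum_{\mu,\nu}\varepsilon^{\lambda_1\dots\lambda_{d-3}\mu\nu}\mathsf{B}'_{\mu\nu}$ with $\varepsilon^{\lambda_1\dots\lambda_{d-3}\mu\nu}$ equal to $(\det\gamma)^{-1/2}$ times the permutation symbol (indices from $1$ to $d-1$). If $d=3$ there are no indices $\lambda$: ${}^{*}\mathsf{B}'$ is a scalar and (vi) says that the radial component ${}^{*}\mathsf{B}^{3}(\cdot,r)$ vanishes. The identities (v), (vi) are meant in every local coordinate system on $S^{d-1}$. *)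

(* Defs.v *)
From HB Require Import structures.
From mathcomp Require Import all_boot all_order all_algebra all_fingroup.
From mathcomp Require Import complex.
From mathcomp Require Import all_classical all_reals all_analysis.

Set Implicit Arguments.
Unset Strict Implicit.
Unset Printing Implicit Defensive.

Import Order.TTheory GRing.Theory Num.Theory.
Import numFieldNormedType.Exports.

Local Open Scope classical_set_scope.
Local Open Scope ring_scope.

Section sigma_finite_prod.
Context {R : realType} d1 d2 (T1 : measurableType d1) (T2 : measurableType d2).
Local Open Scope ereal_scope.

Lemma sigma_finite_prod (m1 : {sigma_finite_measure set T1 -> \bar R})
    (m2 : {sigma_finite_measure set T2 -> \bar R}) :
  sigma_finite setT (m1 \x m2).
Proof.
have /sigma_finiteP[F [TF ndF Foo]] := sigma_finiteT m1.
have /sigma_finiteP[G [TG ndG Goo]] := sigma_finiteT m2.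
exists (fun n => F n `*` G n).
  rewrite -setXTT TF TG predeqE => -[x y]; split.
    move=> [/= [n _ Fnx] [k _ Gky]]; exists (maxn n k) => //; split.
    - by move: x Fnx; exact/subsetPset/ndF/leq_maxl.
    - by move: y Gky; exact/subsetPset/ndG/leq_maxr.
  by move=> [n _ []/= ? ?]; split; exists n.
move=> k; have [? ?] := Foo k; have [? ?] := Goo k.
split; first exact: measurableX.
by rewrite product_measure1E// lte_mul_pinfty// ge0_fin_numE.
Qed.

Lemma semi_sigma_additive_preimage (m : {measure set T1 -> \bar R})
    (f : T1 -> T2) : measurable_fun setT f ->
  semi_sigma_additive (pushforward m f).
Proof.
move=> mf F mF tF mUF; rewrite /pushforward preimage_bigcup.
apply: measure_semi_sigma_additive.
- by move=> n; rewrite -[X in measurable X]setTI; exact: mf.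
- apply/trivIsetP => /= i j _ _ ij; rewrite -preimage_setI.
  by move/trivIsetP : tF => /(_ _ _ _ _ ij) ->//; rewrite preimage_set0.
- by rewrite -preimage_bigcup -[X in measurable X]setTI; exact: mf.
Qed.

End sigma_finite_prod.

Lemma ex_sigma_finite_measure {R : realType} d (T : measurableType d)
    (m : set T -> \bar R) :
  m set0 = 0%E -> (forall E, (0 <= m E)%E) -> semi_sigma_additive m ->
  sigma_finite setT m ->
  exists mu : {sigma_finite_measure set T -> \bar R}, mu = m :> (set T -> \bar R).
Proof.
move=> m0 m_ge0 m_add m_fin.
pose fM := isMeasure.Build _ _ _ m m0 m_ge0 m_add.
pose M : {measure set T -> \bar R} := HB.pack_for (measure T R) m fM.
pose fS := Measure_isSigmaFinite.Build _ _ _ M m_fin.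
pose S : {sigma_finite_measure set T -> \bar R} :=
  HB.pack_for (sigma_finite_measure T R) m fM fS.
by exists S.
Qed.

Section lebesgue_Rn.
Context {R : realType}.
Local Open Scope ereal_scope.

(* Lebesgue measure on R^n by Cavalieri's principle, that is, the n-fold
   product of the Lebesgue measure of R; [n.-tuple R] carries the product
   (= Borel) sigma-algebra. *)
Fixpoint lebesgue_Rn (n : nat) : set (n.-tuple (measurableTypeR R)) -> \bar R :=
  match n with
  | 0 => fun E => \d_([tuple] : 0.-tuple (measurableTypeR R)) E
  | n'.+1 => fun E =>
      \int[lebesgue_measure]_x
        lebesgue_Rn [set t : n'.-tuple (measurableTypeR R) | E (cons_tuple x t)]
  end.

Let tcons n (p : measurableTypeR R * n.-tuple (measurableTypeR R)) :
  n.+1.-tuple (measurableTypeR R) := cons_tuple p.1 p.2.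

Let tuncons n (t : n.+1.-tuple (measurableTypeR R)) :
  measurableTypeR R * n.-tuple (measurableTypeR R) := (thead t, behead_tuple t).

Let tconsK n (p : measurableTypeR R * n.-tuple (measurableTypeR R)) :
  tuncons (tcons p) = p.
Proof. by case: p => x t; congr pair; exact/val_inj. Qed.

Let measurable_tcons n : measurable_fun setT (@tcons n).
Proof. exact: measurable_cons. Qed.

Let measurable_tuncons n : measurable_fun setT (@tuncons n).
Proof.
apply/measurable_fun_pair; first exact: measurable_tnth.
apply/measurable_fun_tnthP => i.
rewrite (_ : _ \o _ = fun t => tnth t (lift ord0 i)); first exact: measurable_tnth.
by apply/funext => t; rewrite /= tnth_behead; congr tnth; apply/val_inj; rewrite /= inordK// ltnS.
Qed.

Let lebesgue_Rn_ge0 n (E : set (n.-tuple (measurableTypeR R))) : 0 <= lebesgue_Rn E.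
Proof. by elim: n E => [|n ih] E /=; [|apply: integral_ge0]. Qed.

Let lebesgue_Rn_measure n :
  exists mu : {sigma_finite_measure set (n.-tuple (measurableTypeR R)) -> \bar R},
    mu = @lebesgue_Rn n :> (set _ -> \bar R).
Proof.
elim: n => [|n [mu muE]].
  by exists (\d_([tuple] : 0.-tuple (measurableTypeR R))).
pose m := pushforward (lebesgue_measure \x mu) (@tcons n).
have mE : m = @lebesgue_Rn n.+1.
  apply/funext => E; rewrite /m /pushforward /product_measure1 /=.
  apply: eq_integral => x _ /=; rewrite muE; congr lebesgue_Rn.
  by apply/seteqP; split => t /=; rewrite /xsection /= inE.
have sm : sigma_finite setT m.
  have [F FT Fm] := sigma_finite_prod lebesgue_measure mu.
  exists (fun k => @tuncons n @^-1` F k).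
    apply/seteqP; split=> // t _.
    by have : setT (tuncons t) by []; rewrite FT => -[k _ Fk]; exists k.
  move=> k; have [mF Ff] := Fm k; split.
    by rewrite -[X in measurable X]setTI; exact: measurable_tuncons.
  rewrite /m /pushforward (_ : _ @^-1` _ = F k)//.
  by apply/seteqP; split => p /=; rewrite tconsK.
have mm := @measurable_tcons n.
have m_ge0 E : 0 <= m E by rewrite mE lebesgue_Rn_ge0.
have m0 : m set0 = 0 by rewrite /m /pushforward preimage_set0 measure0.
rewrite -mE; apply: ex_sigma_finite_measure => //.
exact: semi_sigma_additive_preimage.
Qed.

Let lebesgue_Rn0 n : lebesgue_Rn (@set0 (n.-tuple (measurableTypeR R))) = 0.
Proof. by have [mu <-] := lebesgue_Rn_measure n; rewrite measure0. Qed.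

Let lebesgue_Rn_sigma_additive n : semi_sigma_additive (@lebesgue_Rn n).
Proof.
by have [mu <-] := lebesgue_Rn_measure n; exact: measure_semi_sigma_additive.
Qed.

HB.instance Definition _ n := isMeasure.Build _ _ _ (@lebesgue_Rn n)
  (lebesgue_Rn0 n) (@lebesgue_Rn_ge0 n) (@lebesgue_Rn_sigma_additive n).

Let lebesgue_Rn_sigma_finite n : sigma_finite setT (@lebesgue_Rn n).
Proof. by have [mu <-] := lebesgue_Rn_measure n; exact: sigma_finiteT. Qed.

HB.instance Definition _ n := Measure_isSigmaFinite.Build _ _ _ (@lebesgue_Rn n)
  (@lebesgue_Rn_sigma_finite n).

End lebesgue_Rn.
Arguments lebesgue_Rn R n E : clear implicits.

Section euclidean.
Context {R : realType} {d : nat}.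
Implicit Types x y : 'rV[R]_d.

(* The library norm of ['rV_d] is the maximum norm, hence these. *)
Definition dot x y : R := \sum_(i < d) x ord0 i * y ord0 i.

Definition enorm x : R := Num.sqrt (dot x x).

Definition basis (i : 'I_d) : 'rV[R]_d := delta_mx ord0 i.

Definition sphere : set 'rV[R]_d := [set x | enorm x = 1].

(* the retraction x |-> x / |x| of R^d \ {0} onto the sphere *)
Definition radial x : 'rV[R]_d := (enorm x)^-1 *: x.

Definition tangent (s : 'rV[R]_d) : set 'rV[R]_d := [set X | dot s X = 0].

(* for s on the sphere, the orthogonal projection onto its tangent space at s *)
Definition tproj (s X : 'rV[R]_d) : 'rV[R]_d := X - dot s X *: s.

Definition partial (i : 'I_d) (f : 'rV[R]_d -> R) : 'rV[R]_d -> R :=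
  fun x => 'D_(basis i) f x.

Fixpoint Ck_on (k : nat) (U : set 'rV[R]_d) (f : 'rV[R]_d -> R) : Prop :=
  match k with
  | 0 => forall x, U x -> {for x, continuous f}
  | k'.+1 => forall i,
      (forall x, U x -> derivable f x (basis i)) /\ Ck_on k' U (partial i f)
  end.

(* C^oo on the open set U *)
Definition smooth_on (U : set 'rV[R]_d) (f : 'rV[R]_d -> R) : Prop :=
  forall k, Ck_on k U f.

Definition smooth_map_on n (U : set 'rV[R]_d) (F : 'rV[R]_d -> 'rV[R]_n) : Prop :=
  forall l, smooth_on U (fun x => F x ord0 l).

Definition partial_map n (i : 'I_d) (F : 'rV[R]_d -> 'rV[R]_n) (x : 'rV[R]_d) :
  'rV[R]_n := \row_l partial i (fun y => F y ord0 l) x.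

End euclidean.

Section forms.
Context {R : realType}.

(* A 2-form on R^d is given by its antisymmetric matrix of components. *)
Definition is_closed_2form d (B : 'rV[R]_d -> 'M[R]_d) : Prop :=
  forall x i j k, partial i (fun y => B y j k) x + partial j (fun y => B y k i) x
    + partial k (fun y => B y i j) x = 0.

Record smooth_closed_csupp_2form d (B : 'rV[R]_d -> 'M[R]_d) : Prop := {
  two_form_antisym : forall x i j, B x i j = - B x j i ;
  two_form_smooth : forall i j, smooth_on setT (fun x => B x i j) ;
  two_form_closed : is_closed_2form B ;
  two_form_csupp : compact (closure [set x | B x != 0]) }.

(* Metric and 2-form pulled back by F : R^m -> R^n, in the coordinates of R^m;
   [pullback_metric] is the pullback of the Euclidean metric. *)
Definition pullback_metric m n (F : 'rV[R]_m -> 'rV[R]_n) (q : 'rV[R]_m) : 'M[R]_m :=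
  \matrix_(j, k) dot (partial_map j F q) (partial_map k F q).

Definition pullback_2form m n (F : 'rV[R]_m -> 'rV[R]_n)
    (B : 'rV[R]_n -> 'M[R]_n) (q : 'rV[R]_m) : 'M[R]_m :=
  \matrix_(j, k) \sum_(a < n) \sum_(b < n)
    B (F q) a b * partial_map j F q ord0 a * partial_map k F q ord0 b.

(* the sign of i |-> t_i if it is a permutation, and 0 otherwise *)
Definition levi_civita n (t : n.-tuple 'I_n) : R :=
  if [pick s : 'S_n | [forall i, s i == tnth t i]] is Some s then (-1) ^+ s else 0.

(* the component of index l of the contravariant Hodge dual of w, for the metric g *)
Definition hodge_2form m (g w : 'M[R]_m.+2) (l : m.-tuple 'I_m.+2) : R :=
  2^-1 * \sum_(j < m.+2) \sum_(k < m.+2)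
    (Num.sqrt (\det g))^-1 * levi_civita [tuple of rcons (rcons l j) k] * w j k.

Definition poincare_gauge d (B : 'rV[R]_d -> 'M[R]_d) (x : 'rV[R]_d) : 'rV[R]_d :=
  \row_j (\int[lebesgue_measure]_(u in `[0, 1])
            \sum_(l < d) x ord0 l * B (u *: x) l j * u)%R.

(* The form A(., r) on the sphere, evaluated at s on a tangent vector X. *)
Definition sphere_potential d (B : 'rV[R]_d -> 'M[R]_d) (r : R) (s X : 'rV[R]_d) : R :=
  r * dot (poincare_gauge B (r *: s)) X.

End forms.

Section sphere_calculus.
Context {R : realType} {d : nat}.
Implicit Types (s X : 'rV[R]_d) (phi : 'rV[R]_d -> R[i]).

Definition smooth_on_sphere (f : 'rV[R]_d -> R) : Prop :=
  forall s, sphere s -> exists (W : set 'rV[R]_d) (F : 'rV[R]_d -> R),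
    [/\ open W, W s, smooth_on W F & forall x, W x -> sphere x -> f x = F x].

Definition csmooth_on_sphere phi : Prop :=
  smooth_on_sphere (fun x => complex.Re (phi x)) /\
  smooth_on_sphere (fun x => complex.Im (phi x)).

(* d'f at s, evaluated on a tangent vector X: as [radial] retracts onto the
   sphere, this is the derivative of the extension [f \o radial] of f. *)
Definition sphere_diff (f : 'rV[R]_d -> R) s X : R := 'D_X (f \o radial) s.

Definition csphere_diff phi s X : R[i] :=
  Complex (sphere_diff (fun x => complex.Re (phi x)) s X)
          (sphere_diff (fun x => complex.Im (phi x)) s X).

Definition sqnormc (z : R[i]) : R := complex.Re z ^+ 2 + complex.Im z ^+ 2.

(* Squared norm, for the round metric, of a complex covector a at s: the sum of
   |a(e)|^2 over an orthonormal basis e of the tangent space. It is computed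
   from the projections P e_k of the standard basis, which satisfy
   sum_k (P e_k) (x) (P e_k) = sum_e e (x) e. *)
Definition sqconorm s (a : 'rV[R]_d -> R[i]) : R :=
  \sum_(k < d) sqnormc (a (tproj s (basis k))).

(* The covector X |-> sum_k w_k X_k. *)
Definition covector (w : 'rV[R[i]]_d) X : R[i] := \sum_(k < d) w ord0 k * (X ord0 k)%:C%C.

Definition row_of_tuple (t : d.-tuple (measurableTypeR R)) : 'rV[R]_d :=
  \row_i tnth t i.

(* Integral over the sphere for the surface measure:
   int_(0 < |x| < 1) f (x / |x|) dx = d^-1 int_(S^(d-1)) f d sigma. *)
Definition sphere_integral (f : 'rV[R]_d -> \bar R) : \bar R :=
  (d%:R%:E * \int[lebesgue_Rn R d]_(t in [set t | (0 < enorm (row_of_tuple t) < 1)%R])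
     f (radial (row_of_tuple t)))%E.

Definition sphere_measurable (f : 'rV[R]_d -> R) : Prop :=
  measurable_fun setT (fun t => f (radial (row_of_tuple t)) : measurableTypeR R).

Definition csphere_measurable phi : Prop :=
  sphere_measurable (fun x => complex.Re (phi x)) /\
  sphere_measurable (fun x => complex.Im (phi x)).

Definition sphere_L2 phi : Prop :=
  csphere_measurable phi /\ (sphere_integral (fun s => (sqnormc (phi s))%:E) < +oo)%E.

(* phi belongs to H^1(S^(d-1)), the completion of the smooth functions for the
   H^1 norm, and its differential d'phi is the square-integrable field of
   covectors w. *)
Definition sphere_H1 phi (w : 'rV[R]_d -> 'rV[R[i]]_d) : Prop :=
  [/\ sphere_L2 phi,
      (forall k, csphere_measurable (fun s => w s ord0 k)),
      (sphere_integral (fun s => (sqconorm s (covector (w s)))%:E) < +oo)%E &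
      exists u : nat -> 'rV[R]_d -> R[i],
      [/\ forall n, csmooth_on_sphere (u n),
          sphere_integral (fun s => (sqnormc (u n s - phi s))%:E) @[n --> \oo] --> 0%E &
          sphere_integral (fun s => (sqconorm s (fun X =>
            csphere_diff (u n) s X - covector (w s) X))%:E) @[n --> \oo] --> 0%E]].

(* The Rayleigh quotients take their values in [0, +oo[; the infimum is taken
   in the extended reals, where that of the empty set would be +oo. *)
Definition nu (B : 'rV[R]_d -> 'M[R]_d) (r : R) : \bar R :=
  ereal_inf [set q : \bar R | exists phi w,
    [/\ sphere_H1 phi w,
        sphere_integral (fun s => (sqnormc (phi s))%:E) != 0%E &
        q = (sphere_integral (fun s => (sqconorm s (fun X =>
               covector (w s) X
               - 'i%C * (sphere_potential B r s X)%:C%C * phi s))%:E)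
             * (fine (sphere_integral (fun s => (sqnormc (phi s))%:E)))^-1%:E)%E]].

End sphere_calculus.

Section local_coordinates.
Context {R : realType} {m : nat}.
Implicit Types (U : set 'rV[R]_m) (T : 'rV[R]_m -> 'rV[R]_m.+1).

(* T is the inverse of a local coordinate system of S^m with values in the open
   set U: a diffeomorphism of U onto an open subset of the sphere. *)
Definition sphere_coordinates U T : Prop :=
  [/\ open U, smooth_map_on U T &
      exists (W : set 'rV[R]_m.+1) (K : 'rV[R]_m.+1 -> 'rV[R]_m),
      [/\ open W, smooth_map_on W K, T @` U = W `&` sphere &
          forall q, U q -> K (T q) = q]].

(* Components, in these coordinates, of a 1-form on the sphere and of its
   exterior derivative. *)
Definition coord_1form T (a : 'rV[R]_m.+1 -> 'rV[R]_m.+1 -> R) (j : 'I_m)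
    (q : 'rV[R]_m) : R := a (T q) (partial_map j T q).

Definition coord_ext_deriv T (a : 'rV[R]_m.+1 -> 'rV[R]_m.+1 -> R)
    (q : 'rV[R]_m) : 'M[R]_m :=
  \matrix_(j, k) (partial j (coord_1form T a k) q - partial k (coord_1form T a j) q).

(* the map (q, r) |-> r T(q); the radial coordinate r has index [ord_max] and
   the j-th coordinate of q has index [lift ord_max j], of value j *)
Definition spherical_coordinates T (p : 'rV[R]_m.+1) : 'rV[R]_m.+1 :=
  p ord0 ord_max *: T (\row_j p ord0 (lift ord_max j)).

Definition spherical_point (q : 'rV[R]_m) (r : R) : 'rV[R]_m.+1 :=
  \row_j (if unlift ord_max j is Some k then q ord0 k else r).

End local_coordinates.

(* Main.v *)
(* All the conditions are equivalent to the vanishing of the restriction of B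
   to the sphere of radius r ([flat_on_sphere]), because d'A(., r) is the
   pullback of B by s |-> r s.

   If B is flat on the sphere, the pullback of A by x |-> r x / |x| is a closed
   1-form on R^d \ {0}. The Poincare lemma gives primitives of it on two slit
   domains, starshaped about opposite points; as d >= 3, their difference is
   constant on the overlap, so that A(., r) = d'f, and exp (i f) is parallel.

   If nu = 0, there are smooth u = v + i w with |u|^2 of integral 1 and
   arbitrarily small energy. Let om be the pullback of A, p and q the real and
   imaginary parts of (d - i om) u, rho = |u|^2 and J = v q - w p. Then
   rho d om = 2 p /\ q - dJ, where p, q and, in mean, J are small. Multiply by
   h = x /\ d om and integrate by parts along the Killing fields, which is
   possible because the surface measure is invariant under rotations: the
   integral of h^2 rho is small. As d rho is small too, rho cannot concentrate
   off the set where h^2 > 0: this is the divergence theorem for the field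
   exp (lam t) grad t, where t is the height above a point s0 with h s0 != 0.
   Hence h = 0, that is, B is flat.

   The Hodge duals are compared with B in a chart around each point whose Gram
   matrix at that point is the identity. *)

From HB Require Import structures.
From mathcomp Require Import all_boot all_order all_algebra all_fingroup.
From mathcomp Require Import complex ring lra.
From mathcomp Require Import all_classical all_reals all_analysis.
From mathcomp Require Import measurable_realfun.
Require Import Defs.

Set Implicit Arguments.
Unset Strict Implicit.
Unset Printing Implicit Defensive.

Import Order.TTheory GRing.Theory Num.Theory.
Import numFieldNormedType.Exports.

Local Open Scope classical_set_scope.
Local Open Scope ring_scope.

(** * Calculus in coordinates *)

(** A minimiser for nu would require a compact embedding of H^1 and then a regularity theory. The
    proof keeps instead to smooth functions of small energy, obtained by density, and reaches a
    contradiction with explicit constants. In the identity for rho d om, the term dJ is a derivative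
    of J, which the energy does not bound; it is harmless only once that derivative has been moved
    onto a factor independent of u. The choice of h for this factor gives h^2 rho on the left, which
    has a sign.

    The sphere is treated without charts as long as possible. A function on it is extended by the
    retraction x / |x|; the extension is constant along rays, so at points of the sphere its
    ordinary partial derivatives are the components of the intrinsic differential. Surface integrals
    are integrals of such extensions over the unit ball, and integration by parts rests on the
    invariance of Lebesgue measure under rotations. *)

Section differential_calculus.
Context {R : realType}.

(** Both difference quotients are the same function of h. One lemma thus serves restrictions to
    lines, translations and affine charts. *)
Lemma is_derive_affine {V V' W : normedModType R} (G : V -> V') (f : V' -> W)
    (x v : V) (w : V') df :
  (forall h : R, G (h *: v + x) = h *: w + G x) ->
  is_derive (G x) w f df -> is_derive x v (f \o G) df.
Proof.
move=> GE; have E : (fun h : R => h^-1 *: (((f \o G) \o shift x) (h *: v) - (f \o G) x)) =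
    (fun h => h^-1 *: ((f \o shift (G x)) (h *: w) - f (G x))).
  by apply/funext => h /=; rewrite GE.
by move=> [d1 d2]; split; rewrite ?/derivable ?/derive E.
Qed.

Lemma is_derive_line {V W : normedModType R} (f : V -> W) (x v : V) (t : R) df :
  is_derive (t *: v + x) v f df -> is_derive t 1 (fun t : R => f (t *: v + x)) df.
Proof.
apply: (@is_derive_affine R^o V W (fun t : R^o => t *: v + x)) => h.
by rewrite [h *: 1]mulr1 scalerDl addrA.
Qed.

Lemma is_derive_line0 {V W : normedModType R} (f : V -> W) (x v : V) :
  derivable f x v -> is_derive (0 : R) 1 (fun t : R => f (t *: v + x)) ('D_v f x).
Proof. by move=> fxv; apply: is_derive_line; rewrite scale0r add0r; split. Qed.

(** The hypotheses are on an interval symmetric about 0 so that c may have either sign; the mean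
    value theorem is applied on [0, c] or on [c, 0]. *)
Lemma mvt_bound (g dg : R -> R) (l e c : R) :
  (forall t : R, `|t| <= `|c| -> is_derive t 1 g (dg t)) ->
  (forall t : R, `|t| <= `|c| -> `|dg t - l| <= e) ->
  `|g c - g 0 - c * l| <= e * `|c|.
Proof.
move=> gd gb.
have cg (i : interval R) : (forall x, x \in i -> `|x| <= `|c|) ->
    {within [set` i], continuous g}.
  move=> ic; apply: derivable_within_continuous => x xi.
  by have [] := gd _ (ic _ xi).
have [c0|c0] := leP 0 c.
- have cE x : x \in `[0, c] -> `|x| <= `|c|.
    by rewrite in_itv/= => /andP[x0 xc]; rewrite !ger0_norm.
  have [|x xi ->] := @MVT_segment R g dg _ _ c0 _ (cg _ cE).
    by move=> x /subset_itv_oo_cc /cE; exact: gd.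
  rewrite subr0 mulrC -mulrBr normrM mulrC ler_wpM2r//; exact/gb/cE.
- have cE x : x \in `[c, 0] -> `|x| <= `|c|.
    by rewrite in_itv/= => /andP[x0 xc]; rewrite !ler0_norm ?lerN2// ltW.
  have [|x xi E] := @MVT_segment R g dg _ _ (ltW c0) _ (cg _ cE).
    by move=> x /subset_itv_oo_cc /cE; exact: gd.
  have -> : g c - g 0 - c * l = c * (dg x - l) by rewrite mulrBr mulrC; lra.
  by rewrite normrM mulrC ler_wpM2r//; exact/gb/cE.
Qed.

Lemma cvg_sumr {T : Type} (F : set_system T) {FF : Filter F} (I : Type) (s : seq I)
    (f : I -> T -> R) (l : I -> R) :
  (forall i, f i x @[x --> F] --> l i) ->
  \sum_(i <- s) f i x @[x --> F] --> \sum_(i <- s) l i.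
Proof.
move=> fl; elim: s => [|i s ih].
  by rewrite big_nil; under eq_fun do rewrite big_nil; exact: cvg_cst.
by rewrite big_cons; under eq_fun do rewrite big_cons; exact: cvgD.
Qed.

Context {d : nat}.
Implicit Types (f g : 'rV[R]_d -> R) (x v : 'rV[R]_d).

Lemma dotDl (a b v : 'rV[R]_d) : dot (a + b) v = dot a v + dot b v.
Proof. by rewrite -big_split; apply: eq_bigr => i _; rewrite !mxE mulrDl. Qed.

Lemma dotC (a b : 'rV[R]_d) : dot a b = dot b a.
Proof. by apply: eq_bigr => i _; rewrite mulrC. Qed.

Lemma dotDr (a b v : 'rV[R]_d) : dot v (a + b) = dot v a + dot v b.
Proof. by rewrite dotC dotDl !(dotC v). Qed.

Lemma dotZl k (a v : 'rV[R]_d) : dot (k *: a) v = k * dot a v.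
Proof. by rewrite /dot mulr_sumr; apply: eq_bigr => i _; rewrite !mxE mulrA. Qed.

Lemma dotZr k (a v : 'rV[R]_d) : dot v (k *: a) = k * dot v a.
Proof. by rewrite dotC dotZl dotC. Qed.

Lemma dotNl (a v : 'rV[R]_d) : dot (- a) v = - dot a v.
Proof. by rewrite -scaleN1r dotZl mulN1r. Qed.

Lemma dotNr (a v : 'rV[R]_d) : dot v (- a) = - dot v a.
Proof. by rewrite dotC dotNl dotC. Qed.

Lemma dot_basis (a : 'rV[R]_d) i : dot a (basis i) = a ord0 i.
Proof.
rewrite /dot (bigD1 i)//= big1 ?addr0.
  by rewrite mxE !eqxx mulr1.
by move=> j ji; rewrite mxE (negbTE ji) andbF mulr0.
Qed.

Lemma row_sum_basis v : v = \sum_i v ord0 i *: basis i.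
Proof. exact: row_sum_delta. Qed.

(** The increment from x to x + h is split along a staircase that changes one coordinate at a time,
    and the mean value theorem is applied on each leg. *)
Lemma partials_differentiable f x :
  (\forall y \near x, forall i, derivable f y (basis i)) ->
  (forall i, {for x, continuous (partial i f)}) -> differentiable f x.
Proof.
move=> fd fc.
pose a : 'rV[R]_d := \row_i partial i f x.
have dlin : linear (dot a : _ -> R^o).
  by move=> k u v; rewrite dotDr dotZr.
pose dfM := GRing.isLinear.Build _ _ _ _ _ dlin.
pose df : {linear 'rV[R]_d -> R^o} := HB.pack (dot a : _ -> R^o) dfM.
have dfE v : df v = \sum_i v ord0 i * partial i f x.
  by rewrite -/(dot a v); apply: eq_bigr => i _; rewrite mxE mulrC.
have dfc : continuous df.
  move=> v; apply: (@cvg_sumr _ (nbhs v)) => /= i.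
  by apply: cvgM; [exact: cvg_cst|exact: coord_continuous].
have uniq := @diff_unique R 'rV[R]_d R^o f df x dfc.
(* [dfo] is the little-o expansion that [diff_unique] expects, taken from its type instead of being
   restated. *)
match type of uniq with ?P -> _ => have dfo : P end.
  apply/eqaddoP => e0 e0_gt0.
  (* The error is shared among d legs; dividing by d + 1 covers d = 0 as well. *)
  pose e := e0 / (d.+1)%:R.
  have e_gt0 : 0 < e by rewrite divr_gt0.
  have : \forall y \near x, forall i, derivable f y (basis i) /\
      `|partial i f y - partial i f x| <= e.
    near=> y; move=> i; split; first by move: i; near: y.
    rewrite distrC; move: i; near: y; apply: filter_forall => i.
    exact: (cvgrPdist_le _ _).1 (fc i) _ e_gt0.
  move=> /nbhs_ballP[r /= r0 rP].
  apply/nbhs_ballP; exists r => //= h; rewrite -ball_normE/= sub0r normrN => hr.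
  (* [tr k] keeps the first k coordinates of h, so it runs from 0 to h. *)
  pose tr k : 'rV[R]_d := \row_i (if (i < k)%N then h ord0 i else 0).
  have tr0 : tr 0%N = 0 by apply/rowP => i; rewrite !mxE.
  have trd : tr d = h by apply/rowP => i; rewrite !mxE ltn_ord.
  have tS (i : 'I_d) : tr i.+1 = h ord0 i *: basis i + tr i.
    apply/rowP => j; rewrite !mxE eqxx/= ltnS eq_sym.
    case: (ltngtP j i) => [ji|ij|/val_inj ->].
    - by rewrite -val_eqE/= gtn_eqF// mulr0 add0r.
    - by rewrite -val_eqE/= ltn_eqF// mulr0 add0r.
    - by rewrite eqxx mulr1 addr0.
  have coordle (w : 'rV[R]_d) i : `|w ord0 i| <= `|w|.
    rewrite [leRHS]/Num.Def.normr/= mx_normrE.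
    exact: (le_bigmax _ (fun ij => `|w ij.1 ij.2|) (ord0, i)).
  have key (i : 'I_d) : `|f (tr i.+1 + x) - f (tr i + x) - h ord0 i * partial i f x|
      <= e * `|h|.
    (* The norm is the maximum norm, so every point of a leg is at distance at most |h| from x. *)
    have near_seg t : `|t| <= `|h ord0 i| -> ball x r (t *: basis i + (tr i + x)).
      move=> th; rewrite -ball_normE/= addrA opprD addrCA subrr addr0 normrN.
      rewrite (le_lt_trans _ hr)//.
      rewrite [leLHS]/Num.Def.normr/= mx_normrE (bigmax_le _ (normr_ge0 _))//=.
      move=> [i0 j] _; rewrite (ord1 i0) !mxE eqxx/= eq_sym.
      have [<-|ji] := eqVneq i j.
        by rewrite ltnn mulr1 addr0 (le_trans th).
      by rewrite mulr0 add0r; case: ifP; rewrite ?normr0.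
    pose g (t : R) := f (t *: basis i + (tr i + x)).
    have -> : f (tr i.+1 + x) = g (h ord0 i) by rewrite tS /g addrA.
    have -> : f (tr i + x) = g 0 by rewrite /g scale0r add0r.
    apply: le_trans (_ : e * `|h ord0 i| <= _); last by rewrite ler_wpM2l// ltW.
    apply: (@mvt_bound g (fun t => partial i f (t *: basis i + (tr i + x)))).
    - by move=> t /near_seg/rP/(_ i)[fdi _]; apply: is_derive_line; split.
    - by move=> t /near_seg/rP/(_ i)[_ +].
  have -> : (f \o shift x - (cst (f x) + df)) h = \sum_(i < d)
      (f (tr i.+1 + x) - f (tr i + x) - h ord0 i * partial i f x).
    rewrite sumrB -dfE.
    rewrite -(big_mkord xpredT (fun i => f (tr i.+1 + x) - f (tr i + x))).
    rewrite telescope_sumr//.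
    rewrite trd tr0 add0r.
    by rewrite !fctE/= opprD addrA.
  rewrite (le_trans (ler_norm_sum _ _ _))//.
  rewrite (le_trans (ler_sum _ (fun i _ => key i)))//.
  rewrite sumr_const card_ord -mulr_natl mulrA ler_wpM2r//.
  by rewrite /e mulrA ler_pdivrMr// mulrC ler_wpM2l ?ler_nat// ltW.
apply/diff_locallyP; rewrite (uniq dfo); split => //.
Unshelve. all: by end_near. Qed.

Lemma derive_partial f x v : differentiable f x ->
  'D_v f x = \sum_i v ord0 i * partial i f x.
Proof.
move=> fd; rewrite deriveE// {1}(row_sum_basis v) linear_sum.
by apply: eq_bigr => i _; rewrite linearZ /partial deriveE.
Qed.

End differential_calculus.

Section chain_rule.
Context {R : realType}.

(** F is only assumed to have a derivative in the direction v. Restricted to the line t |-> t v + x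
    it is a differentiable function of one variable, and the chain rule for differentials
    applies. *)
Lemma is_derive_comp {V : normedModType R} n (G : 'rV[R]_n -> R) (F : V -> 'rV[R]_n) (x v : V) :
  differentiable G (F x) ->
  (forall l, derivable (fun y => F y ord0 l) x v) ->
  is_derive x v (G \o F)
    (\sum_l partial l G (F x) * 'D_v (fun y => F y ord0 l) x).
Proof.
move=> dG dF.
have dFx : derivable F x v by apply/derivable_mxP => i j; rewrite (ord1 i).
pose c (t : R) := F (t *: v + x).
have c0 : c 0 = F x by rewrite /c scale0r add0r.
have dc : differentiable c 0.
  by apply/derivable1_diffP; have [] := is_derive_line0 dFx.
have dGc : differentiable (G \o c) 0.
  by apply: differentiable_comp => //; rewrite c0.
have D : derivable (G \o F) x v.
  by apply/derivable1P; apply/derivable1_diffP.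
split=> //.
have [_ <-] := is_derive_line0 D.
transitivity ('D_(1 : R) (G \o c) 0); first by [].
rewrite deriveE// diff_comp//=; last by rewrite c0.
rewrite -(@deriveE _ _ _ c 0 1 dc) c0 -(@deriveE _ _ _ G (F x) _ dG).
have [_ ->] := is_derive_line0 dFx.
rewrite derive_partial// derive_mx//; apply: eq_bigr => l _.
by rewrite mxE mulrC.
Qed.

End chain_rule.

(** * Functions of class C^k and C^oo *)

Section smoothness.
Context {R : realType} {d : nat}.

Lemma is_derive_translate {V W : normedModType R} (f : V -> W) (x v w : V) df :
  is_derive (x + w) v f df -> is_derive x v (fun y => f (y + w)) df.
Proof. by apply: (is_derive_affine (G := fun y => y + w)) => h; rewrite addrA. Qed.

Implicit Types (f g : 'rV[R]_d -> R) (x v : 'rV[R]_d) (U : set 'rV[R]_d).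

Lemma row_continuous {T : topologicalType} n (F : T -> 'rV[R]_n) (x : T) :
  (forall l, {for x, continuous (fun y => F y ord0 l)}) -> {for x, continuous F}.
Proof.
move=> Fx; apply/cvgrPdist_le => /= e e0; near=> y.
rewrite [leLHS]/Num.Def.normr/= mx_normrE (bigmax_le _ (ltW e0))//= => -[i l] _.
rewrite (ord1 i) !mxE/=; move: l {i}; near: y; apply: filter_forall => /= l.
exact: (cvgrPdist_le _ _).1 (Fx l) _ e0.
Unshelve. all: by end_near. Qed.

Lemma open_near U x : open U -> U x -> \forall y \near x, U y.
Proof. by move=> oU Ux; exact: open_nbhs_nbhs. Qed.

Lemma continuous_near_eq {T S : topologicalType} (f g : T -> S) (x : T) :
  (\forall y \near x, f y = g y) -> {for x, continuous f} -> {for x, continuous g}.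
Proof.
move=> fg fx; have gx : g y @[y --> x] --> f x.
  by apply: cvg_trans fx; exact: near_eq_cvg.
by rewrite (nbhs_singleton fg) in gx.
Qed.

Lemma Ck_on_ext k U f g : open U -> (forall x, U x -> f x = g x) ->
  Ck_on k U f -> Ck_on k U g.
Proof.
move=> oU; elim: k f g => [|k ih] f g fg /= fC.
  move=> x Ux; apply: continuous_near_eq (fC x Ux).
  by apply: filterS (open_near oU Ux) => y; exact: fg.
move=> i; have [fd fk] := fC i; split.
  move=> x Ux; apply: near_eq_derivable (fd _ Ux).
  by near do apply: fg; exact: open_near.
apply: ih fk => x Ux; apply: near_eq_derive.
by near do apply: fg; exact: open_near.
Unshelve. all: by end_near. Qed.

Lemma Ck_on_sub k U V f : V `<=` U -> Ck_on k U f -> Ck_on k V f.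
Proof.
move=> VU; elim: k f => [|k ih] f /= fC; first by move=> x /VU; exact: fC.
by move=> i; have [fd fk] := fC i; split; [move=> x /VU; exact: fd|exact: ih].
Qed.

Lemma Ck_on_differentiable U f x : open U -> Ck_on 1 U f -> U x ->
  differentiable f x.
Proof.
move=> oU fC Ux; apply: partials_differentiable.
  by near=> y => i; apply: (fC i).1; near: y; exact: open_near.
by move=> i; exact: (fC i).2.
Unshelve. all: by end_near. Qed.

(** By definition [Ck_on k.+1] speaks of partial derivatives alone; continuity of f itself comes
    from its differentiability. *)
Lemma Ck_onW k U f : open U -> Ck_on k.+1 U f -> Ck_on k U f.
Proof.
move=> oU; elim: k f => [|k ih] f fC.
  move=> x Ux; apply: differentiable_continuous.
  exact: Ck_on_differentiable fC Ux.
by move=> i; split; [exact: (fC i).1|apply: ih; exact: (fC i).2].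
Qed.

Lemma Ck_on_cst k U (a : R) : open U -> Ck_on k U (fun=> a).
Proof.
move=> oU; elim: k a => [|k ih] a /=; first by move=> x _; exact: cst_continuous.
move=> i; split; first by move=> x _; exact: derivable_cst.
apply: Ck_on_ext (ih 0) => // x _.
by rewrite /partial derive_cst.
Qed.

Lemma Ck_onD k U f g : open U -> Ck_on k U f -> Ck_on k U g ->
  Ck_on k U (fun x => f x + g x).
Proof.
move=> oU; elim: k f g => [|k ih] f g fC gC.
  by move=> x Ux; exact: (continuousD (fC x Ux) (gC x Ux)).
move=> i; have [fd fk] := fC i; have [gd gk] := gC i; split.
  by move=> x Ux; apply: derivableD; [exact: fd|exact: gd].
apply: Ck_on_ext (ih _ _ fk gk) => // x Ux.
by rewrite /partial deriveD//; [exact: fd|exact: gd].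
Qed.

Lemma Ck_onM k U f g : open U -> Ck_on k U f -> Ck_on k U g ->
  Ck_on k U (fun x => f x * g x).
Proof.
move=> oU; elim: k f g => [|k ih] f g fC gC.
  by move=> x Ux; exact: (continuousM (fC x Ux) (gC x Ux)).
move=> i; have [fd fk] := fC i; have [gd gk] := gC i; split.
  by move=> x Ux; apply: derivableM; [exact: fd|exact: gd].
have f0 := Ck_onW oU fC; have g0 := Ck_onW oU gC.
apply: Ck_on_ext (Ck_onD oU (ih _ _ f0 gk) (ih _ _ g0 fk)) => // x Ux.
by rewrite /partial deriveM//; [exact: fd|exact: gd].
Qed.

Lemma Ck_on_sum k U I (s : seq I) (f : I -> 'rV[R]_d -> R) : open U ->
  (forall i, Ck_on k U (f i)) -> Ck_on k U (fun x => \sum_(i <- s) f i x).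
Proof.
move=> oU fC; elim: s => [|i s ih].
  by apply: Ck_on_ext (Ck_on_cst _ _ oU) => // x _; rewrite big_nil.
by apply: Ck_on_ext (Ck_onD oU (fC i) ih) => // x _; rewrite big_cons.
Qed.

Lemma partial_coord i j x :
  partial i (fun y : 'rV[R]_d => y ord0 j) x = (i == j)%:R.
Proof.
rewrite /partial deriveE; last exact: differentiable_coord.
have lin : linear (fun y : 'rV[R]_d => y ord0 j : R^o).
  by move=> k u w; rewrite !mxE.
pose fM := GRing.isLinear.Build _ _ _ _ _ lin.
pose f : {linear 'rV[R]_d -> R^o} := HB.pack (fun y : 'rV[R]_d => y ord0 j : R^o) fM.
rewrite (@diff_lin _ _ _ f)/=; last exact: coord_continuous.
by rewrite mxE eqxx/= eq_sym.
Qed.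

Lemma Ck_on_coord k U j : open U -> Ck_on k U (fun y : 'rV[R]_d => y ord0 j).
Proof.
move=> oU; case: k => [|k]; first by move=> x _; exact: coord_continuous.
move=> i; split.
  by move=> x _; apply: diff_derivable; exact: differentiable_coord.
apply: Ck_on_ext (Ck_on_cst _ (i == j)%:R oU) => // x _.
by rewrite partial_coord.
Qed.

Lemma is_derive_comp1 (h : R -> R) f x v l : derivable f x v ->
  is_derive (f x) 1 h l -> is_derive x v (fun y => h (f y)) (l * 'D_v f x).
Proof.
move=> fxv hl; have fl := is_derive_line0 fxv.
have hl' : is_derive (f ((0 : R) *: v + x)) 1 h l by rewrite scale0r add0r.
have D := is_derive1_comp hl' fl.
have Dx : derivable (fun y => h (f y)) x v.
  by apply/derivable1P; have [] := D.
by split => //; have [_ <-] := is_derive_line0 Dx; have [_ <-] := D.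
Qed.

(** [h] is the whole sequence of successive derivatives, so that the induction on k can pass from
    [h m] to [h m.+1]. *)
Lemma Ck_on_comp1 k U (V : set R) (h : nat -> R -> R) f m : open U ->
  (forall n y, V y -> is_derive y 1 (h n) (h n.+1 y)) ->
  (forall x, U x -> V (f x)) -> Ck_on k U f -> Ck_on k U (fun x => h m (f x)).
Proof.
move=> oU hd fV; elim: k m => [|k ih] m fC.
  move=> x Ux; apply: (@continuous_comp _ _ _ f (h m)); first exact: fC.
  apply/differentiable_continuous/derivable1_diffP.
  by have [] := hd m _ (fV _ Ux).
move=> i; have [fd fk] := fC i; split.
  by move=> x Ux; have [] := is_derive_comp1 (fd _ Ux) (hd m _ (fV _ Ux)).
apply: Ck_on_ext (Ck_onM oU (ih m.+1 (Ck_onW oU fC)) fk) => // x Ux.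
by have [_ <-] := is_derive_comp1 (fd _ Ux) (hd m _ (fV _ Ux)).
Qed.

Lemma smooth_on_ext U f g : open U -> (forall x, U x -> f x = g x) ->
  smooth_on U f -> smooth_on U g.
Proof. by move=> oU fg fC k; exact: Ck_on_ext (fC k). Qed.

Lemma smooth_on_sub U V f : V `<=` U -> smooth_on U f -> smooth_on V f.
Proof. by move=> VU fC k; exact: Ck_on_sub (fC k). Qed.

Lemma smooth_on_cst U (a : R) : open U -> smooth_on U (fun=> a).
Proof. by move=> oU k; exact: Ck_on_cst. Qed.

Lemma smooth_onD U f g : open U -> smooth_on U f -> smooth_on U g ->
  smooth_on U (fun x => f x + g x).
Proof. by move=> oU fC gC k; exact: Ck_onD. Qed.

Lemma smooth_onM U f g : open U -> smooth_on U f -> smooth_on U g ->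
  smooth_on U (fun x => f x * g x).
Proof. by move=> oU fC gC k; exact: Ck_onM. Qed.

Lemma smooth_onZ U f (a : R) : open U -> smooth_on U f ->
  smooth_on U (fun x => a * f x).
Proof. by move=> oU fC; apply: smooth_onM => //; exact: smooth_on_cst. Qed.

Lemma smooth_onN U f : open U -> smooth_on U f -> smooth_on U (fun x => - f x).
Proof.
move=> oU fC; apply: smooth_on_ext (smooth_onZ (- 1) oU fC) => // x _.
by rewrite mulN1r.
Qed.

Lemma smooth_onB U f g : open U -> smooth_on U f -> smooth_on U g ->
  smooth_on U (fun x => f x - g x).
Proof. by move=> oU fC gC; apply: smooth_onD => //; exact: smooth_onN. Qed.

Lemma smooth_on_sum U I (s : seq I) (f : I -> 'rV[R]_d -> R) : open U ->
  (forall i, smooth_on U (f i)) -> smooth_on U (fun x => \sum_(i <- s) f i x).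
Proof. by move=> oU fC k; apply: Ck_on_sum => // i; exact: fC. Qed.

Lemma smooth_on_coord U j : open U -> smooth_on U (fun y : 'rV[R]_d => y ord0 j).
Proof. by move=> oU k; exact: Ck_on_coord. Qed.

Lemma smooth_on_partial U f i : smooth_on U f -> smooth_on U (partial i f).
Proof. by move=> fC k; exact: (fC k.+1 i).2. Qed.

Lemma smooth_on_comp1 U (V : set R) (h : nat -> R -> R) f m : open U ->
  (forall n y, V y -> is_derive y 1 (h n) (h n.+1 y)) ->
  (forall x, U x -> V (f x)) -> smooth_on U f -> smooth_on U (fun x => h m (f x)).
Proof. by move=> oU hd fV fC k; exact: Ck_on_comp1 hd fV (fC k). Qed.

Lemma smooth_on_differentiable U f x : open U -> smooth_on U f -> U x ->
  differentiable f x.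
Proof. by move=> oU fC; exact: Ck_on_differentiable. Qed.

Lemma smooth_on_derivable U f x v : open U -> smooth_on U f -> U x ->
  derivable f x v.
Proof.
by move=> oU fC Ux; exact/diff_derivable/(smooth_on_differentiable oU fC Ux).
Qed.

Lemma smooth_on_continuous U f x : open U -> smooth_on U f -> U x ->
  {for x, continuous f}.
Proof. by move=> oU fC; exact: (fC 0). Qed.

Lemma smooth_on_local U f :
  (forall x, U x -> exists V, [/\ open V, V x & smooth_on V f]) -> smooth_on U f.
Proof.
move=> H k; elim: k f H => [|k ih] f H.
  by move=> x /H[V [oV Vx fC]]; exact: (smooth_on_continuous oV fC).
move=> i; split.
  by move=> x /H[V [oV Vx fC]]; exact: smooth_on_derivable oV fC Vx.
apply: ih => x /H[V [oV Vx fC]]; exists V; split => //.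
exact: smooth_on_partial.
Qed.

End smoothness.

Section smooth_composition.
Context {R : realType} {d n : nat}.
Implicit Types (x v : 'rV[R]_d) (U : set 'rV[R]_d) (W : set 'rV[R]_n).
Implicit Types (F : 'rV[R]_d -> 'rV[R]_n).

Lemma smooth_map_is_derive U W F (G : 'rV[R]_n -> R) x v :
  open U -> open W -> smooth_map_on U F -> smooth_on W G -> U x -> W (F x) ->
  is_derive x v (fun y => G (F y))
    (\sum_l partial l G (F x) * 'D_v (fun y => F y ord0 l) x).
Proof.
move=> oU oW FC GC Ux WFx; apply: is_derive_comp.
  exact: smooth_on_differentiable GC WFx.
by move=> l; exact: smooth_on_derivable (FC l) Ux.
Qed.

Lemma smooth_map_partial U W F (G : 'rV[R]_n -> R) x i :
  open U -> open W -> smooth_map_on U F -> smooth_on W G -> U x -> W (F x) ->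
  partial i (fun y => G (F y)) x =
    \sum_l partial l G (F x) * partial_map i F x ord0 l.
Proof.
move=> oU oW FC GC Ux WFx.
have [_] := smooth_map_is_derive (basis i) oU oW FC GC Ux WFx.
by rewrite /partial => ->; apply: eq_bigr => l _; rewrite mxE.
Qed.

Lemma smooth_on_comp U W F (G : 'rV[R]_n -> R) : open U -> open W ->
  smooth_map_on U F -> smooth_on W G -> (forall x, U x -> W (F x)) ->
  smooth_on U (fun y => G (F y)).
Proof.
move=> oU oW FC GC UW k; elim: k G GC => [|k ih] G GC.
  move=> x Ux; apply: (@continuous_comp _ _ _ F G).
    by apply: row_continuous => l; exact: smooth_on_continuous (FC l) Ux.
  exact: smooth_on_continuous GC (UW _ Ux).
move=> i; split.
  by move=> x Ux; have [] := smooth_map_is_derive (basis i) oU oW FC GC Ux (UW _ Ux).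
have H l : Ck_on k U (fun y => partial l G (F y) * partial i (fun z => F z ord0 l) y).
  apply: Ck_onM => //; first by apply: ih; exact: smooth_on_partial.
  exact: (FC l k.+1 i).2.
apply: Ck_on_ext (Ck_on_sum (index_enum 'I_n) oU H) => // x Ux.
rewrite (smooth_map_partial i oU oW FC GC Ux (UW _ Ux)).
by apply: eq_bigr => l _; rewrite mxE.
Qed.

End smooth_composition.

(** * Symmetry of second derivatives *)

Section clairaut.
Context {R : realType} {d : nat}.
Implicit Types (f g : 'rV[R]_d -> R) (x v : 'rV[R]_d) (U : set 'rV[R]_d).

Lemma MVT_line f x v (h : R) : 0 < h ->
  (forall t, 0 <= t <= h -> derivable f (t *: v + x) v) ->
  exists2 t, 0 <= t <= h & f (h *: v + x) - f x = h * 'D_v f (t *: v + x).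
Proof.
move=> h0 fd.
have dl (t : R) : 0 <= t <= h -> is_derive t 1 (fun t : R => f (t *: v + x))
    ('D_v f (t *: v + x)).
  by move=> /fd ?; apply: is_derive_line; split.
have [||c ch E] := @MVT_segment R (fun t : R => f (t *: v + x))
    (fun t => 'D_v f (t *: v + x)) 0 h (ltW h0) _ _.
- by move=> t /subset_itv_oo_cc; rewrite in_itv/=; exact: dl.
- apply: derivable_within_continuous => t; rewrite in_itv/= => /dl.
  by case.
- exists c; first by move: ch; rewrite in_itv.
  by move: E; rewrite scale0r add0r subr0 mulrC.
Qed.

(** The mean value theorem is applied in the direction i to the increment of f in the direction j,
    then in the direction j to the partial derivative so obtained. *)
Lemma mixed_difference U f x (h : R) i j : smooth_on U f -> 0 < h ->
  (forall a b, 0 <= a <= h -> 0 <= b <= h -> U (a *: basis i + (b *: basis j + x))) ->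
  exists a b, [/\ 0 <= a <= h, 0 <= b <= h &
    f (h *: basis i + (h *: basis j + x)) - f (h *: basis i + x)
      - (f (h *: basis j + x) - f x) =
    h * (h * partial j (partial i f) (b *: basis j + (a *: basis i + x)))].
Proof.
move=> fC h0 hU.
have fd a b : 0 <= a <= h -> 0 <= b <= h ->
    derivable f (a *: basis i + (b *: basis j + x)) (basis i).
  by move=> ah bh; apply: (fC 1 i).1; exact: hU.
have z0 : 0 <= (0 : R) <= h by rewrite lexx ltW.
have hh : 0 <= h <= h by rewrite lexx ltW.
pose g y := f (y + h *: basis j) - f y.
have gl : forall a : R, 0 <= a <= h ->
    is_derive (a *: basis i + x) (basis i) g
      (partial i f (h *: basis j + (a *: basis i + x)) - partial i f (a *: basis i + x)).
  move=> a ah; apply: is_deriveB; last first.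
    by split=> //; have := fd a 0 ah z0; rewrite scale0r add0r.
  apply: is_derive_translate; split.
    by rewrite -addrA (addrC x); exact: fd.
  by rewrite -addrA (addrC x) [X in _ = partial i f X]addrCA.
have [|a ah] := @MVT_line g x (basis i) h h0.
  by move=> t /gl[].
have [_ ->] := gl _ ah.
move=> E; exists a.
have [|b bh E2] := @MVT_line (partial i f) (a *: basis i + x) (basis j) h h0.
  move=> t th; apply: ((fC 2 i).2 j).1; rewrite addrCA; exact: hU.
exists b; split => //.
by rewrite -E2 -E /g -(addrA (h *: basis i) x) (addrC x).
Qed.

(** The second difference of f over a small square is symmetric in i and j, so a value of one mixed
    derivative near x equals a value of the other. Continuity at x does the rest. *)
Lemma partialC U f i j x : open U -> smooth_on U f -> U x ->
  partial i (partial j f) x = partial j (partial i f) x.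
Proof.
move=> oU fC Ux; apply/eqP; rewrite -subr_eq0 -normr_le0.
apply/ler_addgt0Pl => e e0; rewrite addr0.
have cont p q : {for x, continuous (partial p (partial q f))}.
  by apply: smooth_on_continuous Ux => //; do 2 apply: smooth_on_partial.
have e2 : 0 < e / 2 by rewrite divr_gt0.
have : \forall y \near x, [/\ U y,
    `|partial i (partial j f) x - partial i (partial j f) y| <= e / 2 &
    `|partial j (partial i f) x - partial j (partial i f) y| <= e / 2].
  apply: filterS3 (open_near oU Ux) ((cvgrPdist_le _ _).1 (cont i j) _ e2)
    ((cvgrPdist_le _ _).1 (cont j i) _ e2) => y Uy c1 c2.
  exact: (And3 Uy c1 c2).
move=> /nbhs_ballP[r /= r0 rP].
(* The square of side h stays in the ball because 2 h < r. *)
pose h := r / 3.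
have h0 : 0 < h by rewrite divr_gt0.
have bx p q (a b : R) : 0 <= a <= h -> 0 <= b <= h ->
    ball x r (a *: basis p + (b *: basis q + x)).
  move=> /andP[a0 ah] /andP[b0 bh].
  rewrite -ball_normE/= addrA opprD addrCA subrr addr0 normrN.
  have r3 : h + h < r by rewrite /h; lra.
  rewrite (le_lt_trans _ r3)// (le_trans (ler_normD _ _))// lerD//.
  - rewrite normrZ ger0_norm// -[leRHS]mulr1 ler_pM//.
    rewrite [leLHS]/Num.Def.normr/= mx_normrE (bigmax_le _ ler01)//= => ij _.
    by rewrite mxE; case: (_ && _); rewrite ?normr1 ?normr0.
  - rewrite normrZ ger0_norm// -[leRHS]mulr1 ler_pM//.
    rewrite [leLHS]/Num.Def.normr/= mx_normrE (bigmax_le _ ler01)//= => ij _.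
    by rewrite mxE; case: (_ && _); rewrite ?normr1 ?normr0.
have [|a [b [ah bh E]]] := @mixed_difference U f x h i j fC h0.
  by move=> a b ah bh; have [] := rP _ (bx i j a b ah bh).
have [|a' [b' [ah' bh' E']]] := @mixed_difference U f x h j i fC h0.
  by move=> a' b' ah' bh'; have [] := rP _ (bx j i a' b' ah' bh').
have [_ _ P1] := rP _ (bx j i _ _ bh ah).
have [_ P2 _] := rP _ (bx i j _ _ bh' ah').
move: P1 P2; set C := partial i _ x; set D := partial j _ x.
move: E E'; set P := partial j _ _; set Q := partial i _ _.
clearbody C D P Q; rewrite [in X in _ -> X -> _](addrCA (h *: basis j)) => E E' P1 P2.
have PQ : P = Q.
  have h_neq0 : h != 0 by rewrite gt_eqF.
  by apply: (mulfI h_neq0); apply: (mulfI h_neq0); rewrite -E -E'; lra.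
rewrite PQ in P1; rewrite (splitr e) (le_trans _ (lerD P2 P1))//.
by rewrite [X in _ <= _ + X]distrC (le_trans _ (ler_normD _ _))// addrA subrK.
Qed.

End clairaut.

Section continuity_dist.
Context {R : realType} {V : normedModType R}.
Implicit Types (f g : V -> R) (x v : V).

Lemma is_derive_prod f g x v df dg : is_derive x v f df -> is_derive x v g dg ->
  is_derive x v (fun y => f y * g y) (f x * dg + g x * df).
Proof. exact: is_deriveM. Qed.

Lemma is_derive_scale f x v df (k : R) : is_derive x v f df ->
  is_derive x v (fun y => k * f y) (k * df).
Proof. exact: is_deriveZ. Qed.

Lemma continuous_dist_near f x (e : R) : {for x, continuous f} -> 0 < e ->
  \forall y \near x, `|f x - f y| <= e.
Proof. by move=> fx e0; exact: (cvgrPdist_le _ _).1 fx _ e0. Qed.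

Lemma continuous_dist f x :
  (forall e : R, 0 < e -> \forall y \near x, `|f x - f y| <= e) ->
  {for x, continuous f}.
Proof. by move=> fx; apply/cvgrPdist_le => e; exact: fx. Qed.

Lemma is_derive_sumr x v I (s : seq I)
    (f : I -> V -> R) (df : I -> R) :
  (forall i, is_derive x v (f i) (df i)) ->
  is_derive x v (fun y => \sum_(i <- s) f i y) (\sum_(i <- s) df i).
Proof.
move=> fd; elim: s => [|i s ih].
  by rewrite big_nil; under eq_fun do rewrite big_nil; exact: is_derive_cst.
by rewrite big_cons; under eq_fun do rewrite big_cons; exact: is_deriveD.
Qed.

Lemma is_derive_exp f x v df n : is_derive x v f df ->
  is_derive x v (fun y => f y ^+ n) (n%:R * f x ^+ n.-1 * df).
Proof.
move=> fd; have := is_deriveX n fd.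
by rewrite (_ : f ^+ n = (fun y => f y ^+ n))//; apply/funext => y; rewrite fctE.
Qed.

End continuity_dist.

(** * Integrals over the unit interval *)

Section unit_interval_integral.
Context {R : realType}.
Implicit Types f g F : R -> R.

Definition int01 f : R := (\int[lebesgue_measure]_(u in `[0, 1]) f u)%R.

Definition continuous01 f := forall u : R, 0 <= u <= 1 -> {for u, continuous f}.

Lemma continuous01_within f : continuous01 f -> {within `[0, 1], continuous f}.
Proof.
move=> fc; apply: continuous_in_subspaceT => u.
by rewrite inE/= in_itv/= => /fc.
Qed.

Lemma continuous01_integrable f : continuous01 f ->
  lebesgue_measure.-integrable `[0, 1] (EFin \o f).
Proof.
move=> fc; apply: continuous_compact_integrable; first exact: segment_compact.
exact: continuous01_within.
Qed.

Lemma int01D f g : continuous01 f -> continuous01 g ->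
  int01 (fun u => f u + g u) = int01 f + int01 g.
Proof. by move=> fc gc; rewrite /int01 RintegralD//; exact: continuous01_integrable. Qed.

Lemma int01B f g : continuous01 f -> continuous01 g ->
  int01 (fun u => f u - g u) = int01 f - int01 g.
Proof. by move=> fc gc; rewrite /int01 RintegralB//; exact: continuous01_integrable. Qed.

Lemma int01Z f k : continuous01 f -> int01 (fun u => k * f u) = k * int01 f.
Proof. by move=> fc; rewrite /int01 RintegralZl//; exact: continuous01_integrable. Qed.

Lemma continuous01D f g : continuous01 f -> continuous01 g ->
  continuous01 (fun u => f u + g u).
Proof. by move=> fc gc u u01; apply: (continuousD (fc u u01) (gc u u01)). Qed.

Lemma continuous01M f g : continuous01 f -> continuous01 g ->
  continuous01 (fun u => f u * g u).
Proof. by move=> fc gc u u01; apply: (continuousM (fc u u01) (gc u u01)). Qed.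

Lemma continuous01_cst k : continuous01 (fun=> k).
Proof. by move=> u _; exact: cst_continuous. Qed.

Lemma continuous01X k : continuous01 (fun u => u ^+ k).
Proof. by move=> u _; exact: exprn_continuous. Qed.

Lemma continuous01Z k f : continuous01 f -> continuous01 (fun u => k * f u).
Proof. by move=> fc u u01; apply: (continuousM _ (fc u u01)); exact: cst_continuous. Qed.

Lemma continuous01_sum I (s : seq I) (f : I -> R -> R) :
  (forall i, continuous01 (f i)) -> continuous01 (fun u => \sum_(i <- s) f i u).
Proof.
move=> fc; elim: s => [|i s ih].
  by under eq_fun do rewrite big_nil; exact: continuous01_cst.
by under eq_fun do rewrite big_cons; exact: continuous01D.
Qed.

Lemma int01_cst k : int01 (fun=> k) = k.
Proof.
rewrite /int01 Rintegral_cst//= lebesgue_measure_itv/= lte_fin ltr01.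
by rewrite oppr0 adde0/= mulr1.
Qed.

Lemma eq_int01 f g : (forall u, 0 <= u <= 1 -> f u = g u) -> int01 f = int01 g.
Proof.
by move=> fg; apply: eq_Rintegral => u; rewrite inE/= in_itv/= => /fg.
Qed.

Lemma int01_sum I (s : seq I) (f : I -> R -> R) :
  (forall i, continuous01 (f i)) ->
  int01 (fun u => \sum_(i <- s) f i u) = \sum_(i <- s) int01 (f i).
Proof.
move=> fc; elim: s => [|i s ih].
  rewrite big_nil -[RHS](int01_cst 0); apply: eq_int01 => u _.
  by rewrite big_nil.
rewrite big_cons -ih -int01D//; last exact: continuous01_sum.
by apply: eq_int01 => u _; rewrite big_cons.
Qed.

Lemma int01_dist f g (e : R) : continuous01 f -> continuous01 g ->
  (forall u, 0 <= u <= 1 -> `|f u - g u| <= e) -> `|int01 f - int01 g| <= e.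
Proof.
move=> fc gc fg; rewrite -int01B//.
have fgc : continuous01 (fun u => f u - g u).
  move=> u u01; exact: (continuousB (fc u u01) (gc u u01)).
rewrite (le_trans (le_normr_Rintegral _ _))//; first exact: continuous01_integrable.
rewrite -[leRHS](int01_cst e); apply: le_Rintegral => //.
- apply: (@continuous01_integrable (fun u => `|f u - g u|)) => u u01.
  by apply: continuous_comp; [exact: fgc|exact: norm_continuous].
- exact/continuous01_integrable/continuous01_cst.
Qed.

Lemma int01_FTC f F : continuous01 f ->
  (forall u : R, 0 <= u <= 1 -> is_derive u 1 F (f u)) -> int01 f = F 1 - F 0.
Proof.
move=> fc dF; rewrite /int01 /Rintegral.
have cF (u : R) : 0 <= u <= 1 -> {for u, continuous F}.
  move=> u01; apply/differentiable_continuous/derivable1_diffP.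
  by have [] := dF u u01.
have le01 : 0 <= (0 : R) <= 1 /\ 0 <= (1 : R) <= 1 by rewrite !lexx ler01.
rewrite (@continuous_FTC2 _ f F 0 1) ?ltr01//.
- exact: continuous01_within.
- split.
  + move=> u; rewrite in_itv/= => /andP[u0 u1].
    by have [] := dF u; rewrite ?(ltW u0) ?ltW.
  + exact/cvg_at_right_filter/cF/le01.1.
  + exact/cvg_at_left_filter/cF/le01.2.
- move=> u; rewrite in_itv/= => /andP[u0 u1].
  by rewrite derive1E; have [] := dF u; rewrite ?(ltW u0) ?ltW.
Qed.

End unit_interval_integral.

(** * Integrals along rays *)

Section radial_integral.
Context {R : realType} {d : nat}.
Implicit Types (U : set 'rV[R]_d) (G : 'rV[R]_d -> R) (x y v : 'rV[R]_d).

Definition starshaped U := forall y (u : R), U y -> 0 <= u <= 1 -> U (u *: y).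

(** The homotopy operator of the Poincare lemma is made of these integrals: the weight u^0 serves
    1-forms, u^1 serves 2-forms, and each differentiation raises the exponent by one. *)
Definition radial_int k G y : R := int01 (fun u => u ^+ k * G (u *: y)).

Variable U : set 'rV[R]_d.
Hypotheses (oU : open U) (sU : starshaped U).

Lemma ray_continuous01 k G y : (forall x, U x -> {for x, continuous G}) -> U y ->
  continuous01 (fun u => u ^+ k * G (u *: y)).
Proof.
move=> cG Uy; apply: continuous01M; first exact: continuous01X.
move=> u u01; apply: (@continuous_comp _ _ _ (fun u : R => u *: y) G).
  exact: scalel_continuous.
exact/cG/sU.
Qed.

(** A tube argument: (u, x) |-> G (u x) is jointly continuous at the points of [0, 1] x {y}, and the
    interval is compact. *)
Lemma ray_uniform_near G y (e : R) : 0 < e ->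
  (forall x, U x -> {for x, continuous G}) -> U y ->
  \forall x \near y, forall u, 0 <= u <= 1 -> `|G (u *: y) - G (u *: x)| <= e.
Proof.
move=> e0 cG Uy.
have /compact_near_coveringP/(_ _ (nbhs y)
  (fun x u => `|G (u *: y) - G (u *: x)| <= e)) := @segment_compact R 0 1.
move=> /(_ _ _)H; suff : \forall x \near y, `[0, 1]%classic `<=`
    (fun u : R => `|G (u *: y) - G (u *: x)| <= e).
  by apply: filterS => x xP u u01; apply: xP; rewrite /= in_itv.
apply: H => u; rewrite /= in_itv/= => u01.
have cu : {for u *: y, continuous G} by exact/cG/sU.
have e2 : 0 < e / 2 by rewrite divr_gt0.
have Gn := continuous_dist_near cu e2.
have c1 := @scale_continuous R 'rV[R]_d (u, y).
have c2 : {for (u, y), continuous (fun z : R * 'rV[R]_d => z.1 *: y)}.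
  apply: (@continuous_comp _ _ _ fst (fun w : R => w *: y)); first exact: cvg_fst.
  exact: scalel_continuous.
have N1 : nbhs (u, y) [set z : R * 'rV[R]_d |
    `|G (u *: y) - G (z.1 *: z.2)| <= e / 2] := c1 _ Gn.
have N2 : nbhs (u, y) [set z : R * 'rV[R]_d |
    `|G (u *: y) - G (z.1 *: y)| <= e / 2] := c2 _ Gn.
suff : nbhs (u, y) [set z : R * 'rV[R]_d |
    `|G (z.1 *: y) - G (z.1 *: z.2)| <= e] by [].
apply: filterS2 N1 N2 => -[w x]/= E1 E2.
rewrite (splitr e) (le_trans _ (lerD E1 E2))// [X in _ <= _ + X]distrC.
by rewrite [leRHS]addrC (le_trans _ (ler_normD _ _))// addrA subrK.
Qed.

Lemma radial_int_continuous k G y : (forall x, U x -> {for x, continuous G}) ->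
  U y -> {for y, continuous (radial_int k G)}.
Proof.
move=> cG Uy; apply: continuous_dist => e e0.
apply: filterS2 (open_near oU Uy) (ray_uniform_near e0 cG Uy) => x Ux xP.
apply: int01_dist; [exact: ray_continuous01|exact: ray_continuous01|] => u u01.
rewrite -mulrBr normrM -[leRHS]mul1r ler_pM// ?xP//.
by case/andP: u01 => u0 u1; rewrite normrX ger0_norm// exprn_ile1.
Qed.

(** Differentiation under the integral sign. The dominating function is the constant [C + 1]: C
    bounds the partial derivative of G on the ray through y, and on nearby rays it changes by at
    most 1. *)
Lemma radial_int_is_derive k G y i : smooth_on U G -> U y ->
  is_derive y (basis i) (radial_int k G) (radial_int k.+1 (partial i G) y).
Proof.
move=> GC Uy.
have cG x : U x -> {for x, continuous G} := GC 0 x.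
have cG' x : U x -> {for x, continuous (partial i G)} := smooth_on_partial i GC 0%N x.
pose l (t : R) := t *: basis i + y.
have l0 : l 0 = y by rewrite /l scale0r add0r.
have cl : {for 0, continuous l}.
  by apply: cvgD; [exact: scalel_continuous|exact: cvg_cst].
have N : \forall t \near 0, U (l t) /\ (forall u, 0 <= u <= 1 ->
    `|partial i G (u *: y) - partial i G (u *: l t)| <= 1).
  have : \forall x \near l 0, U x /\ (forall u, 0 <= u <= 1 ->
    `|partial i G (u *: y) - partial i G (u *: x)| <= 1).
    rewrite l0; apply: filterS2 (open_near oU Uy) (ray_uniform_near ltr01 cG' Uy) => x.
    by split.
  by move/cl.
have [r /= r0 rP] := (nbhs_ballP _ _).1 N.
have {}rP t : t \in `]-r, r[ -> U (l t) /\ (forall u, 0 <= u <= 1 ->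
    `|partial i G (u *: y) - partial i G (u *: l t)| <= 1).
  by rewrite in_itv/= -ltr_norml => tr; apply: rP; rewrite -ball_normE/= sub0r normrN.
pose f (t u : R) := u ^+ k * G (u *: l t).
have fd (t u : R) : t \in `]-r, r[ -> 0 <= u <= 1 ->
    is_derive t 1 (f ^~ u) (u ^+ k.+1 * partial i G (u *: l t)).
  move=> /rP[Ut _] u01.
  have lin : is_derive t 1 (fun t : R => G (t *: (u *: basis i) + u *: y))
      ('D_(u *: basis i) G (t *: (u *: basis i) + u *: y)).
    apply: is_derive_line; split => //; apply: smooth_on_derivable GC _ => //.
    by rewrite scalerA mulrC -scalerA -scalerDr; exact: sU.
  have -> : f^~ u = (fun t : R => u ^+ k * G (t *: (u *: basis i) + u *: y)).
    by apply/funext => s; rewrite /f /l/= scalerDr !scalerA (mulrC u).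
  apply: is_derive_eq (is_derive_scale (u ^+ k) lin) _.
  rewrite exprSr -mulrA; congr (_ * _).
  have -> : t *: (u *: basis i) + u *: y = u *: l t.
    by rewrite /l scalerDr !scalerA mulrC.
  rewrite derive_partial; last exact: smooth_on_differentiable GC (sU Ut u01).
  rewrite (bigD1 i)//= big1 ?addr0.
    by rewrite !mxE !eqxx mulr1.
  by move=> j ji; rewrite !mxE (negbTE ji) andbF mulr0 mul0r.
have [C CP] : exists C, forall u, 0 <= u <= 1 -> `|partial i G (u *: y)| <= C.
  have cf : continuous01 (fun u => `|u ^+ 0 * partial i G (u *: y)|).
    move=> u u01; apply: continuous_comp; last exact: norm_continuous.
    exact: ray_continuous01.
  have [c _ cP] := EVT_max ler01 (continuous01_within cf).
  exists (`|c ^+ 0 * partial i G (c *: y)|) => u u01.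
  by rewrite -[X in `|X|]mul1r; apply: cP; rewrite in_itv.
have I0 : `]-r, r[%classic (0 : R) by rewrite /= in_itv/= oppr_lt0 r0.
have mI : measurable `[0 : R, 1]%classic by [].
have intf (x : R) : `]-r, r[%classic x -> lebesgue_measure.-integrable `[0, 1] (EFin \o f x).
  by move=> /rP[Ux _]; exact/continuous01_integrable/ray_continuous01.
have derf (x u : R) : `]-r, r[%classic x -> `[0, 1]%classic u -> derivable (f ^~ u) x 1.
  by move=> xr; rewrite /= in_itv/= => u01; have [] := fd x u xr u01.
have C1_ge0 : 0 <= C + 1.
  by rewrite addr_ge0// (le_trans _ (CP 0 _))// lexx ler01.
have bd (x u : R) : `]-r, r[%classic x -> `[0, 1]%classic u ->
    `|partial1of2 f x u| <= C + 1.
  move=> xr; rewrite /= in_itv/= => u01; rewrite partial1of2E.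
  have [_ ->] := fd x u xr u01.
  have [Ux /(_ u u01) xP] := rP x xr.
  rewrite normrM -[leRHS]mul1r ler_pM//.
    by case/andP: u01 => u0 u1; rewrite normrX ger0_norm// exprn_ile1.
  rewrite -[X in `|X|](subrK (partial i G (u *: y))) addrC (le_trans (ler_normD _ _))//.
  by rewrite lerD ?CP// distrC.
have intC : lebesgue_measure.-integrable `[0, 1] (EFin \o (fun=> C + 1) : R -> _).
  exact/continuous01_integrable/continuous01_cst.
have D := @derivable_under_integral R _ _ lebesgue_measure f _ mI 0 (-r) r I0 intf derf
  (fun=> C + 1) (fun=> C1_ge0) intC bd.
have E := @differentiation_under_integral R _ _ lebesgue_measure f _ mI 0 (-r) r I0 intf derf
  (fun=> C + 1) (fun=> C1_ge0) intC bd.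
have D' : derivable (radial_int k G) y (basis i) by apply/derivable1P.
split => //.
have [_ <-] := is_derive_line0 D'.
rewrite derive1E in E; transitivity (int01 (partial1of2 f 0)); first exact: E.
apply: eq_int01 => u u01; rewrite partial1of2E.
by have [_ ->] := fd 0 u I0 u01; rewrite l0.
Qed.

Lemma smooth_on_radial_int k G : smooth_on U G -> smooth_on U (radial_int k G).
Proof.
move=> GC n; elim: n k G GC => [|n ih] k G GC.
  by move=> y Uy; apply: radial_int_continuous => // x; exact: (GC 0).
move=> i; split; first by move=> y Uy; have [] := radial_int_is_derive k i GC Uy.
apply: Ck_on_ext (ih k.+1 _ (smooth_on_partial i GC)) => // y Uy.
by have [_] := radial_int_is_derive k i GC Uy.
Qed.

(** Integrate the derivative of u^(k+1) G (u y) in u over [0, 1]. *)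
Lemma radial_int_homotopy k G y : smooth_on U G -> U y ->
  k.+1%:R * radial_int k G y +
    \sum_l y ord0 l * radial_int k.+1 (partial l G) y = G y.
Proof.
move=> GC Uy.
have cG l x : U x -> {for x, continuous (partial l G)} :=
  smooth_on_partial l GC 0%N x.
have c0 : continuous01 (fun u => u ^+ k * G (u *: y)).
  by apply: ray_continuous01 => // x; exact: (GC 0).
have c1 l : continuous01 (fun u => u ^+ k.+1 * partial l G (u *: y)).
  by apply: ray_continuous01 => //; exact: cG.
have cs : continuous01 (fun u => \sum_l y ord0 l * (u ^+ k.+1 * partial l G (u *: y))).
  by apply: continuous01_sum => l; exact: continuous01Z.
transitivity (int01 (fun u => k.+1%:R * (u ^+ k * G (u *: y)) +
    \sum_l y ord0 l * (u ^+ k.+1 * partial l G (u *: y)))).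
  rewrite int01D//; last exact: continuous01Z.
  rewrite int01Z// int01_sum; last by move=> l; exact: continuous01Z.
  by congr (_ + _); apply: eq_bigr => l _; rewrite int01Z.
have dF (u : R) : 0 <= u <= 1 -> is_derive u 1 (fun u : R => u ^+ k.+1 * G (u *: y))
    (k.+1%:R * (u ^+ k * G (u *: y)) +
      \sum_l y ord0 l * (u ^+ k.+1 * partial l G (u *: y))).
  move=> u01; have Uuy := sU Uy u01.
  have dG : is_derive u 1 (fun u : R => G (u *: y)) (\sum_l y ord0 l * partial l G (u *: y)).
    have -> : (fun u : R => G (u *: y)) = (fun u : R => G (u *: y + 0)).
      by apply/funext => s; rewrite addr0.
    apply: is_derive_line; rewrite addr0; split.
      exact: smooth_on_derivable GC Uuy.
    by rewrite derive_partial//; exact: smooth_on_differentiable GC Uuy.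
  have dX : is_derive u 1 (fun u : R => u ^+ k.+1) (k.+1%:R * u ^+ k).
    split; first exact: exprn_derivable.
    by rewrite exp_derive /GRing.scale/= mulr1.
  apply: is_derive_eq (is_derive_prod dX dG) _.
  rewrite addrC; congr (_ + _); first by rewrite mulrC mulrA.
  by rewrite mulr_sumr; apply: eq_bigr => l _; rewrite mulrCA.
rewrite (int01_FTC _ dF).
  by rewrite expr1n mul1r scale1r expr0n/= mul0r subr0.
by apply: continuous01D => //; exact: continuous01Z.
Qed.

End radial_integral.

(** * The Euclidean norm and the radial retraction *)

Section euclidean_norm.
Context {R : realType} {d : nat}.
Implicit Types (x y s v : 'rV[R]_d) (U : set 'rV[R]_d).

Lemma dot_ge0 x : 0 <= dot x x.
Proof. by apply: sumr_ge0 => i _; rewrite -expr2 sqr_ge0. Qed.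

Lemma dot_eq0 x : (dot x x == 0) = (x == 0).
Proof.
apply/eqP/eqP => [|->]; last by rewrite /dot big1// => i _; rewrite mxE mul0r.
move=> /eqP; rewrite psumr_eq0; last by move=> i _; rewrite -expr2 sqr_ge0.
move=> /allP xx0; apply/rowP => i; rewrite mxE.
by have := xx0 i (mem_index_enum _); rewrite -expr2 sqrf_eq0 => /eqP.
Qed.

Lemma dot_gt0 x : x != 0 -> 0 < dot x x.
Proof. by move=> x0; rewrite lt_def dot_eq0 x0 dot_ge0. Qed.

Lemma sqr_enorm x : enorm x ^+ 2 = dot x x.
Proof. by rewrite sqr_sqrtr// dot_ge0. Qed.

Lemma enorm_ge0 x : 0 <= enorm x.
Proof. exact: sqrtr_ge0. Qed.

Lemma enorm_gt0 x : (0 < enorm x) = (x != 0).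
Proof. by rewrite sqrtr_gt0 lt_def dot_eq0 dot_ge0 andbT. Qed.

Lemma enormZ k x : enorm (k *: x) = `|k| * enorm x.
Proof.
by rewrite /enorm dotZl dotZr mulrA -expr2 sqrtrM ?sqr_ge0// sqrtr_sqr.
Qed.

Lemma coord_enorm_le x i : `|x ord0 i| <= enorm x.
Proof.
rewrite -(sqrtr_sqr (x ord0 i)) ler_wsqrtr// /dot (bigD1 i)//= -expr2 lerDl.
by apply: sumr_ge0 => j _; rewrite -expr2 sqr_ge0.
Qed.

Lemma sphereP s : sphere s <-> dot s s = 1.
Proof.
split; first by rewrite -sqr_enorm => ->; rewrite expr1n.
by rewrite /sphere/= /enorm => ->; rewrite sqrtr1.
Qed.

Lemma coord_sphere_le1 s i : sphere s -> `|s ord0 i| <= 1.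
Proof. by move=> <-; exact: coord_enorm_le. Qed.

Lemma sphere_neq0 s : sphere s -> s != 0.
Proof. by rewrite -enorm_gt0 => ->. Qed.

Lemma radial_sphere x : x != 0 -> sphere (radial x).
Proof.
rewrite -enorm_gt0 => x0.
by rewrite /sphere/= enormZ normfV ger0_norm ?mulVf ?gt_eqF// ltW.
Qed.

Lemma radialZ k x : 0 < k -> radial (k *: x) = radial x.
Proof.
move=> k0; rewrite /radial enormZ gtr0_norm// scalerA invfM.
by rewrite mulrC mulrA divff ?mul1r// gt_eqF.
Qed.

Lemma radial_id s : sphere s -> radial s = s.
Proof. by rewrite /radial => ->; rewrite invr1 scale1r. Qed.

Definition punctured : set 'rV[R]_d := [set x | x != 0].

Lemma open_punctured : open punctured.
Proof.
have -> : punctured = ~` [set 0].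
  by apply/seteqP; split => x /=; [move/eqP|move=> ?; apply/eqP].
exact/closed_openC/accessible_closed_set1/hausdorff_accessible/norm_hausdorff.
Qed.

Lemma is_derive_coord x v j : is_derive x v (fun y => y ord0 j) (v ord0 j).
Proof.
split; first by apply: diff_derivable; exact: differentiable_coord.
rewrite derive_partial; last exact: differentiable_coord.
rewrite (bigD1 j)//= partial_coord eqxx mulr1 big1 ?addr0// => i ij.
by rewrite partial_coord (negbTE ij) mulr0.
Qed.

Lemma is_derive_dot x v : is_derive x v (fun y => dot y y) (2 * dot x v).
Proof.
have H i : is_derive x v (fun y => y ord0 i * y ord0 i)
    (x ord0 i * v ord0 i + x ord0 i * v ord0 i).
  by apply: is_derive_prod; exact: is_derive_coord.
apply: is_derive_eq (is_derive_sumr _ H) _.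
by rewrite big_split/= mulr2n mulrDl mul1r.
Qed.

Lemma smooth_on_dot U : open U -> smooth_on U (fun x => dot x x).
Proof.
by move=> oU; apply: smooth_on_sum => // i; apply: smooth_onM => //; exact: smooth_on_coord.
Qed.

Definition inorm x : R := (enorm x)^-1.

(** The k-th derivative of t^(-1/2) is this coefficient times t^(-(2k+1)/2); [smooth_on_comp1] asks
    for the whole sequence. *)
Let inv_sqrt_coef (k : nat) : R := iteri k (fun n c => - c * (n.*2.+1)%:R / 2) 1.

Let inv_sqrt_deriv (k : nat) (t : R) : R :=
  inv_sqrt_coef k * (Num.sqrt t)^-1 ^+ (k.*2.+1).

Let is_derive_inv_sqrt (t : R) : 0 < t ->
  is_derive t 1 (fun t : R => (Num.sqrt t)^-1) (- 2^-1 * (Num.sqrt t)^-1 ^+ 3).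
Proof.
move=> t0; have [D E] := is_derive1_sqrt t0.
have st0 : Num.sqrt t != 0 by rewrite gt_eqF// sqrtr_gt0.
split; first exact: derivableV.
rewrite deriveV// E /GRing.scale/=.
by field.
Qed.

Let is_derive_inv_sqrt_deriv (k : nat) (t : R) : 0 < t ->
  is_derive t 1 (inv_sqrt_deriv k) (inv_sqrt_deriv k.+1 t).
Proof.
move=> t0; have D := is_derive_inv_sqrt t0.
have DX := is_derive_exp (k.*2.+1) D.
apply: is_derive_eq (is_derive_scale (inv_sqrt_coef k) DX) _.
rewrite /inv_sqrt_deriv [inv_sqrt_coef k.+1]/= -/(inv_sqrt_coef k) doubleS.
set c := inv_sqrt_coef k; set z := _^-1; rewrite /GRing.scale/= !exprS.
by field.
Qed.

Lemma smooth_on_inorm : smooth_on punctured inorm.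
Proof.
apply: (@smooth_on_ext _ _ _ (fun x => inv_sqrt_deriv 0 (dot x x))).
- exact: open_punctured.
- by move=> x _; rewrite /inv_sqrt_deriv /= mul1r.
- apply: (@smooth_on_comp1 _ _ _ [set t | 0 < t]).
  + exact: open_punctured.
  + by move=> n y y0; exact: is_derive_inv_sqrt_deriv.
  + by move=> x; exact: dot_gt0.
  + by apply: smooth_on_dot; exact: open_punctured.
Qed.

Lemma is_derive_inorm x v : x != 0 ->
  is_derive x v inorm (- inorm x ^+ 3 * dot x v).
Proof.
move=> x0; have [D E] := is_derive_dot x v.
have := is_derive_comp1 D (is_derive_inv_sqrt (dot_gt0 x0)).
move=> H; apply: is_derive_eq H _; rewrite E -/(enorm x) -/(inorm x).
by field.
Qed.

Lemma is_derive_radial x v l : x != 0 ->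
  is_derive x v (fun y => radial y ord0 l)
    (inorm x * v ord0 l - inorm x ^+ 3 * dot x v * x ord0 l).
Proof.
move=> x0; have -> : (fun y : 'rV[R]_d => radial y ord0 l) = (fun y => inorm y * y ord0 l).
  by apply/funext => y; rewrite mxE.
apply: is_derive_eq (is_derive_prod (is_derive_inorm v x0) (is_derive_coord x v l)) _.
by ring.
Qed.

Lemma smooth_map_on_radial : smooth_map_on punctured (radial (d := d)).
Proof.
move=> l; have op := open_punctured.
apply: (@smooth_on_ext _ _ _ (fun y => inorm y * y ord0 l)) => //.
  by move=> x _; rewrite mxE.
by apply: smooth_onM => //; [exact: smooth_on_inorm|exact: smooth_on_coord].
Qed.

Lemma partial_radial_tangent x i : x != 0 -> dot (radial x) (partial_map i radial x) = 0.
Proof.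
move=> x0.
have -> : partial_map i radial x =
    inorm x *: basis i - (inorm x ^+ 3 * x ord0 i) *: x.
  apply/rowP => l; rewrite !mxE /partial.
  by have [_ ->] := is_derive_radial (basis i) l x0; rewrite !dot_basis !mxE.
rewrite dotDr dotNr !dotZr !dotZl dot_basis -/(inorm x) -sqr_enorm.
have : inorm x * enorm x = 1 by rewrite mulVf// gt_eqF// enorm_gt0.
move=> E; have -> : inorm x ^+ 3 * x ord0 i * (inorm x * enorm x ^+ 2) =
  inorm x ^+ 2 * (inorm x * enorm x) ^+ 2 * x ord0 i by ring.
by rewrite E; ring.
Qed.

Lemma derive_radial_tangent s X l : sphere s -> tangent s X ->
  'D_X (fun y => radial y ord0 l) s = X ord0 l.
Proof.
move=> ss tX; have [_ ->] := is_derive_radial X l (sphere_neq0 ss).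
by rewrite tX /inorm ss invr1 mulr0 mul0r subr0 mul1r.
Qed.

End euclidean_norm.

(** * Pullbacks of 1-forms *)

Section pullback.
Context {R : realType} {m n : nat}.
Variables (U : set 'rV[R]_m) (psi : 'rV[R]_m -> 'rV[R]_n) (A : 'rV[R]_n -> 'rV[R]_n).
Hypotheses (oU : open U) (psiC : smooth_map_on U psi) (AC : smooth_map_on setT A).

Definition pullback_1form (j : 'I_m) (q : 'rV[R]_m) : R :=
  dot (A (psi q)) (partial_map j psi q).

Let smooth_comp a : smooth_on U (fun q => A (psi q) ord0 a).
Proof. by apply: smooth_on_comp (AC a) _ => //; exact: openT. Qed.

Let pullback_1formE j : pullback_1form j =
  (fun q => \sum_a A (psi q) ord0 a * partial j (fun y => psi y ord0 a) q).
Proof. by apply/funext => q; apply: eq_bigr => a _; rewrite mxE. Qed.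

Lemma smooth_on_pullback_1form j : smooth_on U (pullback_1form j).
Proof.
rewrite pullback_1formE; apply: smooth_on_sum => // a; apply: smooth_onM => //.
exact/smooth_on_partial/psiC.
Qed.

Let partial_pullback i j q : U q -> partial i (pullback_1form j) q =
  \sum_b \sum_a partial a (fun x => A x ord0 b) (psi q) *
      partial_map i psi q ord0 a * partial_map j psi q ord0 b +
  \sum_b A (psi q) ord0 b * partial i (partial j (fun y => psi y ord0 b)) q.
Proof.
move=> Uq; rewrite pullback_1formE /partial.
have H b : is_derive q (basis i)
    (fun q => A (psi q) ord0 b * partial j (fun y => psi y ord0 b) q)
    (A (psi q) ord0 b * partial i (partial j (fun y => psi y ord0 b)) q +
     partial j (fun y => psi y ord0 b) q *
     \sum_a partial a (fun x => A x ord0 b) (psi q) * partial_map i psi q ord0 a).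
  apply: is_derive_prod.
    have [D E] := smooth_map_is_derive (basis i) oU openT psiC (AC b) Uq I.
    by split => //; rewrite E; apply: eq_bigr => a _; rewrite mxE.
  split => //; apply: smooth_on_derivable Uq => //.
  exact/smooth_on_partial/psiC.
have [_ ->] := is_derive_sumr (index_enum 'I_n) H.
rewrite big_split/= addrC; congr (_ + _); apply: eq_bigr => b _.
by rewrite mulrC mulr_suml; apply: eq_bigr => a _; rewrite [partial_map j _ _ _ _]mxE.
Qed.

(** The exterior derivative commutes with pullbacks: the terms with second derivatives of psi are
    symmetric in i and j by [partialC] and cancel. *)
Lemma pullback_ext_deriv i j q : U q ->
  partial i (pullback_1form j) q - partial j (pullback_1form i) q =
  \sum_a \sum_b (partial a (fun x => A x ord0 b) (psi q) -
                 partial b (fun x => A x ord0 a) (psi q)) *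
    partial_map i psi q ord0 a * partial_map j psi q ord0 b.
Proof.
move=> Uq.
pose T i j := \sum_b \sum_a partial a (fun x => A x ord0 b) (psi q) *
  partial_map i psi q ord0 a * partial_map j psi q ord0 b.
pose D i j :=
  \sum_b A (psi q) ord0 b * partial i (partial j (fun y => psi y ord0 b)) q.
have E k l : partial k (pullback_1form l) q = T k l + D k l by exact: partial_pullback.
have DC : D i j = D j i.
  by rewrite /D; apply: eq_bigr => b _; rewrite (partialC i j oU (psiC b) Uq).
rewrite !E DC opprD addrACA subrr addr0 /T [in X in X - _]exchange_big/= -sumrB.
apply: eq_bigr => a _; rewrite -sumrB; apply: eq_bigr => b _.
by rewrite !mulrBl; congr (_ - _); rewrite mulrAC.
Qed.

End pullback.

(** * The Poincare lemma on starshaped domains *)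

Section poincare_lemma.
Context {R : realType} {d : nat}.
Implicit Types (U : set 'rV[R]_d) (x y v p : 'rV[R]_d).

(** The primitive is the sum of the x_l int_0^1 w_l (u x) du. Closedness replaces [partial i (w l)]
    by [partial l (w i)] under the integral, and [radial_int_homotopy] with k = 0 then yields
    [w i]. *)
Lemma poincare_starshaped U (w : 'I_d -> 'rV[R]_d -> R) :
  open U -> starshaped U -> (forall i, smooth_on U (w i)) ->
  (forall i j x, U x -> partial i (w j) x = partial j (w i) x) ->
  exists f, smooth_on U f /\ forall x, U x -> forall i, partial i f x = w i x.
Proof.
move=> oU sU wC wcl.
pose f x := \sum_l x ord0 l * radial_int 0 (w l) x.
exists f; split.
  apply: smooth_on_sum => // l; apply: smooth_onM => //; first exact: smooth_on_coord.
  exact: smooth_on_radial_int.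
move=> x Ux i.
have H l : is_derive x (basis i) (fun y => y ord0 l * radial_int 0 (w l) y)
    (x ord0 l * radial_int 1 (partial i (w l)) x +
     radial_int 0 (w l) x * basis (R := R) i ord0 l).
  apply: is_derive_prod; first exact: is_derive_coord.
  exact: (@radial_int_is_derive _ _ U).
have [_ E] := is_derive_sumr (index_enum 'I_d) H.
rewrite [LHS]E big_split/= [X in _ + X](bigD1 i)//=.
rewrite [X in _ + (_ + X)]big1 ?addr0; last first.
  by move=> j ji; rewrite mxE (negbTE ji) andbF mulr0.
rewrite mxE !eqxx mulr1 -[RHS](radial_int_homotopy oU sU 0 (wC i) Ux) mul1r addrC.
have E1 l : radial_int 1 (partial i (w l)) x = radial_int 1 (partial l (w i)) x.
  by apply: eq_int01 => u u01; rewrite wcl//; exact: sU.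
have E2 : \sum_l x ord0 l * radial_int 1 (partial i (w l)) x =
    \sum_l x ord0 l * radial_int 1 (partial l (w i)) x.
  by apply: eq_bigr => l _; exact: (congr1 (fun t => x ord0 l * t) (E1 l)).
exact: (congr1 (fun t => radial_int 0 (w i) x + t) E2).
Qed.

Lemma translate_continuous p : continuous (fun y : 'rV[R]_d => y + p).
Proof.
move=> x; have D : differentiable ((id : 'rV[R]_d -> 'rV[R]_d) + cst p) x.
  exact: differentiableD.
exact: differentiable_continuous D.
Qed.

Lemma derive_translate (f : 'rV[R]_d -> R) x v p :
  'D_v (fun y => f (y + p)) x = 'D_v f (x + p).
Proof.
have E : (fun h : R => h^-1 *: (((fun y => f (y + p)) \o shift x) (h *: v) -
      f (x + p))) =
    (fun h => h^-1 *: ((f \o shift (x + p)) (h *: v) - f (x + p))).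
  by apply/funext => h /=; rewrite addrA.
by rewrite /derive E.
Qed.

Lemma smooth_on_translate U (f : 'rV[R]_d -> R) p : smooth_on U f ->
  smooth_on [set y | U (y + p)] (fun y => f (y + p)).
Proof.
move=> fC k; elim: k f fC => [|k ih] f fC.
  move=> x Ux; apply: (@continuous_comp _ _ _ (fun y => y + p) f).
    exact: translate_continuous.
  exact: (fC 0).
move=> i; split.
  move=> x Ux; have D : is_derive (x + p) (basis i) f (partial i f (x + p)).
    by split => //; exact: (fC 1 i).1.
  by have [] := is_derive_translate D.
rewrite (_ : partial i _ = (fun y => partial i f (y + p))).
  by apply: ih; exact: smooth_on_partial.
by apply/funext => y; rewrite /partial derive_translate.
Qed.

Lemma open_translate U p : open U -> open [set y | U (y + p)].
Proof.
move=> oU; apply: (@open_comp _ _ (fun y => y + p) U) => // x _.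
exact: translate_continuous.
Qed.

Lemma poincare_starshaped_at U p (w : 'I_d -> 'rV[R]_d -> R) :
  open U -> (forall x (u : R), U x -> 0 <= u <= 1 -> U (u *: (x - p) + p)) ->
  (forall i, smooth_on U (w i)) ->
  (forall i j x, U x -> partial i (w j) x = partial j (w i) x) ->
  exists f, smooth_on U f /\ forall x, U x -> forall i, partial i f x = w i x.
Proof.
move=> oU sU wC wcl.
have [|||f [fC fE]] := @poincare_starshaped [set y | U (y + p)]
    (fun i y => w i (y + p)) (open_translate oU).
- by move=> y u/= Uy u01; have := sU _ u Uy u01; rewrite addrK.
- by move=> i; exact: smooth_on_translate.
- by move=> i j x Ux; rewrite /partial !derive_translate; exact: wcl.
exists (fun x => f (x - p)); split.
  have := smooth_on_translate (- p) fC.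
  rewrite (_ : [set y | _] = U)//.
  by apply/seteqP; split => x /=; rewrite subrK.
move=> x Ux i; rewrite /partial derive_translate.
by rewrite -/(partial i f _) fE/= ?subrK.
Qed.

Lemma eq_on_segment U (f : 'rV[R]_d -> R) x v : open U -> smooth_on U f ->
  (forall y, U y -> forall i, partial i f y = 0) ->
  (forall t : R, 0 <= t <= 1 -> U (t *: v + x)) -> f (v + x) = f x.
Proof.
move=> oU fC f0 sU.
have [|t t01] := @MVT_line _ _ f x v 1 ltr01.
  by move=> t /sU; exact: smooth_on_derivable.
rewrite scale1r mul1r derive_partial; last first.
  exact: smooth_on_differentiable fC (sU _ t01).
by rewrite big1 ?subr0 => [/eqP|i _]; rewrite ?subr_eq0 ?f0 ?mulr0//; [move/eqP|exact: sU].
Qed.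

End poincare_lemma.

(** * The Poincare gauge *)

Section gauge.
Context {R : realType} {d : nat}.
Variable B : 'rV[R]_d -> 'M[R]_d.
Hypothesis hB : smooth_closed_csupp_2form B.

Let BC i j : smooth_on setT (fun x => B x i j) := two_form_smooth hB i j.
Let sT : starshaped (@setT 'rV[R]_d). Proof. by []. Qed.

Lemma poincare_gaugeE x j : poincare_gauge B x ord0 j =
  \sum_l x ord0 l * radial_int 1 (fun y => B y l j) x.
Proof.
have c l : continuous01 (fun u : R => u ^+ 1 * B (u *: x) l j).
  apply: (@ray_continuous01 _ _ setT sT 1 (fun y => B y l j)) => // y _.
  exact: smooth_on_continuous openT (BC l j) I.
transitivity (int01 (fun u : R => \sum_l x ord0 l * (u ^+ 1 * B (u *: x) l j))).
  rewrite mxE; apply: eq_int01 => u _; apply: eq_bigr => l _.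
  by rewrite expr1 mulrCA mulrA mulrC mulrA.
rewrite int01_sum; last by move=> l; exact: continuous01Z.
by apply: eq_bigr => l _; rewrite int01Z.
Qed.

Lemma smooth_poincare_gauge : smooth_map_on setT (poincare_gauge B).
Proof.
move=> j; rewrite (_ : (fun x => _) =
    (fun x : 'rV[R]_d => \sum_l x ord0 l * radial_int 1 (fun y => B y l j) x)); last first.
  by apply/funext => x; exact: poincare_gaugeE.
apply: smooth_on_sum => [|l]; first exact: openT.
apply: smooth_onM; [exact: openT|exact/smooth_on_coord/openT|].
exact: smooth_on_radial_int openT sT _ _ (BC l j).
Qed.

(** The homotopy formula for 2-forms. Differentiating the factors x_l gives the ray integral of B_ij
    twice, by antisymmetry; closedness turns the remaining terms into radial derivatives of B_ij,
    and [radial_int_homotopy] with k = 1 applies. *)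
Lemma gauge_ext_deriv i j x :
  partial i (fun y => poincare_gauge B y ord0 j) x
  - partial j (fun y => poincare_gauge B y ord0 i) x = B x i j.
Proof.
have P k l : partial k (fun y => poincare_gauge B y ord0 l) x =
    radial_int 1 (fun y => B y k l) x +
    \sum_a x ord0 a * radial_int 2 (partial k (fun y => B y a l)) x.
  rewrite (_ : (fun x => _) =
    (fun x : 'rV[R]_d => \sum_l0 x ord0 l0 * radial_int 1 (fun y => B y l0 l) x)); last first.
    by apply/funext => y; exact: poincare_gaugeE.
  have H a : is_derive x (basis k) (fun y => y ord0 a * radial_int 1 (fun y => B y a l) y)
      (x ord0 a * radial_int 2 (partial k (fun y => B y a l)) x +
       radial_int 1 (fun y => B y a l) x * basis (R := R) k ord0 a).
    apply: is_derive_prod; first exact: is_derive_coord.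
    exact: (@radial_int_is_derive _ _ setT openT sT 1 _ _ _ (BC a l)).
  have [_ E] := is_derive_sumr (index_enum 'I_d) H.
  rewrite [LHS]E big_split/= addrC; congr (_ + _).
  rewrite (bigD1 k)//= big1 ?addr0 ?mxE ?eqxx ?mulr1// => a ak.
  by rewrite mxE (negbTE ak) andbF mulr0.
have cont k l (G : 'rV[R]_d -> R) : smooth_on setT G ->
    continuous01 (fun u : R => u ^+ k * partial l G (u *: x)).
  move=> GC; apply: (@ray_continuous01 _ _ setT sT k (partial l G)) => // y _.
  exact: smooth_on_continuous openT (smooth_on_partial l GC) I.
have cont0 k l : continuous01 (fun u : R => u ^+ 1 * B (u *: x) k l).
  apply: (@ray_continuous01 _ _ setT sT 1 (fun y => B y k l)) => // y _.
  exact: smooth_on_continuous openT (BC k l) I.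
have E0 : radial_int 1 (fun y => B y j i) x = - radial_int 1 (fun y => B y i j) x.
  rewrite -mulN1r -int01Z; last exact: cont0.
  by apply: eq_int01 => u _; rewrite (two_form_antisym hB) mulrN mulN1r.
have anti k a b y : partial k (fun y => B y a b) y = - partial k (fun y => B y b a) y.
  have -> : (fun y => B y a b) = - (fun y => B y b a).
    by apply/funext => z; rewrite (two_form_antisym hB).
  rewrite /partial deriveN//.
  exact: smooth_on_derivable openT (BC b a) I.
have E1 a : radial_int 2 (partial i (fun y => B y a j)) x -
    radial_int 2 (partial j (fun y => B y a i)) x =
    radial_int 2 (partial a (fun y => B y i j)) x.
  rewrite /radial_int -int01B; [|exact/cont/BC|exact/cont/BC].
  apply: eq_int01 => u _; rewrite -mulrBr.
  have := two_form_closed hB (u *: x) i j a.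
  rewrite (anti i j a) => H.
  have -> : partial i (fun y => B y a j) (u *: x) - partial j (fun y => B y a i) (u *: x)
     = partial a (fun y => B y i j) (u *: x) by move: H; lra.
  by [].
rewrite !P E0 opprD addrACA opprK -mulr2n -sumrB.
have E2 : \sum_a (x ord0 a * radial_int 2 (partial i (fun y => B y a j)) x -
    x ord0 a * radial_int 2 (partial j (fun y => B y a i)) x) =
    \sum_a x ord0 a * radial_int 2 (partial a (fun y => B y i j)) x.
  by apply: eq_bigr => a _; rewrite -mulrBr E1.
rewrite E2 -[RHS](@radial_int_homotopy _ _ setT openT sT 1 _ _ (BC i j) I).
by rewrite mulr2n mulr_natl mulr2n.
Qed.

Lemma gauge_pullback_ext_deriv m (U : set 'rV[R]_m) (psi : 'rV[R]_m -> 'rV[R]_d) i j q :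
  open U -> smooth_map_on U psi -> U q ->
  partial i (pullback_1form psi (poincare_gauge B) j) q -
  partial j (pullback_1form psi (poincare_gauge B) i) q =
  pullback_2form psi B q i j.
Proof.
move=> oU psiC Uq; rewrite (pullback_ext_deriv oU psiC smooth_poincare_gauge)//.
rewrite mxE; apply: eq_bigr => a _; apply: eq_bigr => b _.
by rewrite gauge_ext_deriv.
Qed.

End gauge.

(** * The potential on the sphere of radius r *)

Section sphere_curvature.
Context {R : realType} {d : nat}.
Variables (B : 'rV[R]_d -> 'M[R]_d) (r : R).
Hypotheses (hB : smooth_closed_csupp_2form B) (hr : 0 < r).

Definition flat_on_sphere : Prop := forall s X Y, sphere s -> tangent s X ->
  tangent s Y -> \sum_a \sum_b B (r *: s) a b * X ord0 a * Y ord0 b = 0.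

(* The form A(., r) extended to R^d \ {0} by the retraction on the sphere. *)
Definition radial_form : 'I_d -> 'rV[R]_d -> R :=
  pullback_1form (fun x => r *: radial x) (poincare_gauge B).

Lemma smooth_map_on_scaled m (U : set 'rV[R]_m) (psi : 'rV[R]_m -> 'rV[R]_d) :
  open U -> smooth_map_on U psi -> smooth_map_on U (fun q => r *: psi q).
Proof.
move=> oU psiC l; apply: smooth_on_ext (smooth_onZ r oU (psiC l)) => // q _.
by rewrite mxE.
Qed.

Lemma scale_coord k (v : 'rV[R]_d) a : (k *: v) ord0 a = k * v ord0 a.
Proof. by rewrite mxE. Qed.

Lemma partial_map_scaled m (U : set 'rV[R]_m) (psi : 'rV[R]_m -> 'rV[R]_d) i q :
  open U -> smooth_map_on U psi -> U q ->
  partial_map i (fun q => r *: psi q) q = r *: partial_map i psi q.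
Proof.
move=> oU psiC Uq; apply/rowP => l; rewrite !mxE.
have D : is_derive q (basis i) (fun y => psi y ord0 l) (partial i (fun y => psi y ord0 l) q).
  by split => //; exact: smooth_on_derivable oU (psiC l) Uq.
have [_ <-] := is_derive_scale r D.
by congr ('D_ _ _ q); apply/funext => y; rewrite mxE.
Qed.

Let smooth_scaled_radial : smooth_map_on (@punctured R d) (fun x => r *: radial x).
Proof. by apply: smooth_map_on_scaled; [exact: open_punctured|exact: smooth_map_on_radial]. Qed.

Lemma smooth_on_radial_form j : smooth_on punctured (radial_form j).
Proof.
apply: smooth_on_pullback_1form => //; first exact: open_punctured.
exact: smooth_poincare_gauge.
Qed.

Lemma radial_form_ext_deriv i j x : x != 0 ->
  partial i (radial_form j) x - partial j (radial_form i) x =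
  r ^+ 2 * \sum_a \sum_b B (r *: radial x) a b *
    partial_map i radial x ord0 a * partial_map j radial x ord0 b.
Proof.
move=> x0; have op := @open_punctured R d.
rewrite (gauge_pullback_ext_deriv hB _ _ op)// mxE.
have pE k : partial_map k (fun x => r *: radial x) x = r *: partial_map k radial x.
  exact: partial_map_scaled op (@smooth_map_on_radial _ _) x0.
rewrite mulr_sumr; apply: eq_bigr => a _.
rewrite mulr_sumr; apply: eq_bigr => b _.
have aux (z p q p' q' : R) : p' = r * p -> q' = r * q ->
    z * p' * q' = r ^+ 2 * (z * p * q) by move=> -> ->; ring.
by apply: aux; rewrite pE; exact: scale_coord.
Qed.

Lemma flat_radial_form_closed i j x : flat_on_sphere -> x != 0 ->
  partial i (radial_form j) x = partial j (radial_form i) x.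
Proof.
move=> fl x0; apply/eqP; rewrite -subr_eq0 radial_form_ext_deriv//.
rewrite fl ?mulr0//; [exact: radial_sphere| |]; exact: partial_radial_tangent.
Qed.

(** X need not be tangent: the formula serves tangent vectors in [radial_form_sphere] and the normal
    vector s in [sum_radial_form]. *)
Lemma sum_radial_form_derive s (X : 'rV[R]_d) : sphere s ->
  \sum_i X ord0 i * radial_form i s =
  \sum_a r * poincare_gauge B (r *: s) ord0 a * 'D_X (fun y => radial y ord0 a) s.
Proof.
move=> ss; rewrite /radial_form /pullback_1form radial_id//.
have pE k : partial_map k (fun x => r *: radial x) s = r *: partial_map k radial s.
  exact: partial_map_scaled (@open_punctured R d) (@smooth_map_on_radial _ _) (sphere_neq0 ss).
rewrite /dot; under eq_bigr do rewrite mulr_sumr.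
rewrite exchange_big/=; apply: eq_bigr => a _.
rewrite derive_partial; last first.
  apply: smooth_on_differentiable (@open_punctured R d) (@smooth_map_on_radial _ _ a) _.
  exact: sphere_neq0.
rewrite mulr_sumr; apply: eq_bigr => i _.
rewrite pE scale_coord [partial_map _ _ _ _ _]mxE.
by move: (partial i _ s) (poincare_gauge B _ _ _) => p z; ring.
Qed.

Lemma radial_form_sphere s X : sphere s -> tangent s X ->
  \sum_i X ord0 i * radial_form i s = sphere_potential B r s X.
Proof.
move=> ss tX; rewrite sum_radial_form_derive// /sphere_potential /dot mulr_sumr.
by apply: eq_bigr => a _; rewrite derive_radial_tangent// mulrA.
Qed.

End sphere_curvature.

(** * Closed 1-forms on the punctured space *)

Section exactness.
Context {R : realType} {n : nat}.
Notation d := n.+3.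
Implicit Types (x y z : 'rV[R]_d).

Notation o0 := (ord0 : 'I_d).
Notation o1 := (Ordinal (isT : (1 < n.+3)%N)).
Notation o2 := (Ordinal (isT : (2 < n.+3)%N)).

Definition off_axis : set 'rV[R]_d := [set x : 'rV[R]_d | exists2 j, j != o0 & x ord0 j != 0].

(** For e = 1 or e = -1 this is the space minus a closed half-axis, and it is starshaped about the
    point e of the first axis. *)
Definition slit (e : R) : set 'rV[R]_d := [set x : 'rV[R]_d | 0 < e * x ord0 o0] `|` off_axis.

Let open_off_axis : open off_axis.
Proof.
have -> : off_axis = \bigcup_(j in [set j | j != o0]) ((fun x : 'rV[R]_d => x ord0 j) @^-1` [set t | t != 0]).
  by apply/seteqP; split => x /= [j]; exists j.
apply: bigcup_open => j _; apply: open_comp; first by move=> x _; exact: coord_continuous.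
have -> : [set t : R | t != 0] = ~` [set 0].
  by apply/seteqP; split => x /=; [move/eqP|move=> ?; apply/eqP].
exact/closed_openC/accessible_closed_set1/hausdorff_accessible/norm_hausdorff.
Qed.

Let open_slit e : open (slit e).
Proof.
apply: openU; last exact: open_off_axis.
rewrite (_ : [set x | _] = (fun x : 'rV[R]_d => e * x ord0 o0) @^-1` [set t | 0 < t])//.
apply: open_comp; last exact: open_gt.
move=> x _; apply: (@continuousM _ _ (cst e)); first exact: cst_continuous.
exact: coord_continuous.
Qed.

Let slit_star e x (u : R) : e ^+ 2 = 1 -> slit e x -> 0 <= u <= 1 ->
  slit e (u *: (x - e *: basis o0) + e *: basis o0).
Proof.
move=> e1 sx /andP[u0 u1].
have E0 : (u *: (x - e *: basis o0) + e *: basis o0) ord0 o0 = u * x ord0 o0 + (1 - u) * e.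
  by rewrite !mxE !eqxx/=; ring.
case: sx => [xe|[j j0 xj]].
  left => /=; rewrite E0.
  have -> : e * (u * x ord0 o0 + (1 - u) * e) = u * (e * x ord0 o0) + (1 - u) * e ^+ 2 by ring.
  rewrite e1 mulr1; have [->|un0] := eqVneq u 0; first by rewrite mul0r add0r subr0.
  have up : 0 < u by rewrite lt_def un0.
  by rewrite ltr_pwDl ?subr_ge0// mulr_gt0.
have [->|un0] := eqVneq u 0.
  by left => /=; rewrite scale0r add0r !mxE !eqxx mulr1 -expr2 e1.
right; exists j => //; rewrite !mxE (negbTE j0)/=.
by rewrite mulr0 subr0 addr0 mulf_neq0.
Qed.

Let slit_cover x : x != 0 -> slit 1 x \/ slit (-1) x.
Proof.
move=> x0; have [[j j0 xj]|H] := pselect (off_axis x); first by left; right; exists j.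
have : x ord0 o0 != 0.
  apply: contra_neq x0 => x00; apply/rowP => j; rewrite mxE.
  have [->//|j0] := eqVneq j o0.
  by apply/eqP/negPn/negP => xj; apply: H; exists j.
rewrite neq_lt => /orP[x00|x00]; [right|left]; left => /=.
  by rewrite mulN1r oppr_gt0.
by rewrite mul1r.
Qed.

Let slit_neq0 e x : slit e x -> x != 0.
Proof.
move=> sx; apply/eqP => x0; move: sx; rewrite x0 => -[/=|[j _]].
  by rewrite mxE mulr0 ltxx.
by rewrite mxE eqxx.
Qed.

(** The complement of a line is connected because d >= 3. A point with nonzero third coordinate is
    joined to the second basis vector by a segment that avoids the axis; any other point is first
    moved along the third axis. *)
Let off_axis_const (g : 'rV[R]_d -> R) : smooth_on off_axis g ->
  (forall x, off_axis x -> forall i, partial i g x = 0) ->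
  forall x, off_axis x -> g x = g (basis o1).
Proof.
move=> gC g0.
have H x : x ord0 o2 != 0 -> g x = g (basis o1).
  move=> x2; have := @eq_on_segment _ _ _ g (basis o1) (x - basis o1) open_off_axis gC g0.
  rewrite subrK; apply => t t01; have [->|tn0] := eqVneq t 0.
    by exists o1 => //; rewrite scale0r add0r mxE !eqxx oner_neq0.
  by exists o2 => //; rewrite !mxE /= subr0 addr0 mulf_neq0.
move=> x [j j0 xj]; have [x2|x2] := eqVneq (x ord0 o2) 0; last exact: H.
have j2 : j != o2 by apply: contra_neq xj => ->.
rewrite -(H (basis o2 + x)); last by rewrite !mxE !eqxx x2 addr0 oner_neq0.
apply/esym/(@eq_on_segment _ _ off_axis) => // t _.
by exists j => //; rewrite !mxE (negbTE j2) andbF mulr0 add0r.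
Qed.

Lemma closed_punctured_exact (w : 'I_d -> 'rV[R]_d -> R) :
  (forall i, smooth_on punctured (w i)) ->
  (forall i j x, x != 0 -> partial i (w j) x = partial j (w i) x) ->
  exists f, smooth_on punctured f /\ forall x, x != 0 -> forall i, partial i f x = w i x.
Proof.
move=> wC wcl.
have prim e : e ^+ 2 = 1 -> exists f, smooth_on (slit e) f /\
    forall x, slit e x -> forall i, partial i f x = w i x.
  move=> e1; apply: (@poincare_starshaped_at _ _ (slit e) (e *: basis o0)).
  - exact: open_slit.
  - by move=> x u; exact: slit_star.
  - by move=> i; apply: smooth_on_sub (wC i) => x; exact: slit_neq0.
  - by move=> i j x /slit_neq0; exact: wcl.
have [f [fC fE]] := prim 1 (expr1n _ _).
have [g [gC gE]] := prim (-1) (sqrr_sign _ 1%N).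
have sub e : off_axis `<=` slit e by move=> x ?; right.
pose h x := f x - g x.
have hc x : off_axis x -> h x = h (basis o1).
  apply: off_axis_const.
    apply: smooth_onB; first exact: open_off_axis.
      exact: smooth_on_sub fC.
    exact: smooth_on_sub gC.
  move=> y oy i; rewrite /partial deriveB.
  - have E1 := fE y (sub _ _ oy) i; have E2 := gE y (sub _ _ oy) i.
    by rewrite /partial in E1 E2; rewrite E1 E2 subrr.
  - exact: smooth_on_derivable (@open_slit 1) fC (sub _ _ oy).
  - exact: smooth_on_derivable (@open_slit (-1)) gC (sub _ _ oy).
(* The two slit domains meet exactly off the axis, where f - g is constant; shifted by that
   constant, g continues f. *)
pose F x := if pselect (slit 1 x) then f x else g x + h (basis o1).
have F1 x : slit 1 x -> f x = F x by rewrite /F; case: pselect.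
have F2 x : slit (-1) x -> g x + h (basis o1) = F x.
  rewrite /F; case: pselect => // s1 s2.
  have ox : off_axis x.
    case: s1 => // /= x1; case: s2 => // /= x2.
    by move: x2; rewrite mulN1r -[x ord0 o0]mul1r oppr_gt0 ltNge ltW.
  by rewrite -(hc _ ox) /h addrC subrK.
have gc : smooth_on (slit (-1)) (fun x => g x + h (basis o1)).
  by apply: smooth_onD; [exact: open_slit|exact: gC|exact/smooth_on_cst/open_slit].
exists F; split.
  apply: smooth_on_local => x /slit_cover[sx|sx].
    by exists (slit 1); split => //; apply: smooth_on_ext fC => //; exact: F1.
  by exists (slit (-1)); split => //; apply: smooth_on_ext gc => //; exact: F2.
move=> x /slit_cover[sx|sx] i.
  rewrite -(fE _ sx); apply: near_eq_derive.
  by apply: filterS (open_near (@open_slit 1) sx) => y /F1 ->.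
rewrite -(gE _ sx).
transitivity (partial i (fun x => g x + h (basis o1)) x).
  apply: near_eq_derive.
  by apply: filterS (open_near (@open_slit (-1)) sx) => y /F2 ->.
rewrite /partial deriveD ?derive_cst ?addr0//.
exact: smooth_on_derivable (@open_slit (-1)) gC sx.
Qed.

End exactness.

(** * Integration over the sphere *)

Section translation.
Context {R : realType}.

Lemma measurable_translate (c : R) :
  measurable_fun setT (fun x : measurableTypeR R => x + c : measurableTypeR R).
Proof. by apply: measurable_funD => //; exact: measurable_cst. Qed.

Lemma lebesgue_measure_translate (c : R) (A : set (measurableTypeR R)) : measurable A ->
  lebesgue_measure [set x | A (x + c)] = lebesgue_measure A.
Proof.
move=> mA.
transitivity (pushforward lebesgue_measure
  (fun x : measurableTypeR R => x + c : measurableTypeR R) A); first by [].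
apply/esym/lebesgue_measure_unique => //; first exact: measurable_translate.
move=> mc _ [[a b]] _ <-.
transitivity (lebesgue_measure `]a - c, b - c]%classic); last first.
  by congr lebesgue_measure; apply/seteqP; split => x /=; rewrite !in_itv/= ltrBlDr lerBrDr.
rewrite !lebesgue_measure_itv/= !lte_fin ltrD2r.
by case: ifP => // _; rewrite -!EFinD; congr EFin; ring.
Qed.

End translation.

(** * Invariance of Lebesgue measure under shears *)

Section shear.
Context {R : realType}.
Notation mR := (measurableTypeR R).

Lemma measurable_cons_tuple n (x : mR) :
  measurable_fun setT (fun t : n.-tuple mR => cons_tuple x t).
Proof. exact: measurable_cons. Qed.

Lemma measurable_section n (E : set (n.+1.-tuple mR)) (x : mR) : measurable E ->
  measurable [set t : n.-tuple mR | E (cons_tuple x t)].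
Proof.
by move=> mE; rewrite -[X in measurable X]setTI; exact: measurable_cons_tuple.
Qed.

Lemma lebesgue_RnS n (E : set (n.+1.-tuple mR)) : lebesgue_Rn R n.+1 E =
  (\int[lebesgue_measure]_x lebesgue_Rn R n [set t : n.-tuple mR | E (cons_tuple x t)])%E.
Proof. by []. Qed.

(** By definition the integral over the first coordinate is the outer one; Tonelli makes it the
    inner one, where a shear of the first coordinate acts by translations of the line. *)
Lemma lebesgue_Rn_swap n (E : set (n.+1.-tuple mR)) : measurable E ->
  lebesgue_Rn R n.+1 E =
  (\int[lebesgue_Rn R n]_t lebesgue_measure [set x : mR | E (cons_tuple x t)])%E.
Proof.
move=> mE.
pose A := [set p : mR * n.-tuple mR | E (cons_tuple p.1 p.2)].
have mA : measurable A.
  rewrite -[X in measurable X]setTI.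
  apply: (_ : measurable_fun setT (fun p : mR * n.-tuple mR => cons_tuple p.1 p.2)) => //.
  exact: measurable_cons.
have := @indic_fubini_tonelli _ _ _ _ R lebesgue_measure (lebesgue_Rn R n) A mA.
rewrite indic_fubini_tonelli_FE// indic_fubini_tonelli_GE// => H.
transitivity (\int[lebesgue_measure]_x (lebesgue_Rn R n \o xsection A) x)%E.
  apply: eq_integral => x _ /=; congr lebesgue_Rn.
  by apply/seteqP; split => t; rewrite /xsection /= inE.
rewrite H; apply: eq_integral => t _ /=; congr lebesgue_measure.
by apply/seteqP; split => x; rewrite /ysection /= inE.
Qed.

Definition shear n (i : 'I_n) (psi : n.-tuple mR -> R) (t : n.-tuple mR) : n.-tuple mR :=
  [tuple if j == i then tnth t j + psi t else tnth t j | j < n].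

Lemma measurable_shear n (i : 'I_n) psi :
  measurable_fun setT (psi : _ -> mR) -> measurable_fun setT (shear i psi).
Proof.
move=> mpsi; apply/measurable_fun_tnthP => j.
have -> : (@tnth n mR)^~ j \o shear i psi =
    (fun t => if j == i then tnth t j + psi t else tnth t j).
  by apply/funext => t /=; rewrite tnth_mktuple.
case: (j == i); last exact: measurable_tnth.
by apply: measurable_funD => //; exact: measurable_tnth.
Qed.

Lemma shear_cons_lift n (k : 'I_n) psi (x : mR) (t : n.-tuple mR) :
  shear (lift ord0 k) psi (cons_tuple x t) =
  cons_tuple x (shear k (fun t => psi (cons_tuple x t)) t).
Proof.
apply: eq_from_tnth => j; rewrite tnth_mktuple.
have [l ->|->] := unliftP ord0 j; last by rewrite !tnth0.
by rewrite !tnthS tnth_mktuple (inj_eq lift_inj).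
Qed.

Lemma shear_cons0 n psi (x : mR) (t : n.-tuple mR) :
  shear ord0 psi (cons_tuple x t) = cons_tuple (x + psi (cons_tuple x t)) t.
Proof.
apply: eq_from_tnth => j; rewrite tnth_mktuple.
by have [l ->|->] := unliftP ord0 j; rewrite ?tnthS ?tnth0.
Qed.

(* A shear adds to one coordinate a function of the others, so by Cavalieri
   its invariance reduces to that of the line under translations. *)
Lemma lebesgue_Rn_shear n (i : 'I_n) (psi : n.-tuple mR -> R) E :
  measurable_fun setT (psi : _ -> mR) ->
  (forall t t' : n.-tuple mR, (forall j, j != i -> tnth t j = tnth t' j) -> psi t = psi t') ->
  measurable E ->
  lebesgue_Rn R n (shear i psi @^-1` E) = lebesgue_Rn R n E.
Proof.
elim: n i psi E => [[]//|n ih] i psi E mpsi psii mE.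
have [k ik|i0] := unliftP ord0 i.
  rewrite !lebesgue_RnS; apply: eq_integral => x _; rewrite -(ih k (fun t => psi (cons_tuple x t)) [set t | E (cons_tuple x t)]).
  - by congr lebesgue_Rn; apply/seteqP; split => t /=; rewrite ik shear_cons_lift.
  - apply: (@measurableT_comp _ _ _ _ _ _ (psi : _ -> mR)) => //.
    exact: measurable_cons_tuple.
  - move=> t t' tt'; apply: psii => j; rewrite ik.
    have [l ->|->] := unliftP ord0 j; last by rewrite !tnth0.
    by rewrite (inj_eq lift_inj) !tnthS; exact: tt'.
  - exact: measurable_section.
rewrite i0 in psii *.
have mshE : measurable (shear ord0 psi @^-1` E).
  by rewrite -[X in measurable X]setTI; exact: measurable_shear.
rewrite !lebesgue_Rn_swap//; apply: eq_integral => t _.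
have mEt : measurable [set x : mR | E (cons_tuple x t)].
  rewrite -[X in measurable X]setTI.
  apply: (_ : measurable_fun setT (fun x : mR => cons_tuple x t)) => //.
  exact: measurable_cons.
rewrite -(lebesgue_measure_translate (psi (cons_tuple 0 t)) mEt).
congr lebesgue_measure; apply/seteqP; split => x /=; rewrite shear_cons0;
  rewrite (psii (cons_tuple x t) (cons_tuple 0 t))// => j;
  by have [l ->|->] := unliftP ord0 j; rewrite ?eqxx ?tnthS.
Qed.

End shear.

(** * Plane rotations *)

Section rotation.
Context {R : realType} {n : nat}.
Notation mR := (measurableTypeR R).
Variables (j k : 'I_n) (c s : R).
Hypotheses (jk : j != k) (cs1 : c ^+ 2 + s ^+ 2 = 1).

Definition rotation (x : 'rV[R]_n) : 'rV[R]_n :=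
  \row_i (if i == j then c * x ord0 j - s * x ord0 k
          else if i == k then s * x ord0 j + c * x ord0 k else x ord0 i).

(** Tuples carry the measure and rows carry the calculus, hence two versions of the same map. *)
Definition trotation (t : n.-tuple mR) : n.-tuple mR :=
  [tuple if i == j then c * tnth t j - s * tnth t k
         else if i == k then s * tnth t j + c * tnth t k else tnth t i | i < n].

Lemma row_of_trotation t : row_of_tuple (trotation t) = rotation (row_of_tuple t).
Proof. by apply/rowP => i; rewrite !mxE tnth_mktuple. Qed.

Lemma measurable_trotation : measurable_fun setT trotation.
Proof.
apply/measurable_fun_tnthP => i.
have mt (a : R) l : measurable_fun setT (fun t : n.-tuple mR => a * tnth t l : mR).
  by apply: measurable_funM; [exact: measurable_cst|exact: measurable_tnth].
have -> : (@tnth n mR)^~ i \o trotation =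
    (fun t => if i == j then c * tnth t j - s * tnth t k
         else if i == k then s * tnth t j + c * tnth t k else tnth t i).
  by apply/funext => t /=; rewrite tnth_mktuple.
case: (i == j); first by apply: measurable_funB; exact: mt.
case: (i == k); first by apply: measurable_funD; exact: mt.
exact: measurable_tnth.
Qed.

(* A rotation of a coordinate plane is the product of three shears. *)
Lemma lebesgue_Rn_rotation E : s != 0 -> measurable E ->
  lebesgue_Rn R n (trotation @^-1` E) = lebesgue_Rn R n E.
Proof.
move=> s0 mE.
(* If c = cos theta and s = sin theta, then a = - tan (theta / 2), which is why s must be
   nonzero. *)
pose a := - (1 - c) / s.
pose f (t : n.-tuple mR) : R := a * tnth t k.
pose g (t : n.-tuple mR) : R := s * tnth t j.
have mf : measurable_fun setT (f : _ -> mR).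
  by apply: measurable_funM; [exact: measurable_cst|exact: measurable_tnth].
have mg : measurable_fun setT (g : _ -> mR).
  by apply: measurable_funM; [exact: measurable_cst|exact: measurable_tnth].
have fP t t' : (forall i, i != j -> tnth t i = tnth t' i) -> f t = f t'.
  by move=> tt'; rewrite /f tt'// eq_sym.
have gP t t' : (forall i, i != k -> tnth t i = tnth t' i) -> g t = g t'.
  by move=> tt'; rewrite /g tt'.
have pre (h : n.-tuple mR -> n.-tuple mR) F : measurable_fun setT h -> measurable F ->
    measurable (h @^-1` F).
  by move=> mh mF; rewrite -[X in measurable X]setTI; exact: mh.
have -> : trotation = shear j f \o (shear k g \o shear j f).
  apply/funext => t.
  apply: eq_from_tnth => i; rewrite /= !tnth_mktuple /f /g !tnth_mktuple.
  rewrite !eqxx [k == j]eq_sym (negbTE jk).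
  have ac : 1 + a * s = c by rewrite /a; field.
  have ac' : a + c * a = - s.
    have : s * (a + c * a) = s * - s.
      have -> : s * (a + c * a) = - (1 - c) * (1 + c) by rewrite /a; field.
      by move: cs1; rewrite !expr2; lra.
    by move/(mulfI s0).
  have [->|ij] := eqVneq i j.
    rewrite (negbTE jk); set u := tnth t j; set v := tnth t k.
    have -> : u + a * v + a * (v + s * (u + a * v)) =
      (1 + a * s) * u + (a + (1 + a * s) * a) * v by ring.
    by rewrite ac ac' mulNr.
  have [->|//] := eqVneq i k.
  set u := tnth t j; set v := tnth t k.
  have -> : v + s * (u + a * v) = s * u + (1 + a * s) * v by ring.
  by rewrite ac.
have mE1 : measurable (shear j f @^-1` E) by apply: pre => //; exact: measurable_shear.
have mE2 : measurable (shear k g @^-1` (shear j f @^-1` E)).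
  by apply: pre => //; exact: measurable_shear.
transitivity (lebesgue_Rn R n (shear j f @^-1` (shear k g @^-1` (shear j f @^-1` E)))).
  by [].
by rewrite !lebesgue_Rn_shear.
Qed.

Lemma dot_rotation x y : dot (rotation x) (rotation y) = dot x y.
Proof.
rewrite /dot (bigD1 j)//= [in RHS](bigD1 j)//= (bigD1 k) 1?eq_sym//=.
rewrite [in RHS](bigD1 k) 1?eq_sym//= !addrA; congr (_ + _).
  rewrite !mxE !eqxx [k == j]eq_sym (negbTE jk).
  have -> : (c * x ord0 j - s * x ord0 k) * (c * y ord0 j - s * y ord0 k) +
    (s * x ord0 j + c * x ord0 k) * (s * y ord0 j + c * y ord0 k) =
    (c ^+ 2 + s ^+ 2) * (x ord0 j * y ord0 j + x ord0 k * y ord0 k) by ring.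
  by rewrite cs1 mul1r.
by apply: eq_bigr => i /andP[ij ik]; rewrite !mxE (negbTE ij) (negbTE ik).
Qed.

Lemma enorm_rotation x : enorm (rotation x) = enorm x.
Proof. by rewrite /enorm dot_rotation. Qed.

Lemma rotationZ (b : R) x : rotation (b *: x) = b *: rotation x.
Proof.
by apply/rowP => i; rewrite !mxE; case: ifP => _; [|case: ifP => _ //]; ring.
Qed.

Lemma radial_rotation x : radial (rotation x) = rotation (radial x).
Proof. by rewrite /radial enorm_rotation rotationZ. Qed.

End rotation.

(** * Measurability of continuous functions *)

Section borel.
Context {R : realType} {n : nat}.
Notation mR := (measurableTypeR R).

Let grid (k : nat) (t : n.-tuple mR) : n.-tuple int :=
  [tuple Num.floor (k.+1%:R * tnth t i : R) | i < n].

Let node (k : nat) (z : n.-tuple int) : 'rV[R]_n := \row_i ((tnth z i)%:~R / k.+1%:R).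

Let measurable_grid k z : measurable [set t | grid k t = z].
Proof.
have -> : [set t | grid k t = z] = \bigcap_(i in [set: 'I_n])
    ((fun t : n.-tuple mR => tnth t i) @^-1`
      `[(tnth z i)%:~R / k.+1%:R, ((tnth z i) + 1)%:~R / k.+1%:R[%classic).
  have E (x : R) (m : int) : (Num.floor (k.+1%:R * x) = m) <->
      (m%:~R / k.+1%:R <= x < (m + 1)%:~R / k.+1%:R).
    have k0 : 0 < k.+1%:R :> R by [].
    rewrite ler_pdivrMr// ltr_pdivlMr// mulrC.
    split=> [<-|]; first exact: floor_itv.
    exact: floor_def.
  apply/seteqP; split => t /=.
    move=> <- i _ /=; rewrite in_itv/=; apply/E.
    by rewrite tnth_mktuple.
  move=> H; apply: eq_from_tnth => i; rewrite tnth_mktuple; apply/E.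
  by have := H i I; rewrite /= in_itv.
apply: fin_bigcap_measurable => // i _; rewrite -[X in measurable X]setTI.
exact: measurable_tnth.
Qed.

Let node_grid_le k t i : `|(node k (grid k t)) ord0 i - row_of_tuple t ord0 i| <= k.+1%:R^-1.
Proof.
rewrite !mxE tnth_mktuple.
have /andP[] := floor_itv (k.+1%:R * tnth t i : R).
set m := Num.floor _; rewrite intrD mulr1z => m1 m2.
have k0 : 0 < k.+1%:R :> R by [].
rewrite ler_norml; apply/andP; split.
  rewrite lerBrDr -mulN1r -(ler_pM2r k0) mulrDl -!mulrA !mulVf ?gt_eqF// !mulr1.
  by move: m2; rewrite mulrC; lra.
by rewrite lerBlDr -(ler_pM2r k0) mulrDl -!mulrA !mulVf ?gt_eqF// !mulr1; lra.
Qed.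

Let node_grid_cvg t : node k (grid k t) @[k --> \oo] --> row_of_tuple t.
Proof.
apply/cvgrPdist_le => /= e e0; near=> k.
rewrite [leLHS]/Num.Def.normr/= mx_normrE (bigmax_le _ (ltW e0))//= => -[a i] _.
rewrite (ord1 a) [X in `|X|]mxE [X in _ + X]mxE distrC (le_trans (node_grid_le _ _ _))//.
by apply/ltW; near: k; exact: near_infty_natSinv_lt (PosNum e0).
Unshelve. all: by end_near. Qed.

(* Off the origin G is the pointwise limit of its values at the nodes of the
   grids of mesh 1/k, which are measurable functions as there are countably
   many nodes; the origin is a node of each grid. *)
Lemma measurable_continuous_row (G : 'rV[R]_n -> R) :
  (forall x, x != 0 -> {for x, continuous G}) ->
  measurable_fun setT (fun t => G (row_of_tuple t) : mR).
Proof.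
move=> Gc.
apply: (@measurable_fun_cvg _ _ _ setT (fun k t => G (node k (grid k t)))).
  move=> k _ Y mY; rewrite setTI.
  have -> : (fun t => G (node k (grid k t))) @^-1` Y =
      \bigcup_(z : n.-tuple int) ([set t | grid k t = z /\ Y (G (node k z))]).
    apply/seteqP; split => t /=; first by exists (grid k t).
    by move=> [z _ /= [<-]].
  apply: countable_bigcupT_measurable => [|z]; first exact: countableP.
  have [Yz|Yz] := pselect (Y (G (node k z))).
    rewrite (_ : mkset _ = [set t | grid k t = z]); first exact: measurable_grid.
    by apply/seteqP; split => t /=; [case|split].
  rewrite (_ : mkset _ = set0); first exact: measurable0.
  by apply/seteqP; split => t //= [].
move=> t _.
have [t0|t0] := eqVneq (row_of_tuple t) 0.
  rewrite (_ : (fun k => _) = cst (G (row_of_tuple t))); first exact: cvg_cst.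
  apply/funext => k; congr G; apply/rowP => i; rewrite !mxE tnth_mktuple.
  have -> : tnth t i = 0 by have := congr1 (fun x : 'rV[R]_n => x ord0 i) t0; rewrite !mxE.
  by rewrite mulr0 floor0 mul0r.
by apply: (cvg_comp _ _ (@node_grid_cvg t)); exact: Gc.
Qed.

End borel.

Section sphere_mean.
Context {R : realType} {n : nat}.
Notation mR := (measurableTypeR R).
Notation T := (n.-tuple mR).
Implicit Types (f g : 'rV[R]_n -> R) (s : 'rV[R]_n).

Definition pball : set T := [set t | (0 < enorm (row_of_tuple t) < 1)%R].

Lemma enorm_continuous (x : 'rV[R]_n) : {for x, continuous enorm}.
Proof.
apply: (@continuous_comp _ _ _ (fun x => dot x x) Num.sqrt).
  exact: smooth_on_continuous openT (smooth_on_dot openT) I.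
exact: sqrt_continuous.
Qed.

Lemma measurable_pball : measurable pball.
Proof.
have me : measurable_fun setT (fun t : T => enorm (row_of_tuple t) : mR).
  by apply: measurable_continuous_row => x _; exact: enorm_continuous.
have -> : pball = (fun t : T => enorm (row_of_tuple t) : mR) @^-1` `]0, 1[%classic.
  by apply/seteqP; split => t /=; rewrite in_itv.
by rewrite -[X in measurable X]setTI; exact: me.
Qed.

Lemma pball_neq0 t : pball t -> row_of_tuple t != 0.
Proof. by move=> /andP[+ _]; rewrite enorm_gt0. Qed.

Lemma pball_sphere t : pball t -> sphere (radial (row_of_tuple t)).
Proof. by move=> /pball_neq0; exact: radial_sphere. Qed.

End sphere_mean.

Section cube.
Context {R : realType}.
Notation mR := (measurableTypeR R).

(** The centre is indexed by nat so that the induction can drop its first coordinate by a shift. *)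
Lemma lebesgue_Rn_cube n (c : nat -> R) (h : R) : 0 < h ->
  lebesgue_Rn R n [set t : n.-tuple mR | forall i : 'I_n, c i - h < tnth t i < c i + h] =
  ((2 * h) ^+ n)%:E.
Proof.
move=> h0; elim: n c => [|n ih] c.
  rewrite /= diracE mem_set ?expr0//.
  by move=> /= [].
rewrite lebesgue_RnS.
transitivity (\int[lebesgue_measure]_(x in `](c 0%N - h)%R, (c 0%N + h)%R[) ((2 * h) ^+ n)%:E)%E.
  rewrite [RHS]integral_mkcond; apply: eq_integral => x _; rewrite patchE.
  case: ifPn; rewrite ?inE ?notin_setE/= in_itv/= => xc.
    rewrite -(ih (fun k => c k.+1)); congr lebesgue_Rn; apply/seteqP; split => t /= H i.
      by have := H (lift ord0 i); rewrite tnthS.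
    by have [j ->|->] := unliftP ord0 i; rewrite ?tnthS ?tnth0//; exact: H.
  rewrite (_ : mkset _ = set0) ?measure0//; apply/seteqP; split => t //= H.
  by apply: xc; have := H ord0; rewrite tnth0.
rewrite integral_cst//= lebesgue_measure_itv/= lte_fin.
have -> : c 0%N - h < c 0%N + h by lra.
by rewrite -EFinM exprS; congr EFin; ring.
Qed.

End cube.

(** * The integral over the sphere as a functional *)

Section sphere_functional.
Context {R : realType} {n : nat}.
Notation mR := (measurableTypeR R).
Notation T := (n.-tuple mR).
Notation mu := (lebesgue_Rn R n).
Implicit Types (f g : 'rV[R]_n -> R) (s : 'rV[R]_n).

Lemma measurable_cube (c : nat -> R) (h : R) :
  measurable [set t : T | forall i : 'I_n, c i - h < tnth t i < c i + h].
Proof.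
have -> : [set t : T | forall i : 'I_n, c i - h < tnth t i < c i + h] =
    \bigcap_(i in [set: 'I_n])
    ((fun t : T => tnth t i) @^-1` `](c i - h), (c i + h)[%classic).
  apply/seteqP; split => t /= H i; first by move=> _; rewrite /= in_itv/=.
  by have := H i I; rewrite /= in_itv.
apply: fin_bigcap_measurable => // i _; rewrite -[X in measurable X]setTI.
exact: measurable_tnth.
Qed.

Lemma lebesgue_pball_fin : (mu (@pball R n) < +oo)%E.
Proof.
apply: le_lt_trans (_ : ((2 * 1) ^+ n)%:E < +oo)%E; last exact: ltry.
rewrite -(@lebesgue_Rn_cube R n (fun=> 0) 1 ltr01).
apply: le_measure; rewrite ?inE; [exact: measurable_pball|exact: (measurable_cube (fun=> 0) 1)|].
move=> t /andP[_ t1] i; rewrite sub0r add0r -ltr_norml.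
have := coord_enorm_le (row_of_tuple t) i; rewrite mxE => H.
exact: le_lt_trans H t1.
Qed.

(** This class is stable under sums and products and consists of functions integrable over the ball,
    so that no further integrability has to be checked along the computations. *)
Definition nice f := sphere_measurable f /\ exists C, forall s, sphere s -> `|f s| <= C.

Definition on_ball f (t : T) : R := f (radial (row_of_tuple t)).

(** The surface integral is n times this one, see [sphere_integralE]; constants are not normalised
    to be their own mean. *)
Definition smean f : R := (\int[mu]_(t in @pball R n) on_ball f t)%R.

Lemma nice_integrable f : nice f -> mu.-integrable (@pball R n) (EFin \o on_ball f).
Proof.
move=> [mf [C fC]]; apply: measurable_bounded_integrable.
- exact: measurable_pball.
- exact: lebesgue_pball_fin.
- exact: measurable_funS mf.
- exists `|C|; split; first exact: num_real.
  move=> M CM t /pball_sphere /fC H.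
  by rewrite /= /on_ball (le_trans H)// (le_trans (ler_norm _))// ltW.
Qed.

Lemma eq_smean f g : (forall s, sphere s -> f s = g s) -> smean f = smean g.
Proof.
by move=> fg; apply: eq_Rintegral => t; rewrite inE => /pball_sphere; exact: fg.
Qed.

Lemma sphere_integralE f : nice f ->
  sphere_integral (fun s => (f s)%:E) = (n%:R * smean f)%:E.
Proof.
move=> nf; rewrite /sphere_integral EFinM; congr (_ * _)%E.
rewrite /smean /Rintegral fineK//.
exact: (integrable_fin_num measurable_pball (nice_integrable nf)).
Qed.

Lemma niceD f g : nice f -> nice g -> nice (fun s => f s + g s).
Proof.
move=> [mf [C fC]] [mg [D gD]]; split; first exact: measurable_funD.
by exists (C + D) => s ss; rewrite (le_trans (ler_normD _ _))// lerD ?fC ?gD.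
Qed.

Lemma niceM f g : nice f -> nice g -> nice (fun s => f s * g s).
Proof.
move=> [mf [C fC]] [mg [D gD]]; split; first exact: measurable_funM.
by exists (C * D) => s ss; rewrite normrM ler_pM ?fC ?gD.
Qed.

Lemma nice_cst (k : R) : nice (fun=> k).
Proof. by split; [exact: measurable_cst|exists `|k|]. Qed.

Lemma niceZ k f : nice f -> nice (fun s => k * f s).
Proof. by move=> nf; apply: niceM => //; exact: nice_cst. Qed.

Lemma niceN f : nice f -> nice (fun s => - f s).
Proof.
by move=> /(niceZ (-1)); under [X in nice X -> _]eq_fun do rewrite mulN1r.
Qed.

Lemma niceB f g : nice f -> nice g -> nice (fun s => f s - g s).
Proof. by move=> nf ng; apply: niceD => //; exact: niceN. Qed.

Lemma nice_norm f : nice f -> nice (fun s => `|f s|).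
Proof.
move=> [mf [C fC]]; split; first exact: measurableT_comp.
by exists C => s ss; rewrite normr_id fC.
Qed.

Lemma nice_sum I (r : seq I) (f : I -> 'rV[R]_n -> R) :
  (forall i, nice (f i)) -> nice (fun s => \sum_(i <- r) f i s).
Proof.
move=> nf; elim: r => [|i r ih].
  by under eq_fun do rewrite big_nil; exact: nice_cst.
by under eq_fun do rewrite big_cons; exact: niceD.
Qed.

Lemma smeanD f g : nice f -> nice g -> smean (fun s => f s + g s) = smean f + smean g.
Proof.
move=> nf ng; rewrite /smean -RintegralD//; [exact: measurable_pball| |];
exact: nice_integrable.
Qed.

Lemma smeanB f g : nice f -> nice g -> smean (fun s => f s - g s) = smean f - smean g.
Proof.
move=> nf ng; rewrite /smean -RintegralB//; [exact: measurable_pball| |];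
exact: nice_integrable.
Qed.

Lemma smeanZ k f : nice f -> smean (fun s => k * f s) = k * smean f.
Proof.
move=> nf; rewrite /smean -RintegralZl//; first exact: measurable_pball.
exact: nice_integrable.
Qed.

Lemma smean0 : smean (fun=> 0) = 0.
Proof. by have := smeanZ 0 (nice_cst 0); rewrite !mul0r. Qed.

Lemma smean_sum I (r : seq I) (f : I -> 'rV[R]_n -> R) :
  (forall i, nice (f i)) ->
  smean (fun s => \sum_(i <- r) f i s) = \sum_(i <- r) smean (f i).
Proof.
move=> nf; elim: r => [|i r ih].
  rewrite big_nil; transitivity (smean (fun=> 0)); last exact: smean0.
  by apply: eq_smean => s _; rewrite big_nil.
rewrite big_cons -ih -smeanD//; last exact: nice_sum.
by apply: eq_smean => s _; rewrite big_cons.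
Qed.

Lemma le_smean f g : nice f -> nice g -> (forall s, sphere s -> f s <= g s) ->
  smean f <= smean g.
Proof.
move=> nf ng fg; apply: le_Rintegral; [exact: measurable_pball|exact: nice_integrable
  |exact: nice_integrable|by move=> t /pball_sphere; exact: fg].
Qed.

Lemma smean_ge0 f : (forall s, sphere s -> 0 <= f s) -> 0 <= smean f.
Proof. by move=> f0; apply: Rintegral_ge0 => t /pball_sphere; exact: f0. Qed.

Lemma norm_smean f : nice f -> `|smean f| <= smean (fun s => `|f s|).
Proof.
move=> nf; rewrite /smean (le_trans (le_normr_Rintegral _ _))//.
- exact: measurable_pball.
- exact: nice_integrable.
Qed.

(** The ball is invariant under the rotation and [radial] commutes with it; the rest is the change
    of variables for an image measure. *)
Lemma smean_rotation f (j k : 'I_n) (c s : R) : nice f -> j != k ->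
  c ^+ 2 + s ^+ 2 = 1 -> s != 0 -> smean (f \o rotation j k c s) = smean f.
Proof.
move=> nf jk cs1 s0; have [mf _] := nf.
pose phi := trotation j k c s.
have mphi : measurable_fun setT phi by exact: measurable_trotation.
have pE : phi @^-1` @pball R n = @pball R n.
  by apply/seteqP; split => t; rewrite /pball /= row_of_trotation enorm_rotation.
have fE : on_ball (f \o rotation j k c s) = on_ball f \o phi.
  by apply/funext => t; rewrite /on_ball /= row_of_trotation radial_rotation.
have ifphi : mu.-integrable (phi @^-1` @pball R n) ((EFin \o on_ball f) \o phi).
  have -> : (EFin \o on_ball f) \o phi = EFin \o on_ball (f \o rotation j k c s).
    by rewrite fE.
  rewrite pE; apply: nice_integrable; split.
    have := measurableT_comp mf mphi.
    by rewrite (_ : _ \o phi = on_ball f \o phi)// -fE.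
  have [_ [C fC]] := nf; exists C => x sx; apply: fC.
  by rewrite /sphere/= enorm_rotation.
have mF : measurable_fun setT (EFin \o on_ball f) by exact/measurable_EFinP.
have := integral_pushforward mphi mF ifphi measurable_pball.
rewrite pE => H; rewrite /smean /Rintegral; congr fine.
transitivity (\int[mu]_(x in @pball R n) ((EFin \o on_ball f) \o phi) x)%E.
  by apply: eq_integral => t _; rewrite fE.
rewrite -H; apply: eq_measure_integral => A mA _.
exact: lebesgue_Rn_rotation.
Qed.

Lemma radial_continuous (x : 'rV[R]_n) : x != 0 -> {for x, continuous radial}.
Proof.
move=> x0; apply: row_continuous => l.
exact: smooth_on_continuous (@open_punctured R n) (@smooth_map_on_radial _ _ l) x0.
Qed.

Lemma compact_sphere : compact (@sphere R n).
Proof.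
apply: bounded_closed_compact.
  exists 1; split; first exact: num_real.
  move=> M M1 x sx /=; rewrite [leLHS]/Num.Def.normr/= mx_normrE.
  apply: bigmax_le; first by rewrite (le_trans ler01)// ltW.
  move=> [a i] _; rewrite (ord1 a) (le_trans (coord_enorm_le x i))// sx.
  exact: ltW.
have -> : @sphere R n = enorm @^-1` [set 1] by [].
apply: preimage_closed; first by move=> x _; exact: enorm_continuous.
exact/accessible_closed_set1/hausdorff_accessible/norm_hausdorff.
Qed.

Lemma continuous_sphere_bounded f : (forall s, sphere s -> {for s, continuous f}) ->
  exists C, forall s, sphere s -> `|f s| <= C.
Proof.
move=> fc.
have [[s0 ss0]|S0] := pselect (exists s, @sphere R n s); last first.
  by exists 0 => s ss; exfalso; apply: S0; exists s.
have fnc : {within @sphere R n, continuous (fun s => `|f s|)}.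
  apply: continuous_in_subspaceT => s; rewrite inE => ss.
  by apply: continuous_comp; [exact: fc|exact: norm_continuous].
have [|c _ cP] := compact_EVT_max _ compact_sphere fnc; first by exists s0.
by exists `|f c| => s ss; apply: cP; rewrite inE.
Qed.

Lemma continuous_nice f : (forall x, x != 0 -> {for x, continuous f}) -> nice f.
Proof.
move=> fc; split; last first.
  by apply: continuous_sphere_bounded => s /sphere_neq0; exact: fc.
apply: (@measurable_continuous_row _ _ (f \o radial)) => x x0.
apply: continuous_comp; first exact: radial_continuous.
exact/fc/sphere_neq0/radial_sphere.
Qed.

Lemma smooth_nice f : smooth_on punctured f -> nice f.
Proof.
move=> fC; apply: continuous_nice => x x0.
exact: smooth_on_continuous (@open_punctured R n) fC x0.
Qed.

(** By continuity the extension of f is at least f s0 / 2 on a small cube inside the ball, and the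
    cube has positive volume. *)
Lemma smean_gt0 f s0 : (forall x, x != 0 -> {for x, continuous f}) ->
  (forall s, sphere s -> 0 <= f s) -> sphere s0 -> 0 < f s0 -> 0 < smean f.
Proof.
move=> fc f0 ss0 fs0.
(* This point is half-way between the origin and the boundary: a tolerance of 1/4 on the norm keeps
   the cube inside the punctured ball. *)
pose x0 : 'rV[R]_n := 2^-1 *: s0.
have ex0 : enorm x0 = 2^-1 by rewrite enormZ ss0 mulr1 ger0_norm ?invr_ge0.
have x00 : x0 != 0 by rewrite -enorm_gt0 ex0 invr_gt0.
have rx0 : radial x0 = s0 by rewrite radialZ ?invr_gt0// radial_id.
have f2 : 0 < f s0 / 2 by rewrite divr_gt0.
have frc : {for x0, continuous (f \o radial)}.
  apply: continuous_comp; first exact: radial_continuous.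
  by rewrite rx0; exact/fc/sphere_neq0.
have e4 : 0 < 4^-1 :> R by rewrite invr_gt0.
have N1 := continuous_dist_near frc f2.
have N2 := continuous_dist_near (@enorm_continuous R n x0) e4.
have [h /= h0 hP] := (nbhs_ballP _ _).1 (filterI N1 N2).
pose c (i : nat) := oapp (fun j : 'I_n => x0 ord0 j) 0 (insub i).
have cE (i : 'I_n) : c i = x0 ord0 i by rewrite /c valK.
pose Q := [set t : T | forall i : 'I_n, c i - h < tnth t i < c i + h].
have QP t : Q t -> pball t /\ f s0 / 2 <= on_ball f t.
  move=> Qt; have : ball x0 h (row_of_tuple t).
    split=> // a i; rewrite (ord1 a) [row_of_tuple t _ _]mxE -cE /ball/= ltr_norml.
    by have /andP[] := Qt i; move=> ? ?; apply/andP; split; lra.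
  move=> /hP[/=]; rewrite /on_ball /= rx0 ex0 => E1 E2; split.
    by move: E2; rewrite ler_norml => /andP[E2 E3]; apply/andP; split; lra.
  by move: E1; rewrite ler_norml => /andP[E1 E3]; lra.
have mQ : measurable Q by exact: measurable_cube.
have nf := continuous_nice fc.
have vQ : 0 < (2 * h) ^+ n by rewrite exprn_gt0// mulr_gt0.
apply: (@lt_le_trans _ _ (f s0 / 2 * (2 * h) ^+ n)); first exact: mulr_gt0.
have fin := integrable_fin_num measurable_pball (nice_integrable nf).
rewrite -lee_fin /smean /Rintegral fineK//.
have [mf _] := nf.
have mfE (D : set T) : measurable_fun D (EFin \o on_ball f).
  by apply/measurable_EFinP; exact: measurable_funS mf.
apply: (@le_trans _ _ (\int[mu]_(t in Q) (f s0 / 2)%:E)%E).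
  by rewrite integral_cst// [X in (_ * X)%E]lebesgue_Rn_cube// EFinM.
apply: (@le_trans _ _ (\int[mu]_(t in Q) (on_ball f t)%:E)%E).
  apply: ge0_le_integral => //.
  - by move=> t _; rewrite lee_fin ltW.
  - by move=> t /QP[_]; rewrite lee_fin.
apply: ge0_subset_integral => //.
- exact: measurable_pball.
- by move=> t /pball_sphere /f0; rewrite lee_fin.
- by move=> t /QP[].
Qed.

End sphere_functional.

(** * Flatness from small energy *)

Section rotor.
Context {R : realType} {n : nat}.
Implicit Types (G H : 'rV[R]_n -> R) (x s : 'rV[R]_n).

(** The derivative along x_j d_k - x_k d_j, the generator of the rotations of the (j, k)-plane; this
    field is tangent to all spheres about 0. *)
Definition rotor (j k : 'I_n) G x : R :=
  x ord0 j * partial k G x - x ord0 k * partial j G x.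

Notation punct := (@punctured R n).
Let op : open punct := @open_punctured R n.

Lemma smooth_on_rotor j k G : smooth_on punct G -> smooth_on punct (rotor j k G).
Proof.
by move=> GC; apply: smooth_onB => //; apply: smooth_onM => //;
  first [exact: smooth_on_coord|exact: smooth_on_partial].
Qed.

Lemma is_derive_rotation j k (t : R) x l : j != k ->
  is_derive t 1 (fun t : R => rotation j k (cos t) (sin t) x ord0 l)
    (if l == j then - rotation j k (cos t) (sin t) x ord0 k
     else if l == k then rotation j k (cos t) (sin t) x ord0 j else 0).
Proof.
move=> jk; have E (y : R) i : rotation j k (cos y) (sin y) x ord0 i =
    if i == j then cos y * x ord0 j - sin y * x ord0 k
    else if i == k then sin y * x ord0 j + cos y * x ord0 k else x ord0 i.
  by rewrite mxE.
under eq_fun do rewrite E; rewrite !E !eqxx [k == j]eq_sym (negbTE jk).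
have dc (a : R) : is_derive t 1 (fun y => a * cos y) (a * - sin t).
  exact: (is_derive_scale a (is_derive_cos t)).
have ds (a : R) : is_derive t 1 (fun y => a * sin y) (a * cos t).
  exact: (is_derive_scale a (is_derive_sin t)).
case: (l == j).
  under eq_fun do rewrite mulrC (mulrC (sin _)).
  by apply: is_derive_eq (is_deriveB (dc _) (ds _)) _; ring.
case: (l == k); last exact: is_derive_cst.
under eq_fun do rewrite mulrC (mulrC (cos _)).
by apply: is_derive_eq (is_deriveD (ds _) (dc _)) _; ring.
Qed.

Lemma rotation_neq0 j k (t : R) x : j != k -> x != 0 ->
  rotation j k (cos t) (sin t) x != 0.
Proof. by move=> jk; rewrite -!enorm_gt0 enorm_rotation// cos2Dsin2. Qed.

Lemma is_derive_along_rotation j k G (t : R) x : smooth_on punct G -> j != k -> x != 0 ->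
  is_derive t 1 (fun t : R => G (rotation j k (cos t) (sin t) x))
    (rotor j k G (rotation j k (cos t) (sin t) x)).
Proof.
move=> GC jk x0; set y := rotation j k (cos t) (sin t) x.
have y0 : y != 0 by exact: rotation_neq0.
have D := fun l => @is_derive_rotation j k t x l jk.
have dG : differentiable G y by exact: smooth_on_differentiable GC y0.
have dF l : derivable (fun t : R => rotation j k (cos t) (sin t) x ord0 l) t 1.
  by have [] := D l.
apply: is_derive_eq (@is_derive_comp R R^o n G (fun t : R^o => rotation j k (cos t) (sin t) x) t 1 dG dF) _.
rewrite -/y (bigD1 j)//= (bigD1 k) 1?eq_sym//= big1 ?addr0; last first.
  move=> l /andP[lj lk]; have [_ ->] := D l.
  by rewrite (negbTE lj) (negbTE lk) mulr0.
have [_ ->] := D j; have [_ ->] := D k.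
rewrite !eqxx [k == j]eq_sym (negbTE jk) -/y /rotor.
by rewrite addrC mulrN mulrC (mulrC (partial j G y)).
Qed.

(** [mvt_bound] is used twice along the orbit of s; the constant is uniform because the second
    derivative along orbits is bounded on the compact sphere. *)
Lemma rotation_taylor j k G : smooth_on punct G -> j != k -> exists C : R,
  forall s (t : R), sphere s ->
    `|G (rotation j k (cos t) (sin t) s) - G s - t * rotor j k G s| <= C * t ^+ 2.
Proof.
move=> GC jk; have LC := smooth_on_rotor j k GC.
have LLC := smooth_on_rotor j k LC.
have [C CP] : exists C, forall s, sphere s -> `|rotor j k (rotor j k G) s| <= C.
  apply: continuous_sphere_bounded => s /sphere_neq0 s0.
  exact: smooth_on_continuous op LLC s0.
exists C => s t ss; have s0 := sphere_neq0 ss.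
have r0 : rotation j k (cos 0) (sin 0) s = s.
  rewrite cos0 sin0; apply/rowP => i; rewrite !mxE.
  by have [->|_] := eqVneq i j; [ring|have [->|//] := eqVneq i k; ring].
have rs (u : R) : sphere (rotation j k (cos u) (sin u) s).
  by rewrite /sphere/= enorm_rotation// cos2Dsin2.
have H1 (u : R) : `|u| <= `|t| ->
    `|rotor j k G (rotation j k (cos u) (sin u) s) - rotor j k G s| <= C * `|t|.
  move=> ut; have := @mvt_bound R (fun u => rotor j k G (rotation j k (cos u) (sin u) s))
    (fun u => rotor j k (rotor j k G) (rotation j k (cos u) (sin u) s)) 0 C u.
  rewrite r0 mulr0 subr0 => H; apply: (le_trans (H _ _)).
  - by move=> v _; exact: is_derive_along_rotation.
  - by move=> v _; rewrite subr0; exact: CP.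
  - by rewrite ler_wpM2l// (le_trans _ (CP _ ss)).
have := @mvt_bound R (fun u => G (rotation j k (cos u) (sin u) s))
    (fun u => rotor j k G (rotation j k (cos u) (sin u) s)) (rotor j k G s) (C * `|t|) t.
rewrite r0 => H; apply: (le_trans (H _ _)).
- by move=> v _; exact: is_derive_along_rotation.
- exact: H1.
- by rewrite -mulrA -expr2 real_normK// num_real.
Qed.

Lemma nice_rotor j k G : smooth_on punct G -> nice (rotor j k G).
Proof. by move=> GC; exact/smooth_nice/smooth_on_rotor. Qed.

Lemma nice_rotation j k (t : R) G : j != k -> smooth_on punct G ->
  nice (G \o rotation j k (cos t) (sin t)).
Proof.
move=> jk GC; apply: continuous_nice => x x0.
apply: continuous_comp; last first.
  exact: smooth_on_continuous op GC (rotation_neq0 t jk x0).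
apply: row_continuous => l.
have c i : {for x, continuous (fun y : 'rV[R]_n => y ord0 i)} := @coord_continuous _ _ _ ord0 i x.
have cM (a : R) i : {for x, continuous (fun y : 'rV[R]_n => a * y ord0 i)}.
  by apply: (continuousM _ (c i)); exact: cst_continuous.
have -> : (fun y : 'rV[R]_n => rotation j k (cos t) (sin t) y ord0 l) =
   (fun y => if l == j then cos t * y ord0 j - sin t * y ord0 k
    else if l == k then sin t * y ord0 j + cos t * y ord0 k else y ord0 l).
  by apply/funext => y; rewrite mxE.
case: (l == j); first exact: (continuousB (cM _ _) (cM _ _)).
by case: (l == k); [exact: (continuousD (cM _ _) (cM _ _))|exact: c].
Qed.

(** G and its composite with a rotation have the same mean, so the Taylor bound leaves t |smean
    (rotor j k G)| <= C' t^2; divide by t and let t tend to 0. *)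
Lemma smean_rotor j k G : smooth_on punct G -> smean (rotor j k G) = 0.
Proof.
move=> GC; have [->|jk] := eqVneq j k.
  by rewrite -[RHS](@smean0 R n); apply: eq_smean => s _; rewrite /rotor subrr.
have [C CP] := rotation_taylor GC jk.
have nG := smooth_nice GC; have nL := nice_rotor j k GC.
(* In this range sin t is nonzero, as [smean_rotation] demands. *)
have H (t : R) : 0 < t < 1 -> `|smean (rotor j k G)| <= C * smean (n := n) (fun=> 1) * t.
  move=> /andP[t0 t1].
  have st0 : sin t != 0.
    by rewrite gt_eqF// sin_gt0_pihalf// t0/= (lt_le_trans t1)// pihalf_ge1.
  have nGr := nice_rotation t jk GC.
  pose D s := G (rotation j k (cos t) (sin t) s) - G s - t * rotor j k G s.
  have ntL : nice (fun s => t * rotor j k G s) := niceZ t nL.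
  have nD : nice D by apply: niceB => //; exact: niceB.
  have DE : smean D = - (t * smean (rotor j k G)).
    rewrite /D smeanB//; last exact: niceB.
    rewrite smeanB// smeanZ//.
    rewrite [smean (fun s => G (rotation _ _ _ _ s))](@smean_rotation _ _ G)//.
      by rewrite subrr add0r.
    by rewrite cos2Dsin2.
  have : `|smean D| <= smean (fun s : 'rV[R]_n => C * t ^+ 2 * 1).
    rewrite (le_trans (norm_smean nD))//; apply: le_smean.
    - exact: nice_norm.
    - exact/niceZ/nice_cst.
    - by move=> s ss; rewrite mulr1; exact: CP.
  rewrite smeanZ; last exact: nice_cst.
  rewrite DE normrN normrM gtr0_norm// => K.
  rewrite -(ler_pM2l t0); apply: (le_trans K).
  by rewrite le_eqVlt; apply/orP; left; apply/eqP; ring.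
apply/eqP; rewrite -normr_le0; apply/ler_addgt0Pl => e e0; rewrite addr0.
set K := C * _ in H.
pose t := Num.min 2^-1 (e / (`|K| + 1)).
have K1 : 0 < `|K| + 1 by rewrite ltr_wpDl.
have t0 : 0 < t by rewrite lt_min invr_gt0 ltr0n/= divr_gt0.
have t1 : t < 1 by rewrite gt_min; apply/orP; left; rewrite invf_lt1 ?ltr1n.
have := H t; rewrite t0 t1 => /(_ isT)/le_trans; apply.
rewrite (le_trans (_ : _ <= `|K| * t))//.
  by rewrite ler_wpM2r ?ler_norm// ltW.
apply: (@le_trans _ _ ((`|K| + 1) * (e / (`|K| + 1)))).
  by apply: ler_pM => //; [exact: ltW|rewrite lerDl|rewrite ge_min lexx orbT].
by rewrite mulrCA divff ?mulr1// gt_eqF.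
Qed.

Lemma is_derive_partial G x i : smooth_on punct G -> x != 0 ->
  is_derive x (basis i) G (partial i G x).
Proof. by move=> GC x0; split => //; exact: smooth_on_derivable op GC x0. Qed.

Lemma rotorM j k G H x : smooth_on punct G -> smooth_on punct H -> x != 0 ->
  rotor j k (fun y => G y * H y) x = G x * rotor j k H x + H x * rotor j k G x.
Proof.
move=> GC HC x0.
have P i : partial i (fun y => G y * H y) x = G x * partial i H x + H x * partial i G x.
  have [_ E] := is_derive_prod (is_derive_partial i GC x0) (is_derive_partial i HC x0).
  exact: E.
by rewrite /rotor !P; move: (partial k G x) (partial k H x) (partial j G x) (partial j H x) => a b c d; ring.
Qed.

Lemma smean_by_parts j k G H : smooth_on punct G -> smooth_on punct H ->
  smean (fun s => G s * rotor j k H s) = - smean (fun s => H s * rotor j k G s).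
Proof.
move=> GC HC; apply/eqP; rewrite -addr_eq0 -smeanD; last 2 first.
- by apply: niceM; [exact: smooth_nice|exact: nice_rotor].
- by apply: niceM; [exact: smooth_nice|exact: nice_rotor].
apply/eqP; rewrite -[RHS](smean_rotor j k (smooth_onM op GC HC)).
by apply: eq_smean => s /sphere_neq0 s0; rewrite rotorM.
Qed.

End rotor.

(** * Control of a density by its values near one point *)

Section propagation.
Context {R : realType} {n : nat}.
Implicit Types (G H rho : 'rV[R]_n -> R) (x s : 'rV[R]_n).
Notation punct := (@punctured R n).
Let op : open punct := @open_punctured R n.

Lemma dot_sphere_le1 s s0 : sphere s -> sphere s0 -> -1 <= dot s s0 <= 1.
Proof.
move=> /sphereP ss /sphereP ss0.
have := dot_ge0 (s - s0); have := dot_ge0 (s + s0).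
rewrite !dotDl !dotDr !dotNl !dotNr ss ss0 (dotC s0 s) => h1 h2.
by apply/andP; split; lra.
Qed.

(** On the sphere |s - s0|^2 = 2 (1 - <s, s0>), so the caps around s0 form a basis of
    neighbourhoods. *)
Lemma near_pole (f : 'rV[R]_n -> R) s0 (e : R) : sphere s0 -> {for s0, continuous f} ->
  0 < e -> exists2 delta : R, 0 < delta < 1 &
    forall s, sphere s -> 1 - delta < dot s s0 -> `|f s0 - f s| <= e.
Proof.
move=> ss0 fc e0.
have [h /= h0 hP] := (nbhs_ballP _ _).1 (continuous_dist_near fc e0).
have hh : 0 < 1 + h ^+ 2 by rewrite ltr_pwDl// sqr_ge0.
(* Chosen so that delta < 1 and 2 delta <= h^2. *)
exists (h ^+ 2 / (2 * (1 + h ^+ 2))).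
  rewrite divr_gt0 ?mulr_gt0 ?exprn_gt0//= ltr_pdivrMr ?mulr_gt0//.
  by have := sqr_ge0 h; lra.
move=> s ss st; apply: hP; split => // a i; rewrite (ord1 a) /ball/=.
rewrite -(ltr_pXn2r (n := 2))// ?nnegrE ?ltW//.
rewrite (le_lt_trans (y := dot (s0 - s) (s0 - s)))//.
  have := coord_enorm_le (s0 - s) i.
  rewrite -(ler_pXn2r (n := 2))// ?nnegrE// ?enorm_ge0// sqr_enorm.
  by rewrite !mxE.
have /sphereP E := ss; have /sphereP E0 := ss0.
rewrite !dotDl !dotDr !dotNl !dotNr E E0 (dotC s0 s).
have : h ^+ 2 / (2 * (1 + h ^+ 2)) * 2 <= h ^+ 2.
  rewrite invfM mulrA mulrAC divfK ?pnatr_eq0// ler_pdivrMr// ler_peMr ?sqr_ge0//.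
  by rewrite lerDl sqr_ge0.
by move: st; set z := _ / _; set u := dot s s0; lra.
Qed.

Section polar_field.
Variables (s0 : 'rV[R]_n) (lam : R).

Definition polar_weight x : R := expR (lam * dot x s0).

(* The components, on the Killing fields, of the gradient of the height
   s |-> <s, s0> multiplied by the weight exp (lam <s, s0>). *)
Definition polar_field (j k : 'I_n) x : R :=
  polar_weight x * (x ord0 j * s0 ord0 k - x ord0 k * s0 ord0 j).

Lemma is_derive_polar_weight x i :
  is_derive x (basis i) polar_weight (polar_weight x * (lam * s0 ord0 i)).
Proof.
have D1 : is_derive x (basis i) (fun x => lam * dot x s0) (lam * s0 ord0 i).
  apply: is_derive_scale.
  have H l : is_derive x (basis i) (fun y : 'rV[R]_n => y ord0 l * s0 ord0 l)
      (basis (R := R) i ord0 l * s0 ord0 l).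
    apply: is_derive_eq (is_derive_prod (is_derive_coord x _ l) (is_derive_cst _ _ _)) _.
    by rewrite mulr0 add0r mulrC.
  apply: is_derive_eq (is_derive_sumr (index_enum 'I_n) H) _.
  by rewrite -/(dot _ _) dotC dot_basis.
have [D2 E2] := D1.
by have := is_derive_comp1 D2 (is_derive_expR (lam * dot x s0)); rewrite E2.
Qed.

Lemma smooth_on_polar_weight : smooth_on punct polar_weight.
Proof.
apply: (@smooth_on_comp1 _ _ punct setT (fun=> expR) (fun x => lam * dot x s0) 0%N) => //.
apply: smooth_onZ => //; apply: smooth_on_sum => // i.
by apply: smooth_onM => //; [exact: smooth_on_coord|exact: smooth_on_cst].
Qed.

Lemma smooth_on_polar_field j k : smooth_on punct (polar_field j k).
Proof.
apply: smooth_onM => //; first exact: smooth_on_polar_weight.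
by apply: smooth_onB => //; apply: smooth_onM => //;
  first [exact: smooth_on_coord|exact: smooth_on_cst].
Qed.

(** The Kronecker term makes the formula hold for j = k too, where both sides vanish, so that it can
    be summed over all pairs. *)
Lemma rotor_polar_field j k x : rotor j k (polar_field j k) x =
  polar_weight x * (lam * (x ord0 j * s0 ord0 k - x ord0 k * s0 ord0 j) ^+ 2
    - (x ord0 j * s0 ord0 j + x ord0 k * s0 ord0 k)
    + (j == k)%:R * (x ord0 j * s0 ord0 k + x ord0 k * s0 ord0 j)).
Proof.
have P i : partial i (polar_field j k) x =
    polar_weight x * ((i == j)%:R * s0 ord0 k - (i == k)%:R * s0 ord0 j) +
    (x ord0 j * s0 ord0 k - x ord0 k * s0 ord0 j) * (polar_weight x * (lam * s0 ord0 i)).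
  have dl a c : is_derive x (basis i) (fun y : 'rV[R]_n => y ord0 a * c) ((i == a)%:R * c).
    apply: is_derive_eq (is_derive_prod (is_derive_coord x _ a) (is_derive_cst _ _ _)) _.
    by rewrite mulr0 add0r mulrC !mxE eqxx/= eq_sym.
  have DB := is_deriveB (dl j (s0 ord0 k)) (dl k (s0 ord0 j)).
  have [_ E] := is_derive_prod (is_derive_polar_weight x i) DB.
  exact: E.
rewrite /rotor !P !eqxx [k == j]eq_sym; case: (j == k); rewrite ?mulr1n ?mulr0n; ring.
Qed.

(** On the sphere this is twice the divergence of exp (lam t) grad t for t = <x, s0>, since |grad
    t|^2 = 1 - t^2 and the Laplacian of t is - (n - 1) t. The factor 2 comes from the sum over
    ordered pairs. *)
Lemma sum_rotor_polar_field x : sphere s0 ->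
  \sum_j \sum_k rotor j k (polar_field j k) x =
  2 * polar_weight x * (lam * (dot x x - dot x s0 ^+ 2) - (n%:R - 1) * dot x s0).
Proof.
move=> /sphereP ss0.
have S1 : \sum_(j < n) \sum_(k < n) (x ord0 j * s0 ord0 k - x ord0 k * s0 ord0 j) ^+ 2 =
    2 * (dot x x - dot x s0 ^+ 2).
  transitivity (\sum_(j < n) (x ord0 j ^+ 2 * dot s0 s0 + s0 ord0 j ^+ 2 * dot x x
      - 2 * (x ord0 j * s0 ord0 j) * dot x s0)).
    apply: eq_bigr => j _; rewrite /dot !mulr_sumr -big_split/= -sumrB.
    by apply: eq_bigr => k _; ring.
  rewrite sumrB big_split/= -!mulr_suml -mulr_sumr ss0 mulr1.
  have sq (y : 'rV[R]_n) : \sum_(j < n) y ord0 j ^+ 2 = dot y y.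
    by apply: eq_bigr => j _; rewrite expr2.
  by rewrite !sq ss0 -/(dot x s0); ring.
have S2 : \sum_(j < n) \sum_(k < n) (x ord0 j * s0 ord0 j + x ord0 k * s0 ord0 k) =
    2 * n%:R * dot x s0.
  transitivity (\sum_(j < n) (n%:R * (x ord0 j * s0 ord0 j) + dot x s0)).
    by apply: eq_bigr => j _; rewrite big_split/= sumr_const card_ord mulr_natl.
  rewrite big_split/= -mulr_sumr -/(dot x s0) sumr_const card_ord -mulr_natl.
  by ring.
have S3 : \sum_(j < n) \sum_(k < n)
    (j == k)%:R * (x ord0 j * s0 ord0 k + x ord0 k * s0 ord0 j) = 2 * dot x s0.
  rewrite /dot mulr_sumr; apply: eq_bigr => j _.
  rewrite (bigD1 j)//= eqxx big1 ?addr0; last first.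
    by move=> k kj; rewrite eq_sym (negbTE kj) mul0r.
  by rewrite mulr1n; ring.
transitivity (polar_weight x * (lam *
   (\sum_(j < n) \sum_(k < n) (x ord0 j * s0 ord0 k - x ord0 k * s0 ord0 j) ^+ 2)
  - (\sum_(j < n) \sum_(k < n) (x ord0 j * s0 ord0 j + x ord0 k * s0 ord0 k))
  + (\sum_(j < n) \sum_(k < n)
    (j == k)%:R * (x ord0 j * s0 ord0 k + x ord0 k * s0 ord0 j)))).
  rewrite !mulr_sumr -sumrB -big_split/= mulr_sumr; apply: eq_bigr => j _.
  rewrite !mulr_sumr -sumrB -big_split/= mulr_sumr; apply: eq_bigr => k _.
  exact: rotor_polar_field.
by rewrite S1 S2 S3; ring.
Qed.

End polar_field.

(* With lam large, the divergence of the polar field is bounded below off a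
   cap around s0 on which chi is positive. *)
Lemma propagation (chi : 'rV[R]_n -> R) s0 : (1 < n)%N -> nice chi ->
  (forall s, sphere s -> 0 <= chi s) -> sphere s0 ->
  {for s0, continuous chi} -> 0 < chi s0 ->
  exists2 C : R, 0 <= C & forall rho, smooth_on punct rho ->
    (forall s, sphere s -> 0 <= rho s) ->
    smean rho <= C * (smean (fun s => chi s * rho s)
      + \sum_j \sum_k smean (fun s => `|rotor j k rho s|)).
Proof.
move=> n1 nchi chi0 ss0 cchi chis0.
have c0 : 0 < chi s0 / 2 by rewrite divr_gt0.
have [delta /andP[d0 d1] capP] := near_pole ss0 cchi c0.
(* Off the cap t <= 1 - delta. If t > 0, then lam (1 - t^2) >= n outweighs (n - 1) t; if t <= 0, the
   term - (n - 1) t helps and lam >= n - 1 is enough. *)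
pose lam : R := n%:R / delta.
have lam0 : 0 <= lam by rewrite divr_ge0// ltW.
have n2 : 2 <= n%:R :> R by rewrite (ler_nat _ 2).
pose V := polar_field s0 lam.
pose phi x := \sum_j \sum_k rotor j k (V j k) x.
pose c1 := expR (- lam).
have c1_gt0 : 0 < c1 by exact: expR_gt0.
have nphi : nice phi.
  apply: nice_sum => j; apply: nice_sum => k.
  exact/nice_rotor/smooth_on_polar_field.
have [K0 K0P] := nphi.2.
(* On the cap the divergence [phi] is only known to be at least - K0; there chi >= chi s0 / 2, so C1
   chi makes up for it. *)
pose C1 := (`|K0| + c1) / (chi s0 / 2).
have C1_ge0 : 0 <= C1 by rewrite divr_ge0// ?addr_ge0// ltW.
have wE s : sphere s -> c1 <= polar_weight s0 lam s <= expR lam.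
  move=> ss; have /andP[t1 t2] := dot_sphere_le1 ss ss0.
  rewrite !ler_expR -mulrN1 ler_wpM2l//=.
  by rewrite -[leRHS]mulr1 ler_wpM2l.
have phiP s : sphere s -> c1 <= phi s + C1 * chi s.
  move=> ss; have [st|st] := ltP (1 - delta) (dot s s0).
    have : chi s0 / 2 <= chi s.
      by have := capP _ ss st; rewrite ler_norml => /andP[_]; lra.
    move=> chis; have : `|K0| + c1 <= C1 * chi s.
      by rewrite /C1 mulrAC ler_pdivlMr// ler_wpM2l// addr_ge0// ltW.
    have := K0P _ ss; rewrite ler_norml => /andP[+ _].
    by have := ler_norm K0; lra.
  have /andP[w1 w2] := wE _ ss; have /sphereP ssE := ss.
  have /andP[t1 t2] := dot_sphere_le1 ss ss0.
  have := mulr_ge0 C1_ge0 (chi0 _ ss); set C1chi := C1 * chi s => C1chi0.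
  rewrite ler_wpDr//.
  rewrite /phi sum_rotor_polar_field// ssE.
  rewrite (le_trans w1)// -[leLHS]mulr1 -mulrA mulrCA ler_wpM2l//.
    by rewrite (le_trans _ w1)// ltW.
  set t := dot s s0 in st t1 t2 *.
  suff : 1 <= lam * (1 - t ^+ 2) - (n%:R - 1) * t by lra.
  have [t0|t0] := leP t 0.
    have h1 : 0 <= (n%:R - 1) * (- t - t ^+ 2).
      apply: mulr_ge0; first by lra.
      have : 0 <= (- t) * (1 + t) by apply: mulr_ge0; lra.
      by rewrite expr2; lra.
    have h2 : n%:R - 1 <= lam.
      by rewrite /lam ler_pdivlMr//; have := ler_wpM2l (_ : 0 <= n%:R - 1) (ltW d1); nra.
    have h3 : 0 <= (lam - (n%:R - 1)) * (1 - t ^+ 2).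
      by apply: mulr_ge0; [lra|rewrite expr2; nra].
    by nra.
  have h1 : n%:R <= lam * (1 - t ^+ 2).
    have -> : n%:R = lam * delta by rewrite /lam divfK// gt_eqF.
    by rewrite ler_wpM2l//; rewrite expr2; nra.
  have h2 : (n%:R - 1) * t <= n%:R - 1 by rewrite ler_piMr//; lra.
  by lra.
pose K := 2 * expR lam.
have VP j k s : sphere s -> `|V j k s| <= K.
  move=> ss; have /andP[w1 w2] := wE _ ss.
  rewrite /V /polar_field normrM mulrC /K ler_pM//.
    rewrite (le_trans (ler_normB _ _))// -[leRHS]/(1 + 1 : R) lerD// normrM.
      rewrite -[leRHS]mulr1 ler_pM//.
        exact: coord_sphere_le1 ss.
      exact: coord_sphere_le1 ss0.
    rewrite -[leRHS]mulr1 ler_pM//.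
      exact: coord_sphere_le1 ss.
    exact: coord_sphere_le1 ss0.
  by rewrite ger0_norm// (le_trans _ w1)// ltW.
have K_ge0 : 0 <= K by rewrite mulr_ge0// expR_ge0.
(* The bound integrates c1 rho <= rho phi + C1 chi rho: by parts, the first term costs at most K per
   rotor of rho, and the second one costs C1. *)
exists ((K + C1) / c1); first by rewrite divr_ge0 ?addr_ge0// ltW.
move=> rho rhoC rho0; have nrho := smooth_nice rhoC.
set S := \sum_j \sum_k _.
have Mchi0 : 0 <= smean (fun s => chi s * rho s).
  by apply: smean_ge0 => s ss; rewrite mulr_ge0 ?chi0 ?rho0.
have S0 : 0 <= S.
  apply: sumr_ge0 => j _; apply: sumr_ge0 => k _; apply: smean_ge0 => s _.
  exact: normr_ge0.
rewrite mulrAC ler_pdivlMr// mulrC.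
have H1 : c1 * smean rho <= smean (fun s => rho s * phi s + C1 * (chi s * rho s)).
  rewrite -smeanZ//; apply: le_smean.
  - exact: niceZ.
  - by apply: niceD; [exact: niceM|apply/niceZ/niceM].
  - move=> s ss; rewrite mulrA -[X in _ + X]mulrC -mulrDr mulrC ler_wpM2l ?rho0//.
    exact: phiP.
rewrite (le_trans H1)// smeanD; [|exact: niceM|exact/niceZ/niceM].
rewrite smeanZ; last exact: niceM.
have H2 : smean (fun s => rho s * phi s) <= K * S.
  have -> : smean (fun s => rho s * phi s) =
      \sum_j \sum_k - smean (fun s => V j k s * rotor j k rho s).
    transitivity (smean (fun s => \sum_j \sum_k rho s * rotor j k (V j k) s)).
      apply: eq_smean => s _; rewrite mulr_sumr; apply: eq_bigr => j _.
      by rewrite mulr_sumr.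
    rewrite smean_sum; last first.
      move=> j; apply: nice_sum => k; apply: niceM => //.
      exact/nice_rotor/smooth_on_polar_field.
    apply: eq_bigr => j _; rewrite smean_sum; last first.
      move=> k; apply: niceM => //.
      exact/nice_rotor/smooth_on_polar_field.
    apply: eq_bigr => k _; rewrite smean_by_parts//.
    exact: smooth_on_polar_field.
  rewrite /S mulr_sumr; apply: ler_sum => j _; rewrite mulr_sumr; apply: ler_sum => k _.
  have nL := nice_rotor j k rhoC.
  have nV : nice (V j k) by exact/smooth_nice/smooth_on_polar_field.
  rewrite (le_trans (ler_norm _))// normrN (le_trans (norm_smean (niceM nV nL)))//.
  rewrite -smeanZ; last exact: nice_norm.
  apply: le_smean; [exact/nice_norm/niceM|exact/niceZ/nice_norm|].
  by move=> s ss; rewrite normrM ler_wpM2r// VP.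
rewrite (le_trans (lerD H2 (lexx _)))//.
rewrite mulrDl !mulrDr.
have : 0 <= K * smean (fun s => chi s * rho s) by rewrite mulr_ge0.
have : 0 <= C1 * S by rewrite mulr_ge0.
by lra.
Qed.

End propagation.

Lemma le_term_sum2 (R : realType) n (f : 'I_n -> 'I_n -> R) a b :
  (forall a b, 0 <= f a b) -> f a b <= \sum_a \sum_b f a b.
Proof.
move=> f0; rewrite (bigD1 a)//= (bigD1 b)//= -addrA lerDl addr_ge0//.
  by apply: sumr_ge0 => c _.
by apply: sumr_ge0 => c _; apply: sumr_ge0 => c' _.
Qed.

(** * Covariant derivatives, current and curvature *)

Section curvature.
Context {R : realType} {n : nat}.
Notation punct := (@punctured R n).
Let op : open punct := @open_punctured R n.
Variable om : 'I_n -> 'rV[R]_n -> R.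
Hypothesis omC : forall i, smooth_on punct (om i).

Definition curv i j x : R := partial i (om j) x - partial j (om i) x.

(* The components of the exterior product of the position covector with the
   2-form [curv]; on the sphere they only see its tangential part. *)
Definition tcurv k i j (x : 'rV[R]_n) : R :=
  x ord0 k * curv i j x + x ord0 i * curv j k x + x ord0 j * curv k i x.

Lemma smooth_on_tcurv k i j : smooth_on punct (tcurv k i j).
Proof.
have cC a b : smooth_on punct (curv a b).
  by apply: smooth_onB => //; exact: smooth_on_partial.
by apply: smooth_onD => //; [apply: smooth_onD => //|];
  apply: smooth_onM => //; exact: smooth_on_coord.
Qed.

(* For u = v + i w, [cov_re] and [cov_im] are the parts of (d - i om) u. *)
Section covariant_derivative.
Variables v w : 'rV[R]_n -> R.
Hypotheses (vC : smooth_on punct v) (wC : smooth_on punct w).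

Definition cov_re i x : R := partial i v x + om i x * w x.
Definition cov_im i x : R := partial i w x - om i x * v x.
Definition sqmod x : R := v x ^+ 2 + w x ^+ 2.
Definition cov_energy x : R := \sum_i (cov_re i x ^+ 2 + cov_im i x ^+ 2).
(** The imaginary part of conj(u) (d - i om) u, the probability current of quantum mechanics; the
    real part of the same product is half the differential of |u|^2. *)
Definition current i x : R := v x * cov_im i x - w x * cov_re i x.

Lemma smooth_on_cov_re i : smooth_on punct (cov_re i).
Proof.
by apply: smooth_onD => //; [exact: smooth_on_partial|exact: smooth_onM].
Qed.

Lemma smooth_on_cov_im i : smooth_on punct (cov_im i).
Proof.
by apply: smooth_onB => //; [exact: smooth_on_partial|exact: smooth_onM].
Qed.

Lemma smooth_on_sqmod : smooth_on punct sqmod.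
Proof.
by apply: smooth_onD => //; under eq_fun do rewrite expr2; exact: smooth_onM.
Qed.

Lemma smooth_on_cov_energy : smooth_on punct cov_energy.
Proof.
have pC := smooth_on_cov_re; have qC := smooth_on_cov_im.
apply: smooth_on_sum => // i; apply: smooth_onD => //;
  under eq_fun do rewrite expr2.
  exact: smooth_onM (pC i) (pC i).
exact: smooth_onM (qC i) (qC i).
Qed.

Lemma smooth_on_current i : smooth_on punct (current i).
Proof.
apply: smooth_onB => //.
  exact: smooth_onM vC (smooth_on_cov_im i).
exact: smooth_onM wC (smooth_on_cov_re i).
Qed.

(** The terms in om cancel, so d|u|^2 is controlled by u and its covariant derivative, whatever the
    size of the potential. *)
Lemma partial_sqmod i x : x != 0 ->
  partial i sqmod x = 2 * (v x * cov_re i x + w x * cov_im i x).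
Proof.
move=> x0; have dv := is_derive_partial i vC x0; have dw := is_derive_partial i wC x0.
have [_ E] := is_deriveD (is_derive_exp 2 dv) (is_derive_exp 2 dw).
transitivity (2%:R * v x ^+ 1 * partial i v x + 2%:R * w x ^+ 1 * partial i w x).
  exact: E.
rewrite /cov_re /cov_im; move: (partial i v x) (partial i w x) => a b.
by rewrite !expr1; ring.
Qed.

Lemma partial_current i j x : x != 0 -> partial i (current j) x =
  v x * (partial i (partial j w) x - (om j x * partial i v x + v x * partial i (om j) x))
  + cov_im j x * partial i v x
  - (w x * (partial i (partial j v) x + (om j x * partial i w x + w x * partial i (om j) x))
  + cov_re j x * partial i w x).
Proof.
move=> x0; have dv := is_derive_partial i vC x0; have dw := is_derive_partial i wC x0.
have dom := is_derive_partial i (omC j) x0.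
have dvj := is_derive_partial i (smooth_on_partial j vC) x0.
have dwj := is_derive_partial i (smooth_on_partial j wC) x0.
have dq := is_deriveB dwj (is_derive_prod dom dv).
have dp := is_deriveD dvj (is_derive_prod dom dw).
have [_ E] := is_deriveB (is_derive_prod dv dq) (is_derive_prod dw dp).
exact: E.
Qed.

(** In dJ the second derivatives of u cancel by symmetry; besides the quadratic term there remains
    the commutator of the covariant derivatives, that is, the curvature times |u|^2. *)
Lemma curv_sqmod i j x : x != 0 -> curv i j x * sqmod x =
  2 * (cov_re i x * cov_im j x - cov_re j x * cov_im i x)
  - (partial i (current j) x - partial j (current i) x).
Proof.
move=> x0; rewrite !partial_current// (partialC i j op vC x0) (partialC i j op wC x0).
rewrite /curv /sqmod /cov_re /cov_im.
move: (partial j (partial i w) x) (partial j (partial i v) x) => a b.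
move: (partial i v x) (partial j v x) (partial i w x) (partial j w x) => c d e f.
move: (partial i (om j) x) (partial j (om i) x) => g h.
by ring.
Qed.

Definition wedge_cov k i j (x : 'rV[R]_n) : R :=
  x ord0 k * (cov_re i x * cov_im j x - cov_re j x * cov_im i x) +
  x ord0 i * (cov_re j x * cov_im k x - cov_re k x * cov_im j x) +
  x ord0 j * (cov_re k x * cov_im i x - cov_re i x * cov_im k x).

(** Exterior multiplication by x turns dJ into derivatives along the Killing fields, which are those
    that [smean_by_parts] can move. *)
Lemma tcurv_sqmod k i j x : x != 0 -> tcurv k i j x * sqmod x =
  2 * wedge_cov k i j x
  - (rotor k i (current j) x + rotor i j (current k) x + rotor j k (current i) x).
Proof.
move=> x0; rewrite /tcurv !mulrDl -3!mulrA.
rewrite (curv_sqmod i j x0) (curv_sqmod j k x0) (curv_sqmod k i x0) /wedge_cov /rotor.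
move: (cov_re i x) (cov_re j x) (cov_re k x) => p1 p2 p3.
move: (cov_im i x) (cov_im j x) (cov_im k x) => q1 q2 q3.
move: (partial i (current j) x) (partial j (current i) x) => a b.
move: (partial k (current j) x) (partial j (current k) x) => c d.
move: (partial k (current i) x) (partial i (current k) x) => e f.
by ring.
Qed.

Lemma cov_sq_le i j x : cov_re i x ^+ 2 + cov_im j x ^+ 2 <= cov_energy x.
Proof.
rewrite /cov_energy big_split/= lerD//; [rewrite (bigD1 i)//=|rewrite (bigD1 j)//=];
  by rewrite lerDl sumr_ge0// => l _; exact: sqr_ge0.
Qed.

Lemma cov_energy_ge0 x : 0 <= cov_energy x.
Proof. by apply: sumr_ge0 => i _; rewrite addr_ge0 ?sqr_ge0. Qed.

Lemma sqmod_ge0 x : 0 <= sqmod x.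
Proof. by rewrite addr_ge0 ?sqr_ge0. Qed.

(** The weight e balances a factor of size 1 against a covariant derivative of size e. *)
Lemma amgm (a b e : R) : 0 < e -> `|a * b| <= (e * a ^+ 2 + e^-1 * b ^+ 2) / 2.
Proof.
move=> e0; rewrite normrM -(real_normK (num_real a)) -(real_normK (num_real b)).
move: `|a| `|b| => c d.
suff : 0 <= e^-1 * (e * c - d) ^+ 2.
  have -> : e^-1 * (e * c - d) ^+ 2 = e * c ^+ 2 - 2 * (c * d) + e^-1 * d ^+ 2.
    by field; rewrite gt_eqF.
  lra.
by rewrite mulr_ge0 ?sqr_ge0// invr_ge0 ltW.
Qed.

Lemma cov_prod_le i j x : `|cov_re i x * cov_im j x| <= cov_energy x / 2.
Proof.
rewrite (le_trans (amgm _ _ ltr01))// invr1 !mul1r ler_pM2r ?invr_gt0//.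
exact: cov_sq_le.
Qed.

Lemma wedge_cov_le k i j s : sphere s -> `|wedge_cov k i j s| <= 3 * cov_energy s.
Proof.
move=> ss; have H c a b : `|s ord0 c * (cov_re a s * cov_im b s - cov_re b s * cov_im a s)|
    <= cov_energy s.
  rewrite normrM -[leRHS]mul1r ler_pM//.
    exact: coord_sphere_le1 ss.
  rewrite (le_trans (ler_normB _ _))//.
  by have := cov_prod_le a b s; have := cov_prod_le b a s; lra.
rewrite (le_trans (ler_normD _ _))// (le_trans (lerD (ler_normD _ _) (lexx _)))//.
by have := H k i j; have := H i j k; have := H j k i; lra.
Qed.

Lemma current_le i x (e : R) : 0 < e ->
  `|current i x| <= (e * sqmod x + e^-1 * cov_energy x) / 2.
Proof.
move=> e0; rewrite (le_trans (ler_normB _ _))//.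
have := amgm (v x) (cov_im i x) e0; have := amgm (w x) (cov_re i x) e0.
have : e^-1 * (cov_re i x ^+ 2 + cov_im i x ^+ 2) <= e^-1 * cov_energy x.
  by rewrite ler_wpM2l ?cov_sq_le// invr_ge0 ltW.
by rewrite /sqmod; lra.
Qed.

Lemma rotor_sqmod_le j k s (e : R) : 0 < e -> sphere s ->
  `|rotor j k sqmod s| <= 2 * (e * sqmod s + e^-1 * cov_energy s).
Proof.
move=> e0 ss; have H a b : `|s ord0 a * partial b sqmod s| <=
    e * sqmod s + e^-1 * cov_energy s.
  rewrite normrM -[leRHS]mul1r ler_pM//.
    exact: coord_sphere_le1 ss.
  rewrite partial_sqmod ?sphere_neq0// normrM gtr0_norm// -ler_pdivlMl//.
  rewrite (le_trans (ler_normD _ _))//.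
  have := amgm (v s) (cov_re b s) e0; have := amgm (w s) (cov_im b s) e0.
  have : e^-1 * (cov_re b s ^+ 2 + cov_im b s ^+ 2) <= e^-1 * cov_energy s.
    by rewrite ler_wpM2l ?cov_sq_le// invr_ge0 ltW.
  by rewrite /sqmod; lra.
rewrite (le_trans (ler_normB _ _))// (le_trans (lerD (H j k) (H k j)))//.
by rewrite mulrDl mul1r.
Qed.

Lemma nice_wedge_cov k i j : nice (wedge_cov k i j).
Proof.
have nx c : nice (fun s : 'rV[R]_n => s ord0 c) by apply/smooth_nice/smooth_on_coord.
have np a := smooth_nice (smooth_on_cov_re a).
have nq a := smooth_nice (smooth_on_cov_im a).
by apply: niceD; [apply: niceD|]; apply: niceM => //; apply: niceB; exact: niceM.
Qed.

Lemma smean_tcurv_sqmod k i j : smean (fun s => tcurv k i j s ^+ 2 * sqmod s) =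
  2 * smean (fun s => tcurv k i j s * wedge_cov k i j s)
  + (smean (fun s => current j s * rotor k i (tcurv k i j) s)
   + smean (fun s => current k s * rotor i j (tcurv k i j) s)
   + smean (fun s => current i s * rotor j k (tcurv k i j) s)).
Proof.
set h := tcurv k i j; have hC : smooth_on punct h by exact: smooth_on_tcurv.
have cC := smooth_on_current.
have nh := smooth_nice hC.
have nr a b c : nice (fun s => h s * rotor a b (current c) s).
  by apply: niceM => //; exact: nice_rotor.
have nw : nice (fun s => h s * wedge_cov k i j s).
  exact: niceM nh (nice_wedge_cov _ _ _).
transitivity (smean (fun s => 2 * (h s * wedge_cov k i j s)
  - (h s * rotor k i (current j) s + h s * rotor i j (current k) s
   + h s * rotor j k (current i) s))).
  apply: eq_smean => s /sphere_neq0 s0; rewrite expr2 -mulrA /h tcurv_sqmod//.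
  by move: (tcurv _ _ _ _) (wedge_cov _ _ _ _) (rotor _ _ _ _) (rotor _ _ _ _) (rotor _ _ _ _)
    => a b c d e; ring.
rewrite smeanB; [|exact: niceZ|by apply: niceD => //; exact: niceD].
rewrite smeanZ// smeanD//; last exact: niceD.
by rewrite smeanD// !(smean_by_parts _ _ hC (cC _)) -!opprD opprK.
Qed.

Section small_energy.
Variable e : R.
Hypotheses (e0 : 0 < e) (e1 : e <= 1)
  (small : smean cov_energy <= e ^+ 2 * smean sqmod).

Let nr : nice sqmod := smooth_nice smooth_on_sqmod.
Let nE : nice cov_energy := smooth_nice smooth_on_cov_energy.

Let nice_amgm : nice (fun s => e * sqmod s + e^-1 * cov_energy s).
Proof. by apply: niceD; exact: niceZ. Qed.

(** The square in [small] offsets [e^-1], so each of the two terms is at most [e * smean sqmod]. *)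
Let smean_amgm : smean (fun s => e * sqmod s + e^-1 * cov_energy s)
  <= 2 * (e * smean sqmod).
Proof.
rewrite smeanD; [|exact: niceZ|exact: niceZ]; rewrite !smeanZ//.
have : e^-1 * smean cov_energy <= e * smean sqmod.
  by rewrite ler_pdivrMl// mulrA -expr2.
by move: (_ * smean _) (_ * smean _) => a b; lra.
Qed.

Lemma smean_rotor_sqmod_le :
  \sum_a \sum_b smean (fun s => `|rotor a b sqmod s|)
    <= 4 * n%:R ^+ 2 * (e * smean sqmod).
Proof.
have G (t : R) : 4 * n%:R ^+ 2 * t = \sum_(a < n) \sum_(b < n) 4 * t.
  by rewrite !sumr_const !card_ord -mulrnA -[RHS]mulr_natl natrM; ring.
rewrite (G (e * smean sqmod)).
apply: ler_sum => a _; apply: ler_sum => b _.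
apply: (@le_trans _ _ (smean (fun s => 2 * (e * sqmod s + e^-1 * cov_energy s)))).
  apply: le_smean; [|exact: niceZ|].
    exact/nice_norm/nice_rotor/smooth_on_sqmod.
  by move=> s ss; exact: rotor_sqmod_le.
have A (u t : R) : u <= 2 * t -> 2 * u <= 4 * t by lra.
by rewrite smeanZ//; exact: A smean_amgm.
Qed.

(** The wedge term is quadratic in the covariant derivative, hence of order e^2 <= e. Each of the
    three current terms is of order e, as its derivative now falls on the curvature, bounded by H.
    The constant is 9 = 2 x 3 + 3 x 1. *)
Lemma smean_tcurv_sqmod_le k i j (H : R) :
  (forall s, sphere s -> `|tcurv k i j s| <= H) ->
  (forall a b s, sphere s -> `|rotor a b (tcurv k i j) s| <= H) ->
  smean (fun s => tcurv k i j s ^+ 2 * sqmod s) <= 9 * H * (e * smean sqmod).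
Proof.
rewrite smean_tcurv_sqmod => hP rP.
have hC := smooth_on_tcurv k i j; have nh := smooth_nice hC.
move: (tcurv k i j) hC nh hP rP => h hC nh hP rP.
have M0 : 0 <= smean sqmod by apply: smean_ge0 => s _; exact: sqmod_ge0.
(* A negative H is possible only if the sphere is empty, and then all means vanish. *)
have [H0|nS] := pselect (0 <= H); last first.
  have S0 (s : 'rV[R]_n) : ~ sphere s.
    by move=> ss; apply: nS; exact: le_trans (normr_ge0 _) (hP _ ss).
  have Z (f : 'rV[R]_n -> R) : smean f = 0.
    by rewrite -(@smean0 R n); apply: eq_smean => s /S0.
  have A (a b c d m : R) : a = 0 -> b = 0 -> c = 0 -> d = 0 -> m = 0 ->
      2 * a + (b + c + d) <= 9 * H * (e * m).
    by move=> -> -> -> -> ->; rewrite !(mulr0, addr0).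
  exact: A (Z _) (Z _) (Z _) (Z _) (Z _).
have T1 : smean (fun s => h s * wedge_cov k i j s) <= 3 * H * (e * smean sqmod).
  apply: (@le_trans _ _ (smean (fun s => 3 * H * cov_energy s))).
    apply: le_smean; [exact: niceM nh (nice_wedge_cov _ _ _)|exact: niceZ|move=> s ss].
    rewrite (le_trans (ler_norm _))// normrM (mulrC 3) -mulrA ler_pM// ?hP//.
    exact: wedge_cov_le.
  rewrite smeanZ// ler_wpM2l ?mulr_ge0// (le_trans small)// ler_wpM2r//.
  by rewrite expr2 ler_piMl// ltW.
have T2 a b c : smean (fun s => current c s * rotor a b h s) <= H * (e * smean sqmod).
  have nc := smooth_nice (smooth_on_current c).
  apply: (@le_trans _ _ (smean (fun s =>
      H / 2 * (e * sqmod s + e^-1 * cov_energy s)))).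
    apply: le_smean; [by apply: niceM => //; exact: nice_rotor|exact: niceZ|move=> s ss].
    rewrite (le_trans (ler_norm _))// normrM mulrC -mulrA (mulrC 2^-1) ler_pM//.
      exact: rP.
    exact: current_le.
  have A (u t : R) : H * u <= H * (2 * t) -> H / 2 * u <= H * t by lra.
  by rewrite smeanZ//; exact: A (ler_wpM2l H0 smean_amgm).
have A (a b c d t : R) : a <= 3 * H * t -> b <= H * t -> c <= H * t -> d <= H * t ->
    2 * a + (b + c + d) <= 9 * H * t by lra.
exact: A T1 (T2 _ _ _) (T2 _ _ _) (T2 _ _ _).
Qed.

End small_energy.

End covariant_derivative.

Hypothesis n1 : (1 < n)%N.

Lemma small_energy_tcurv0 :
  (forall e : R, 0 < e <= 1 -> exists v w, [/\ smooth_on punct v, smooth_on punct w,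
     0 < smean (sqmod v w) & smean (cov_energy v w) <= e ^+ 2 * smean (sqmod v w)]) ->
  forall k i j s, sphere s -> tcurv k i j s = 0.
Proof.
move=> small k i j s0 ss0; apply/eqP/negPn/negP => h0.
set h := tcurv k i j in h0; have hC : smooth_on punct h by exact: smooth_on_tcurv.
have nh := smooth_nice hC.
pose chi s := h s ^+ 2.
have chiC : smooth_on punct chi.
  by rewrite /chi; under eq_fun do rewrite expr2; exact: smooth_onM.
have chis0 : 0 < chi s0 by rewrite exprn_even_gt0.
have [C C0 CP] := @propagation R n chi s0 n1 (smooth_nice chiC)
  (fun s _ => sqr_ge0 _) ss0 (smooth_on_continuous op chiC (sphere_neq0 ss0))
  chis0.
have [H H0 [hP rP]] : exists2 H : R, 0 <= H & (forall s, sphere s -> `|h s| <= H) /\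
    forall a b s, sphere s -> `|rotor a b h s| <= H.
  have [H1 H1P] := nh.2.
  have [H2 H2P] : exists C, forall s : 'rV[R]_n, sphere s ->
      `|\sum_a \sum_b `|rotor a b h s| | <= C.
    suff [_ //] : nice (fun s => \sum_a \sum_b `|rotor a b h s|).
    by apply: nice_sum => a; apply: nice_sum => b; exact/nice_norm/nice_rotor.
  exists (`|H1| + `|H2|); first by rewrite addr_ge0.
  split=> [s ss|a b s ss].
    by rewrite (le_trans (H1P _ ss))// (le_trans (ler_norm _))// lerDl.
  rewrite (le_trans _ (_ : H2 <= _))//; last first.
    by rewrite (le_trans (ler_norm _))// lerDr.
  rewrite (le_trans _ (H2P s ss))// (le_trans _ (ler_norm _))//.
  exact: (@le_term_sum2 _ _ (fun a b => `|rotor a b h s|)).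
pose D : R := C * (9 * H + 4 * n%:R ^+ 2).
have D0 : 0 <= D.
  by rewrite mulr_ge0// addr_ge0// mulr_ge0// exprn_ge0.
(* With M the mean of |u|^2, propagation gives M <= D e M; this e is at most 1 and makes D e < 1,
   which contradicts M > 0. *)
pose e : R := (1 + D)^-1 / 2.
have De : 0 < 1 + D by rewrite ltr_pwDl.
have e0 : 0 < e by rewrite divr_gt0// invr_gt0.
have e1 : e <= 1.
  rewrite /e ler_pdivrMr// mul1r (le_trans (_ : _ <= 1))// ?ler1n//.
  by rewrite invf_le1// lerDl.
have [] := small e; first by rewrite e0.
move=> v [w [vC wC M0 ME]].
have B1 := smean_tcurv_sqmod_le vC wC e0 e1 ME hP rP.
have B2 := smean_rotor_sqmod_le vC wC e0 ME.
have := CP _ (smooth_on_sqmod vC wC) (fun s _ => sqmod_ge0 v w s).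
rewrite leNgt => /negP; apply.
rewrite (le_lt_trans (ler_wpM2l C0 (lerD B1 B2)))//.
rewrite -mulrDl mulrA -/D mulrA -[ltRHS]mul1r ltr_pM2r// /e mulrA ltr_pdivrMr// mul1r.
rewrite (@lt_trans _ _ 1)// ?ltr1n//.
by rewrite ltr_pdivrMr// mul1r ltrDr.
Qed.

End curvature.

(** * Charts and Hodge duals *)

Lemma sum_bilinear (R : comPzRingType) m n (b : 'I_n -> 'I_n -> R) (P : 'I_m -> 'I_n -> R)
    (c e : 'I_m -> R) :
  \sum_i \sum_j b i j * (\sum_k c k * P k i) * (\sum_l e l * P l j) =
  \sum_k \sum_l c k * e l * \sum_i \sum_j b i j * P k i * P l j.
Proof.
under [RHS]eq_bigr do under eq_bigr do rewrite mulr_sumr.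
under [RHS]eq_bigr do rewrite exchange_big.
rewrite [RHS]exchange_big; apply: eq_bigr => i _.
under [RHS]eq_bigr do under eq_bigr do rewrite mulr_sumr.
under [RHS]eq_bigr do rewrite exchange_big.
rewrite [RHS]exchange_big; apply: eq_bigr => j _.
rewrite -mulrA big_distrlr/= mulr_sumr; apply: eq_bigr => k _.
by rewrite mulr_sumr; apply: eq_bigr => l _; ring.
Qed.

Section charts.
Context {R : realType}.

Section reflection.
Context {d : nat}.
Implicit Types u x y : 'rV[R]_d.

(* It is the identity if u = 0, because 0^-1 = 0. *)
Definition reflection u x : 'rV[R]_d := x - (2 * dot x u / dot u u) *: u.

Lemma reflection_affine u (h : R) x y :
  reflection u (h *: x + y) = h *: reflection u x + reflection u y.
Proof.
rewrite /reflection; apply/rowP => i; rewrite dotDl dotZl !mxE.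
by move: (dot u u)^-1 => c; ring.
Qed.

Lemma reflectionZ u (h : R) x : reflection u (h *: x) = h *: reflection u x.
Proof.
by rewrite /reflection; apply/rowP => i; rewrite dotZl !mxE; move: (dot u u)^-1 => c; ring.
Qed.

Lemma dot_reflection u x y : dot (reflection u x) (reflection u y) = dot x y.
Proof.
rewrite /reflection; have [->|u0] := eqVneq u 0.
  by rewrite !scaler0 !subr0.
rewrite !dotDl !dotDr !dotNl !dotNr !dotZl !dotZr (dotC u y).
by field; rewrite dot_eq0.
Qed.

Lemma reflectionK u : involutive (reflection u).
Proof.
move=> x; rewrite /reflection; have [->|u0] := eqVneq u 0.
  by rewrite !scaler0 !subr0.
rewrite dotDl dotNl dotZl; apply/rowP => i; rewrite !mxE.
by field; rewrite dot_eq0.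
Qed.

(** In [exists_chart] this carries the pole to an arbitrary point of the sphere by an explicit
    isometry. *)
Lemma reflection_swap x y : dot x x = dot y y -> reflection (x - y) x = y.
Proof.
move=> xy; rewrite /reflection; have [/eqP|u0] := eqVneq (x - y) 0.
  by rewrite subr_eq0 => /eqP ->; rewrite subrr scaler0 subr0.
have E : dot (x - y) (x - y) = 2 * dot x (x - y).
  by rewrite !dotDl !dotDr !dotNl !dotNr -xy (dotC y x); ring.
by rewrite -E divff ?dot_eq0// scale1r opprB addrC subrK.
Qed.

Lemma smooth_on_reflection u m (U : set 'rV[R]_m) (F : 'rV[R]_m -> 'rV[R]_d) : open U ->
  smooth_map_on U F -> smooth_map_on U (fun q => reflection u (F q)).
Proof.
move=> oU FC l; have -> : (fun q => reflection u (F q) ord0 l) =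
    (fun q => F q ord0 l - (2 * u ord0 l / dot u u) * \sum_i F q ord0 i * u ord0 i).
  by apply/funext => q; rewrite !mxE -/(dot _ _); move: (dot u u)^-1 => c; ring.
apply: smooth_onB => //; apply: smooth_onZ => //; apply: smooth_on_sum => // i.
by apply: smooth_onM => //; exact: smooth_on_cst.
Qed.

End reflection.

Section central_projection.
Context {m : nat}.
Notation pole := (basis ord_max : 'rV[R]_m.+1).
Variables (s0 : 'rV[R]_m.+1) (H : 'rV[R]_m.+1 -> 'rV[R]_m.+1).
Hypotheses (ss0 : sphere s0) (HK : involutive H)
  (HD : forall (h : R) x y, H (h *: x + y) = h *: H x + H y)
  (HZ : forall (h : R) x, H (h *: x) = h *: H x)
  (dotH : forall x y, dot (H x) (H y) = dot x y)
  (smooth_H : smooth_map_on setT H) (Hpole : H pole = s0).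

Let enormH x : enorm (H x) = enorm x.
Proof. by rewrite /enorm dotH. Qed.

Let radialH x : radial (H x) = H (radial x).
Proof. by rewrite /radial enormH HZ. Qed.

(* The central projection of the tangent hyperplane at s0 onto the sphere. *)
Definition central_chart (q : 'rV[R]_m) : 'rV[R]_m.+1 := radial (H (spherical_point q 1)).

(** The inverse divides by the coordinate along the pole. The reciprocal is written as [inorm] of a
    multiple of the pole, to inherit the smoothness of [inorm]; the two agree where that coordinate
    is positive. *)
Let central_inv (x : 'rV[R]_m.+1) : 'rV[R]_m :=
  \row_k (inorm (H x ord0 ord_max *: pole) * H x ord0 (lift ord_max k)).

Let pointE_max (q : 'rV[R]_m) (t : R) : spherical_point q t ord0 ord_max = t.
Proof. by rewrite mxE unlift_none. Qed.

Let pointE_lift (q : 'rV[R]_m) (t : R) j : spherical_point q t ord0 (lift ord_max j) = q ord0 j.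
Proof. by rewrite mxE liftK. Qed.

Let point_neq0 (q : 'rV[R]_m) : spherical_point q 1 != 0.
Proof.
apply/eqP => /rowP /(_ ord_max); rewrite pointE_max mxE => /eqP.
by rewrite oner_eq0.
Qed.

Let rowP_max (x y : 'rV[R]_m.+1) : x ord0 ord_max = y ord0 ord_max ->
  (forall j, x ord0 (lift ord_max j) = y ord0 (lift ord_max j)) -> x = y.
Proof.
by move=> xy1 xy2; apply/rowP => i; case: (unliftP ord_max i) => [j|] ->.
Qed.

Let H_neq0 x : x != 0 -> H x != 0.
Proof. by rewrite -!enorm_gt0 enormH. Qed.

Let smooth_point : smooth_map_on setT (fun q : 'rV[R]_m => spherical_point q (1 : R)).
Proof.
move=> l; case: (unliftP ord_max l) => [j|] ->.
  by under eq_fun do rewrite pointE_lift; exact/smooth_on_coord/openT.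
by under eq_fun do rewrite pointE_max; exact/smooth_on_cst/openT.
Qed.

Let W : set 'rV[R]_m.+1 := [set x | 0 < H x ord0 ord_max].

Let open_W : open W.
Proof.
apply: (@open_comp _ _ (fun x => H x ord0 ord_max) [set t | 0 < t]); last exact: open_gt.
by move=> x _; exact: smooth_on_continuous openT (smooth_H ord_max) _.
Qed.

Let enorm_pole (t : R) : 0 < t -> enorm (t *: pole) = t.
Proof.
by move=> t0; rewrite enormZ gtr0_norm// /enorm dot_basis mxE !eqxx sqrtr1 mulr1.
Qed.

Let H_central_chart q : H (central_chart q) = inorm (spherical_point q 1) *: spherical_point q 1.
Proof. by rewrite /central_chart radialH HK. Qed.

Let inorm_gt0 (x : 'rV[R]_m.+1) : x != 0 -> 0 < inorm x.
Proof. by move=> x0; rewrite invr_gt0 enorm_gt0. Qed.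

Let central_invE x : W x -> central_inv x = (H x ord0 ord_max)^-1 *: (\row_k H x ord0 (lift ord_max k)).
Proof. by move=> Wx; apply/rowP => k; rewrite !mxE /inorm enorm_pole. Qed.

Lemma central_chart_coordinates : sphere_coordinates setT central_chart.
Proof.
split; first exact: openT.
  move=> l; apply: (@smooth_on_comp _ _ _ setT (@punctured R m.+1) _ (fun x => radial x ord0 l)).
  - exact: openT.
  - exact: open_punctured.
  - by move=> k; apply: (smooth_on_comp openT openT smooth_point (smooth_H k)).
  - exact: smooth_map_on_radial.
  - by move=> q _; exact/H_neq0/point_neq0.
exists W, central_inv; split.
- exact: open_W.
- have HW l := @smooth_on_sub _ _ setT W _ (@subsetT _ W) (smooth_H l).
  move=> k; under eq_fun do rewrite mxE.
  apply: (smooth_onM open_W _ (HW _)).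
  apply: (@smooth_on_comp _ _ _ W (@punctured R m.+1) (fun x => H x ord0 ord_max *: pole) inorm) => //.
  - exact: open_punctured.
  - move=> l; under eq_fun do rewrite mxE.
    by apply: smooth_onM => //; exact: smooth_on_cst.
  - exact: smooth_on_inorm.
  - by move=> x Wx; rewrite /punctured/= -enorm_gt0 enorm_pole.
- apply/seteqP; split => [x [q _ <-]|x [Wx sx]].
    split; last exact/radial_sphere/H_neq0/point_neq0.
    by rewrite /W/= H_central_chart mxE pointE_max mulr1; exact/inorm_gt0/point_neq0.
  exists (central_inv x) => //; rewrite /central_chart.
  have -> : spherical_point (central_inv x) 1 = (H x ord0 ord_max)^-1 *: H x.
    apply: rowP_max => [|j]; first by rewrite pointE_max mxE mulVf// gt_eqF.
    by rewrite pointE_lift central_invE// !mxE.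
  by rewrite HZ HK radialZ ?invr_gt0// radial_id.
- move=> q _; rewrite central_invE; last first.
    by rewrite /W/= H_central_chart mxE pointE_max mulr1; exact/inorm_gt0/point_neq0.
  rewrite H_central_chart; apply/rowP => k.
  by rewrite !mxE liftK unlift_none mulr1 mulrA mulVf ?mul1r// gt_eqF// inorm_gt0.
Qed.

Let point0 : spherical_point 0 1 = pole.
Proof.
apply: rowP_max => [|j]; first by rewrite pointE_max mxE !eqxx.
by rewrite pointE_lift !mxE eqxx/= eq_sym (negbTE (neq_lift _ _)).
Qed.

Lemma central_chart0 : central_chart 0 = s0.
Proof. by rewrite /central_chart point0 Hpole radial_id. Qed.

Let lift_tangent j : tangent s0 (H (basis (lift ord_max j))).
Proof.
rewrite /tangent/= -Hpole dotH dot_basis mxE eqxx/=.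
by rewrite eq_sym (negbTE (neq_lift _ _)).
Qed.

Let partial_central_chart j :
  partial_map j central_chart 0 = H (basis (lift ord_max j)).
Proof.
apply/rowP => l; rewrite mxE /partial.
have A (h : R) : H (spherical_point (h *: basis j + 0) 1) =
    h *: H (basis (lift ord_max j)) + H (spherical_point 0 1).
  rewrite -HD; congr H; apply: rowP_max => [|k].
    by rewrite !mxE unlift_none eqxx/= (negbTE (neq_lift _ _)) mulr0 add0r.
  by rewrite !mxE liftK !mxE eqxx/= (inj_eq lift_inj) addr0.
have D := is_derive_radial (H (basis (lift ord_max j))) l (sphere_neq0 ss0).
rewrite -Hpole -point0 in D.
have [_ E] := @is_derive_affine _ _ _ _ (fun q => H (spherical_point q 1)) _ _ _ _ _ A D.
rewrite E point0 Hpole (lift_tangent j).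
have -> : inorm s0 = 1 by rewrite /inorm ss0 invr1.
by rewrite mulr0 mul0r subr0 mul1r.
Qed.

Lemma central_chart_gram : pullback_metric central_chart 0 = 1%:M.
Proof.
apply/matrixP => j k; rewrite !mxE !partial_central_chart dotH dot_basis mxE eqxx/=.
by rewrite (inj_eq lift_inj) eq_sym.
Qed.

Lemma central_chart_span X : tangent s0 X ->
  exists c : 'I_m -> R, X = \sum_j c j *: partial_map j central_chart 0.
Proof.
move=> tX; exists (fun j => H X ord0 (lift ord_max j)).
under eq_bigr do rewrite partial_central_chart.
apply: (can_inj HK).
have HS (c : 'I_m -> R) (v : 'I_m -> 'rV[R]_m.+1) (t : seq 'I_m) :
    H (\sum_(j <- t) c j *: v j) = \sum_(j <- t) c j *: H (v j).
  elim: t => [|k t ih]; last by rewrite !big_cons HD ih.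
  by rewrite !big_nil -[X in H X](scale0r 0) HZ scale0r.
rewrite HS; under eq_bigr do rewrite HK.
apply: rowP_max => [|k].
  rewrite summxE big1 => [|j _].
    by rewrite -dot_basis -(HK pole) dotH Hpole dotC.
  by rewrite !mxE eqxx/= (negbTE (neq_lift _ _)) mulr0.
rewrite summxE (bigD1 k)//= big1 ?addr0 => [|j jk].
  by rewrite !mxE !eqxx mulr1.
by rewrite !mxE eqxx/= (inj_eq lift_inj) eq_sym (negbTE jk) mulr0.
Qed.

End central_projection.

(** The reflection that exchanges the pole and s0 transports the central projection at the pole.
    With the Gram matrix normalised at the point, its determinant is visibly positive, which
    inverting the Hodge dual requires. *)
Lemma exists_chart m (s0 : 'rV[R]_m.+1) : sphere s0 ->
  exists T : 'rV[R]_m -> 'rV[R]_m.+1,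
  [/\ sphere_coordinates setT T, T 0 = s0, pullback_metric T 0 = 1%:M &
    forall X, tangent s0 X -> exists c : 'I_m -> R, X = \sum_j c j *: partial_map j T 0].
Proof.
move=> ss0; pose pole : 'rV[R]_m.+1 := basis ord_max; pose u := pole - s0.
have Hpole : reflection u pole = s0.
  by apply: reflection_swap; rewrite dot_basis mxE !eqxx; move/sphereP : ss0 => ->.
have HC : smooth_map_on setT (reflection u).
  apply: (@smooth_on_reflection _ u _ setT id); first exact: openT.
  by move=> l; exact/smooth_on_coord/openT.
have HK := @reflectionK _ u; have HD := @reflection_affine _ u.
have HZ := @reflectionZ _ u; have dotH := @dot_reflection _ u.
exists (central_chart (reflection u)); split.
- exact: (central_chart_coordinates HK HZ dotH HC).
- exact: (central_chart0 ss0 Hpole).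
- exact: (central_chart_gram ss0 HD dotH Hpole).
- exact: (central_chart_span ss0 HK HD HZ dotH Hpole).
Qed.

Section chart_forms.
Context {m : nat}.
Variables (B : 'rV[R]_m.+1 -> 'M[R]_m.+1) (r : R).
Hypotheses (hB : smooth_closed_csupp_2form B) (hr : 0 < r).
Variables (U : set 'rV[R]_m) (T : 'rV[R]_m -> 'rV[R]_m.+1).
Hypothesis UT : sphere_coordinates U T.

Let oU : open U. Proof. by case: UT. Qed.
Let TC : smooth_map_on U T. Proof. by case: UT. Qed.

Lemma chart_sphere q : U q -> sphere (T q).
Proof.
case: UT => _ _ [W [K [_ _ TU _]]] Uq.
by have : (T @` U) (T q) by [exists q]; rewrite TU => -[].
Qed.

Lemma chart_tangent q j : U q -> tangent (T q) (partial_map j T q).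
Proof.
move=> Uq; have D l : is_derive q (basis j) (fun y => T y ord0 l) (partial_map j T q ord0 l).
  by rewrite mxE; split => //; exact: smooth_on_derivable oU (TC l) Uq.
have [_ E] := is_derive_sumr (index_enum 'I_m.+1) (fun l => is_derive_prod (D l) (D l)).
have E1 : 'D_(basis j) (fun y => \sum_l T y ord0 l * T y ord0 l) q = 0.
  transitivity ('D_(basis j) (fun=> 1 : R) q); last exact: derive_cst.
  apply: near_eq_derive; apply: filterS (open_near oU Uq) => y Uy.
  by apply/sphereP/chart_sphere.
rewrite E1 big_split/= in E; rewrite /tangent/=.
by move: E; rewrite -/(dot _ _); lra.
Qed.

(** This is dA = B pulled back by q |-> r T q; each of the two tangent vectors contributes a factor
    r. *)
Lemma chart_ext_deriv q j k : U q ->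
  coord_ext_deriv T (sphere_potential B r) q j k =
  r ^+ 2 * \sum_a \sum_b B (r *: T q) a b * partial_map j T q ord0 a * partial_map k T q ord0 b.
Proof.
move=> Uq; have rTC := smooth_map_on_scaled r oU TC.
have := gauge_pullback_ext_deriv hB j k oU rTC Uq.
have E i : forall y, U y -> coord_1form T (sphere_potential B r) i y =
    pullback_1form (fun q => r *: T q) (poincare_gauge B) i y.
  by move=> y Uy; rewrite /coord_1form /pullback_1form /sphere_potential (partial_map_scaled r i oU TC Uy) dotZr.
have P i i' : partial i (pullback_1form (fun q => r *: T q) (poincare_gauge B) i') q =
    partial i (coord_1form T (sphere_potential B r) i') q.
  by apply: near_eq_derive; apply: filterS (open_near oU Uq) => y Uy; rewrite E.
rewrite !P => E2; rewrite mxE E2 mxE mulr_sumr; apply: eq_bigr => a _.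
rewrite mulr_sumr; apply: eq_bigr => b _.
rewrite (partial_map_scaled r j oU TC Uq) (partial_map_scaled r k oU TC Uq) !scale_coord.
by move: (B _ _ _) (partial_map _ _ _ _ _) (partial_map _ _ _ _ _) => x y z; ring.
Qed.

Let F := spherical_coordinates T.

Let point_proj q t : (\row_j (spherical_point q t : 'rV[R]_m.+1) ord0 (lift ord_max j)) = q.
Proof. by apply/rowP => j; rewrite !mxE liftK. Qed.

Lemma spherical_coordinates_point q (t : R) : F (spherical_point q t) = t *: T q.
Proof. by rewrite /F /spherical_coordinates point_proj mxE unlift_none. Qed.

Let angles (p : 'rV[R]_m.+1) : 'rV[R]_m := \row_j p ord0 (lift ord_max j).

(** One computation for both kinds of coordinates: v is a basis vector for an angular coordinate and
    0 for the radial one. *)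
Let partial_spherical q (t : R) i v l dT :
  (forall h : R, angles (h *: basis i + spherical_point q t) = h *: v + angles (spherical_point q t)) ->
  is_derive q v (fun y => T y ord0 l) dT ->
  partial_map i F (spherical_point q t) ord0 l = t * dT + T q ord0 l * (i == ord_max)%:R.
Proof.
move=> A; rewrite -{1}(point_proj q t) => D; rewrite mxE /partial; set p := spherical_point q t.
have [_ E] := is_derive_prod (is_derive_coord p (basis i) ord_max) (is_derive_affine A D).
transitivity ('D_(basis i) (fun y : 'rV[R]_m.+1 => y ord0 ord_max *
    ((fun y => T y ord0 l) \o angles) y) p).
  by congr ('D_ _ _ p); apply/funext => y; rewrite !mxE.
by rewrite E /= /angles point_proj !mxE unlift_none eqxx/= eq_sym.
Qed.

Lemma partial_spherical_lift q (t : R) j : U q ->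
  partial_map (lift ord_max j) F (spherical_point q t) = t *: partial_map j T q.
Proof.
move=> Uq; apply/rowP => l.
have D : is_derive q (basis j) (fun y => T y ord0 l) (partial j (fun y => T y ord0 l) q).
  by split => //; exact: smooth_on_derivable oU (TC l) Uq.
rewrite (partial_spherical _ D) => [|h].
  by rewrite eq_sym (negbTE (neq_lift _ _)) mulr0 addr0 !mxE.
by apply/rowP => k; rewrite !mxE liftK eqxx/= (inj_eq lift_inj).
Qed.

Lemma partial_spherical_max q (t : R) : partial_map ord_max F (spherical_point q t) = T q.
Proof.
apply/rowP => l; have D : is_derive q 0 (fun y => T y ord0 l) 0.
  by split; [exact: derivable0|exact: derive0].
rewrite (partial_spherical _ D) => [|h]; first by rewrite mulr0 add0r eqxx mulr1.
apply/rowP => k; rewrite !mxE liftK eqxx/= eq_sym (negbTE (neq_lift _ _)).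
by rewrite !mulr0.
Qed.

Lemma pullback_spherical_lift q j k : U q ->
  pullback_2form F B (spherical_point q r) (lift ord_max j) (lift ord_max k) =
  coord_ext_deriv T (sphere_potential B r) q j k.
Proof.
move=> Uq; rewrite chart_ext_deriv// mxE mulr_sumr; apply: eq_bigr => a _.
rewrite mulr_sumr; apply: eq_bigr => b _.
rewrite (partial_spherical_lift r j Uq) (partial_spherical_lift r k Uq) !scale_coord.
rewrite spherical_coordinates_point.
by move: (B _ _ _) (partial_map _ _ _ _ _) (partial_map _ _ _ _ _) => x y z; ring.
Qed.

Lemma flat_chart_ext_deriv q : flat_on_sphere B r -> U q ->
  coord_ext_deriv T (sphere_potential B r) q = 0.
Proof.
move=> fl Uq; apply/matrixP => j k; rewrite chart_ext_deriv// mxE.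
by rewrite fl ?mulr0//; [exact: chart_sphere|exact: chart_tangent|exact: chart_tangent].
Qed.

(** At such a point the metric r^2 gamma + dr^2 is diagonal, with entries r^2 and 1. *)
Lemma det_spherical_metric q : U q -> pullback_metric T q = 1%:M ->
  0 < \det (pullback_metric F (spherical_point q r)).
Proof.
move=> Uq G; have GE j k : dot (partial_map j T q) (partial_map k T q) = (j == k)%:R.
  by have /matrixP/(_ j k) := G; rewrite !mxE.
have -> : pullback_metric F (spherical_point q r) =
    diag_mx (\row_i (if unlift ord_max i is Some _ then r ^+ 2 else 1)).
  apply/matrixP => i k; rewrite !mxE.
  case: (unliftP ord_max i) => [j ->|->]; case: (unliftP ord_max k) => [l ->|->].
  - rewrite !partial_spherical_lift// dotZl dotZr GE (inj_eq lift_inj).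
    by case: (j == l); rewrite ?mulr0n ?mulr0// !mulr1n mulr1 expr2.
  - rewrite partial_spherical_lift// partial_spherical_max dotZl dotC.
    by rewrite (chart_tangent j Uq) mulr0 eq_sym (negbTE (neq_lift _ _)).
  - rewrite partial_spherical_lift// partial_spherical_max dotZr.
    by rewrite (chart_tangent l Uq) mulr0 (negbTE (neq_lift _ _)).
  - rewrite partial_spherical_max eqxx.
    by have /sphereP -> := chart_sphere Uq.
rewrite det_diag; apply: prodr_gt0 => i _; rewrite mxE.
by case: unlift => // _; rewrite exprn_gt0.
Qed.

End chart_forms.
End charts.

(** * Components of the Hodge dual *)

Section hodge.
Context {R : realType}.

Lemma levi_civita_perm n (s : 'S_n) (t : n.-tuple 'I_n) :
  (forall i, tnth t i = s i) -> levi_civita (R := R) t = (-1) ^+ s.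
Proof.
move=> ts; rewrite /levi_civita; case: pickP => [s' /forallP s'P|/(_ s)/forallP[]].
  by congr ((-1) ^+ (odd_perm _)); apply/permP => i; rewrite (eqP (s'P i)) ts.
by move=> i; rewrite ts.
Qed.

Lemma levi_civita_uniq n (t : n.-tuple 'I_n) : levi_civita (R := R) t != 0 -> uniq t.
Proof.
rewrite /levi_civita; case: pickP => [s /forallP sP _|_]; last by rewrite eqxx.
apply/tuple_uniqP => i j; rewrite -(eqP (sP i)) -(eqP (sP j)); exact: perm_inj.
Qed.

Lemma levi_civita_neq0 n (t : n.-tuple 'I_n) : uniq t -> levi_civita (R := R) t != 0.
Proof.
move=> ut; have ti : injective (tnth t) by exact/tuple_uniqP.
by rewrite (@levi_civita_perm _ (perm ti)) ?signr_eq0// => i; rewrite permE.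
Qed.

Section components.
Variables (m : nat) (l : m.-tuple 'I_m.+2).

Let t j k : m.+2.-tuple 'I_m.+2 := [tuple of rcons (rcons l j) k].

Lemma levi_civita_swap j k : levi_civita (R := R) (t k j) = - levi_civita (t j k).
Proof.
have [u|nu] := boolP (uniq (t j k)); last first.
  have nu' : ~~ uniq (t k j).
    apply: contra nu; rewrite /= !rcons_uniq !mem_rcons !inE !negb_or (eq_sym j).
    by move=> /and3P[/andP[-> ->] -> ->].
  apply/eqP; move: (contraNN (levi_civita_uniq (t := t j k)) nu).
  move: (contraNN (levi_civita_uniq (t := t k j)) nu').
  by rewrite !negbK => /eqP -> /eqP ->; rewrite oppr0.
have ti : injective (tnth (t j k)) by exact/tuple_uniqP.
pose a : 'I_m.+2 := Ordinal (ltnW (leqnn m.+2) : (m < m.+2)%N).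
pose b : 'I_m.+2 := ord_max.
have ab : a != b by rewrite -val_eqE/= ltn_eqF.
rewrite [in RHS](@levi_civita_perm _ (perm ti)); last by move=> i; rewrite permE.
(* Here a and b are the last two positions: exchanging the entries there is precomposition with
   their transposition, which flips the sign. *)
rewrite (@levi_civita_perm _ (tperm a b * perm ti)%g) ?odd_permM ?odd_tperm ?ab.
  by rewrite signr_addb expr1 mulN1r.
have E j' k' i : tnth (t j' k') i = if (i < m)%N then nth j l i else if i == a then j' else k'.
  rewrite (tnth_nth j) /= !nth_rcons !size_rcons size_tuple -[i == a]val_eqE/=.
  rewrite ltnS; case: (ltngtP i m) => [im|mi|] //.
  by rewrite (_ : i == m.+1 :> nat)// eqn_leq mi -ltnS ltn_ord.
move=> i; rewrite permM permE !E.
case: tpermP => [->|->|/eqP/negbTE ia /eqP/negbTE ib].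
- by rewrite /a/b/= ltnn ltnNge leqnSn/= eqxx eq_sym (negbTE ab).
- by rewrite /a/b/= ltnn ltnNge leqnSn/= eqxx eq_sym (negbTE ab).
- rewrite ia; case: ltnP => // mi; have := ltn_ord i.
  rewrite ltnS leq_eqVlt ltnS.
  by move: ia ib; rewrite -!val_eqE/= eqn_leq mi andbT => -> ->.
Qed.

(** As l, a and b exhaust the indices, only the terms (a, b) and (b, a) survive, and they are equal
    by two changes of sign. The component of the dual is thus a nonzero multiple of [w a b]. *)
Lemma hodge_component (g w : 'M[R]_m.+2) a b : 0 < \det g ->
  (forall j k, w j k = - w k j) -> uniq (rcons (rcons l a) b) ->
  hodge_2form g w l = 0 -> w a b = 0.
Proof.
move=> g0 anti u; rewrite /hodge_2form.
have mem x : x \notin l -> (x == a) || (x == b).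
  move=> xl; have [_ E] : (size (rcons (rcons l a) b) = size (enum 'I_m.+2)) *
      (rcons (rcons l a) b =i enum 'I_m.+2).
    apply: uniq_min_size => // [y _|]; first by rewrite mem_enum.
    by rewrite size_enum_ord !size_rcons size_tuple.
  have := E x; rewrite mem_enum !mem_rcons !inE mem_rcons inE (negbTE xl) orbF.
  by rewrite orbC => ->.
have ab : a != b.
  by move: u; rewrite rcons_uniq mem_rcons inE negb_or eq_sym => /andP[/andP[]].
pose c := (Num.sqrt (\det g))^-1 * levi_civita (R := R) (t a b).
have c0 : c != 0.
  by rewrite mulf_neq0 ?levi_civita_neq0// invr_eq0 gt_eqF// sqrtr_gt0.
have Z j k : ~~ (((j == a) && (k == b)) || ((j == b) && (k == a))) ->
    (Num.sqrt (\det g))^-1 * levi_civita (R := R) (t j k) * w j k = 0.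
  have [->|/levi_civita_uniq] := eqVneq (levi_civita (R := R) (t j k)) 0.
    by rewrite mulr0 mul0r.
  rewrite /= !rcons_uniq mem_rcons inE negb_or => /and3P[/andP[kj /mem kl] /mem jl _].
  move: kl jl kj => /orP[] /eqP -> /orP[] /eqP ->; rewrite ?eqxx//=.
  by rewrite orbT.
rewrite (bigD1 a)//= (bigD1 b)//= [X in _ + X + _]big1 => [|k kb]; last first.
  by apply: Z; rewrite (negbTE kb) (negbTE ab) andbF.
rewrite (bigD1 b) 1?eq_sym//= (bigD1 a)//= [X in _ + (_ + X + _)]big1 => [|k ka]; last first.
  by apply: Z; rewrite (negbTE ka) eq_sym (negbTE ab) andbF.
rewrite [X in _ + (_ + X)]big1 => [|j /andP[ja jb]]; last first.
  by apply: big1 => k _; apply: Z; rewrite (negbTE ja) (negbTE jb).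
rewrite (levi_civita_swap a b) (anti b a) => H.
have /eqP : c * w a b = 0 by rewrite -H /c; field; rewrite gt_eqF// sqrtr_gt0.
by rewrite mulf_eq0 (negbTE c0) => /eqP.
Qed.

End components.

Lemma exists_complement n (a b : 'I_n.+2) : a != b ->
  exists l : n.-tuple 'I_n.+2, uniq (rcons (rcons l a) b).
Proof.
move=> ab; pose s := [seq x <- enum 'I_n.+2 | x \notin [:: a; b]].
have sn : size s == n.
  rewrite size_filter -(eqn_add2l 2) -[X in (X + _)%N](_ : count (mem [:: a; b]) (enum 'I_n.+2) = 2%N).
    by rewrite (count_predC (mem [:: a; b])) size_enum_ord.
  rewrite -size_filter -[RHS]/(size [:: a; b]); apply: perm_size.
  apply: uniq_perm; [by rewrite filter_uniq// enum_uniq|by rewrite /= inE ab|].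
  by move=> x; rewrite mem_filter mem_enum andbT.
exists (Tuple sn) => /=.
rewrite !rcons_uniq mem_rcons inE negb_or eq_sym ab filter_uniq ?enum_uniq//=.
by rewrite !mem_filter !inE !eqxx orbT.
Qed.

End hodge.

(** * Flatness in terms of Hodge duals *)

Section flatness_criteria.
Context {R : realType} {n : nat}.
Variables (B : 'rV[R]_n.+3 -> 'M[R]_n.+3) (r : R).
Hypotheses (hB : smooth_closed_csupp_2form B) (hr : 0 < r).
Notation w T q := (coord_ext_deriv T (sphere_potential B r) q).

Let coord_ext_deriv_antisym (T : 'rV[R]_n.+2 -> 'rV[R]_n.+3) q j k : w T q j k = - w T q k j.
Proof. by rewrite !mxE opprB. Qed.

(** One chart around each point is enough, because its coordinate vectors span the tangent space. *)
Lemma flat_of_charts :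
  (forall T : 'rV[R]_n.+2 -> 'rV[R]_n.+3, sphere_coordinates setT T ->
    pullback_metric T 0 = 1%:M -> forall a b, a != b -> w T 0 a b = 0) ->
  flat_on_sphere B r.
Proof.
move=> H s X Y ss tX tY; have [T [UT T0 G span]] := exists_chart ss.
have [c ->] := span _ tX; have [e ->] := span _ tY.
have W a b : \sum_i \sum_j B (r *: s) i j * partial_map a T 0 ord0 i * partial_map b T 0 ord0 j = 0.
  have : w T 0 a b = 0.
    have [<-|] := eqVneq a b; last exact: H.
    by rewrite mxE subrr.
  rewrite (chart_ext_deriv r hB UT)// T0 => /eqP.
  by rewrite mulf_eq0 expf_eq0/= gt_eqF//= => /eqP.
have S (z : 'I_n.+2 -> R) i : (\sum_j z j *: partial_map j T 0) ord0 i =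
    \sum_j z j * partial_map j T 0 ord0 i.
  by rewrite summxE; apply: eq_bigr => j _; rewrite scale_coord.
under eq_bigr do under eq_bigr do rewrite !S.
rewrite (sum_bilinear _ (fun j => partial_map j T 0 ord0)).
by apply: big1 => a _; apply: big1 => b _; rewrite W mulr0.
Qed.

Lemma flat_of_sphere_hodge :
  (forall (U : set 'rV[R]_n.+2) T, sphere_coordinates U T ->
    forall q, U q -> forall l : n.-tuple 'I_n.+2,
      hodge_2form (pullback_metric T q) (w T q) l = 0) ->
  flat_on_sphere B r.
Proof.
move=> H; apply: flat_of_charts => T UT G a b ab.
have [l lab] := exists_complement ab.
apply: (@hodge_component _ _ l (pullback_metric T 0)) => //.
  by rewrite G det1.
exact: (H setT).
Qed.

Let lift_max_neq (j : 'I_n.+2) : (lift ord_max j == ord_max) = false.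
Proof. by rewrite eq_sym; exact/negbTE/neq_lift. Qed.

(** The radial index already occurs in the tuple, so the two free indices are angular and the
    component only sees the restriction of B to the sphere. *)
Lemma flat_of_hodge :
  (forall (U : set 'rV[R]_n.+2) T, sphere_coordinates U T ->
    forall q, U q -> forall l : n.-tuple 'I_n.+2,
      let p := spherical_point q r in
      hodge_2form (pullback_metric (spherical_coordinates T) p)
        (pullback_2form (spherical_coordinates T) B p)
        [tuple of rcons (map_tuple (lift ord_max) l) ord_max] = 0) ->
  flat_on_sphere B r.
Proof.
move=> H; apply: flat_of_charts => T UT G a b ab.
have [l lab] := exists_complement ab.
rewrite -(pullback_spherical_lift r hB UT)//.
have := H setT T UT 0 Logic.I l.
apply: hodge_component.
- exact: (det_spherical_metric hr UT).
- move=> j k; rewrite !mxE -sumrN exchange_big; apply: eq_bigr => c _.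
  rewrite -sumrN; apply: eq_bigr => e _.
  by rewrite (two_form_antisym hB); ring.
- move: lab; rewrite /= !rcons_uniq !(mem_rcons, inE) !negb_or.
  rewrite !(inj_eq lift_inj) !(mem_map lift_inj) (map_inj_uniq lift_inj) !lift_max_neq/=.
  move=> /and3P[/andP[-> ->] -> ->]; rewrite !andbT/=.
  by apply/mapP => -[j _ /eqP]; rewrite eq_sym lift_max_neq.
Qed.

Lemma flat_hodge (U : set 'rV[R]_n.+2) T q (l : n.-tuple 'I_n.+2) :
  flat_on_sphere B r -> sphere_coordinates U T -> U q ->
  hodge_2form (pullback_metric (spherical_coordinates T) (spherical_point q r))
    (pullback_2form (spherical_coordinates T) B (spherical_point q r))
    [tuple of rcons (map_tuple (lift ord_max) l) ord_max] = 0.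
Proof.
move=> fl UT Uq; rewrite /hodge_2form big1 ?mulr0// => j _; apply: big1 => k _.
(* This disposes of the terms where j or k is radial, since an index is then repeated. *)
have Z (t : n.+3.-tuple 'I_n.+3) (c d : R) : ~~ uniq t -> c * levi_civita (R := R) t * d = 0.
  by move=> /(contraNN (@levi_civita_uniq R _ t)); rewrite negbK => /eqP ->; rewrite mulr0 mul0r.
case: (unliftP ord_max j) => [j' ->|->]; last first.
  by apply: Z; rewrite /= !rcons_uniq !(mem_rcons, inE) eqxx/= !(orbT, andbF).
case: (unliftP ord_max k) => [k' ->|->]; last first.
  by apply: Z; rewrite /= !rcons_uniq !(mem_rcons, inE) eqxx /= !(orbT, andbF).
rewrite (pullback_spherical_lift r hB UT _ _ Uq) (flat_chart_ext_deriv hB UT fl Uq).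
by rewrite mxE mulr0.
Qed.

End flatness_criteria.

(** * The equivalences *)

Section sphere_integrals.
Context {R : realType} {n : nat}.
Notation punct := (@punctured R n).
Notation sint f := (sphere_integral (fun s => (f s)%:E)).
Implicit Types (f g : 'rV[R]_n -> R) (s X : 'rV[R]_n).

(** Measurability is asked on the ball alone, so that a function can be replaced by one equal to it
    on the sphere ([eq_sphere_mfun]). Elements of H^1 may be unbounded, so [nice] does not fit
    them. *)
Definition sphere_mfun f : Prop := measurable_fun (@pball R n) (on_ball f).

Lemma sphere_measurable_mfun f : sphere_measurable f -> sphere_mfun f.
Proof. by move=> mf; exact: measurable_funTS. Qed.

Lemma nice_mfun f : nice f -> sphere_mfun f.
Proof. by case=> mf _; exact: sphere_measurable_mfun. Qed.

Lemma eq_sphere_mfun f g : (forall s, sphere s -> f s = g s) -> sphere_mfun f -> sphere_mfun g.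
Proof.
by move=> fg; apply: eq_measurable_fun => t; rewrite inE => /pball_sphere; exact: fg.
Qed.

Lemma sphere_mfunD f g : sphere_mfun f -> sphere_mfun g -> sphere_mfun (fun s => f s + g s).
Proof. by move=> mf mg; exact: measurable_funD. Qed.

Lemma sphere_mfunM f g : sphere_mfun f -> sphere_mfun g -> sphere_mfun (fun s => f s * g s).
Proof. by move=> mf mg; exact: measurable_funM. Qed.

Lemma sphere_mfunZ (c : R) f : sphere_mfun f -> sphere_mfun (fun s => c * f s).
Proof. by apply: sphere_mfunM; exact: measurable_cst. Qed.

Lemma sphere_mfunB f g : sphere_mfun f -> sphere_mfun g -> sphere_mfun (fun s => f s - g s).
Proof. by move=> mf mg; exact: measurable_funB. Qed.

Lemma sphere_mfun_sqr f : sphere_mfun f -> sphere_mfun (fun s => f s ^+ 2).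
Proof. by move=> mf; under eq_fun do rewrite expr2; exact: @sphere_mfunM. Qed.

Lemma sphere_mfun_sum I (r : seq I) (f : I -> 'rV[R]_n -> R) :
  (forall i, sphere_mfun (f i)) -> sphere_mfun (fun s => \sum_(i <- r) f i s).
Proof.
move=> mf; elim: r => [|i r ih].
  by under eq_fun do rewrite big_nil; exact: measurable_cst.
by under eq_fun do rewrite big_cons; exact: @sphere_mfunD.
Qed.

Lemma eq_sint f g : (forall s, sphere s -> f s = g s) -> sint f = sint g.
Proof.
move=> fg; congr (_ * _)%E; apply: eq_integral => t; rewrite inE => /pball_sphere H.
by rewrite fg.
Qed.

Lemma sint_ge0 f : (forall s, sphere s -> 0 <= f s) -> (0 <= sint f)%E.
Proof.
move=> f0; apply: mule_ge0; first by rewrite lee_fin.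
by apply: integral_ge0 => t /pball_sphere H; rewrite lee_fin f0.
Qed.

Let mE f : sphere_mfun f ->
  measurable_fun (@pball R n) (fun t => (f (radial (row_of_tuple t)))%:E).
Proof. by move=> mf; exact/measurable_EFinP. Qed.

Lemma le_sint f g : sphere_mfun f -> sphere_mfun g ->
  (forall s, sphere s -> 0 <= f s) -> (forall s, sphere s -> f s <= g s) ->
  (sint f <= sint g)%E.
Proof.
move=> mf mg f0 fg; apply: lee_wpmul2l; first by rewrite lee_fin.
apply: ge0_le_integral; [exact: measurable_pball| |exact: mE|exact: mE|].
  by move=> t /pball_sphere H; rewrite lee_fin f0.
by move=> t /pball_sphere H; rewrite lee_fin fg.
Qed.

Lemma sintD f g : sphere_mfun f -> sphere_mfun g ->
  (forall s, sphere s -> 0 <= f s) -> (forall s, sphere s -> 0 <= g s) ->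
  sint (fun s => f s + g s) = (sint f + sint g)%E.
Proof.
move=> mf mg f0 g0; rewrite /sphere_integral -ge0_muleDr; last 2 first.
- by apply: integral_ge0 => t /pball_sphere H; rewrite lee_fin f0.
- by apply: integral_ge0 => t /pball_sphere H; rewrite lee_fin g0.
congr (_ * _)%E; rewrite -ge0_integralD; [|exact: measurable_pball| |exact: mE| |exact: mE].
- by apply: eq_integral => t _; rewrite EFinD.
- by move=> t /pball_sphere H; rewrite lee_fin f0.
- by move=> t /pball_sphere H; rewrite lee_fin g0.
Qed.

Lemma sintZ (c : R) f : 0 <= c -> sphere_mfun f -> (forall s, sphere s -> 0 <= f s) ->
  sint (fun s => c * f s) = (c%:E * sint f)%E.
Proof.
move=> c0 mf f0; rewrite /sphere_integral muleCA; congr (_ * _)%E.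
rewrite -ge0_integralZl_EFin; [|exact: measurable_pball| |exact: mE|by []].
  by apply: eq_integral => t _; rewrite EFinM.
by move=> t /pball_sphere H; rewrite lee_fin f0.
Qed.

Lemma sint0 f : (forall s, sphere s -> f s = 0) -> sint f = 0%E.
Proof.
move=> f0; rewrite (@eq_sint f (fun=> 0))//.
by rewrite /sphere_integral integral0 mule0.
Qed.

(** Near x this is the composite with [radial] of a local smooth extension of f around x / |x|. *)
Lemma smooth_on_sphere_radial f : smooth_on_sphere f -> smooth_on punct (f \o radial).
Proof.
move=> fC; apply: smooth_on_local => x x0.
have [W [F [oW Ws FC fF]]] := fC _ (radial_sphere x0).
pose V := punct `&` [set y | W (radial y)].
have oV : open V.
  rewrite openE => y [y0 Wy]; apply: filterI.
    exact: open_near (@open_punctured R n) y0.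
  exact: (radial_continuous y0 (open_near oW Wy)).
exists V; split => //.
apply: (@smooth_on_ext _ _ V (fun y => F (radial y))) => //.
  by move=> y [y0 Wy]; rewrite /= fF//; exact: radial_sphere.
apply: (@smooth_on_comp _ _ _ V W radial F) => //.
  by move=> l; apply: smooth_on_sub (@smooth_map_on_radial _ _ l) => y [].
by move=> y [].
Qed.

Lemma sphere_nice f : smooth_on punct (f \o radial) -> nice f.
Proof.
move=> fC; have fc x : x != 0 -> {for x, continuous (f \o radial)}.
  exact: smooth_on_continuous (@open_punctured R n) fC.
split; first exact: (@measurable_continuous_row _ _ (f \o radial)).
have [C CP] := continuous_sphere_bounded (fun s ss => fc s (sphere_neq0 ss)).
by exists C => s ss; have := CP s ss; rewrite /= radial_id.
Qed.

(** Euler's relation, the extension being homogeneous of degree 0. *)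
Lemma sum_partial_radial f s : smooth_on punct (f \o radial) -> sphere s ->
  \sum_l s ord0 l * partial l (f \o radial) s = 0.
Proof.
move=> fC ss; have s0 := sphere_neq0 ss.
have fd := smooth_on_differentiable (@open_punctured R n) fC s0.
rewrite -derive_partial//.
have [_ <-] := is_derive_line0 (diff_derivable (v := s) fd).
transitivity ('D_1 (fun=> (f \o radial) s : R) (0 : R)); last exact: derive_cst.
apply: near_eq_derive; near=> t.
rewrite /= -[X in _ + X]scale1r -scalerDl radialZ//.
have : `|t| < 1 by near: t; exact: (@nbhs0_lt _ R^o _ ltr01).
by rewrite ltr_norml => /andP[]; lra.
Unshelve. all: by end_near. Qed.

Definition re_part (u : 'rV[R]_n -> R[i]) : 'rV[R]_n -> R :=
  (fun x => complex.Re (u x)) \o radial.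
Definition im_part (u : 'rV[R]_n -> R[i]) : 'rV[R]_n -> R :=
  (fun x => complex.Im (u x)) \o radial.

Lemma csphere_diffE u s X : smooth_on punct (re_part u) -> smooth_on punct (im_part u) ->
  sphere s -> csphere_diff u s X =
    Complex (\sum_l X ord0 l * partial l (re_part u) s)
            (\sum_l X ord0 l * partial l (im_part u) s).
Proof.
move=> vC wC ss; have s0 := sphere_neq0 ss; rewrite /csphere_diff.
congr Complex; rewrite -derive_partial//.
  exact: smooth_on_differentiable (@open_punctured R n) vC s0.
exact: smooth_on_differentiable (@open_punctured R n) wC s0.
Qed.

Lemma tprojE s k l : tproj s (basis k) ord0 l = (l == k)%:R - s ord0 k * s ord0 l.
Proof. by rewrite /tproj dot_basis !mxE eqxx. Qed.

Lemma tproj_tangent s X : sphere s -> tangent s (tproj s X).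
Proof.
by move=> /sphereP ss; rewrite /tangent/= /tproj dotDr dotNr dotZr ss mulr1 subrr.
Qed.

(** A covector that kills s takes the same value on a vector and on its tangential projection. Hence
    [sqconorm] becomes the plain sum of the squares of the components. *)
Lemma sum_tproj s k (a : 'I_n -> R) : \sum_l s ord0 l * a l = 0 ->
  \sum_l tproj s (basis k) ord0 l * a l = a k.
Proof.
move=> a0; transitivity (a k - s ord0 k * \sum_l s ord0 l * a l); last first.
  by rewrite a0 mulr0 subr0.
rewrite mulr_sumr (bigD1 k)//= [X in _ = _ - X](bigD1 k)//= tprojE eqxx opprD addrA.
rewrite -sumrN; congr (_ + _); first by rewrite mulr1n; ring.
by apply: eq_bigr => l lk; rewrite tprojE (negbTE lk) mulr0n; ring.
Qed.

Lemma ReB (z1 z2 : R[i]) : complex.Re (z1 - z2) = complex.Re z1 - complex.Re z2.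
Proof. by case: z1 z2 => [? ?] []. Qed.

Lemma ImB (z1 z2 : R[i]) : complex.Im (z1 - z2) = complex.Im z1 - complex.Im z2.
Proof. by case: z1 z2 => [? ?] []. Qed.

Lemma sqnormc_ge0 (z : R[i]) : 0 <= sqnormc z.
Proof. by rewrite addr_ge0 ?sqr_ge0. Qed.

Lemma sqconorm_ge0 s a : 0 <= sqconorm s a.
Proof. by apply: sumr_ge0 => k _; exact: sqnormc_ge0. Qed.

Lemma sqnormcD2 (z1 z2 : R[i]) : sqnormc (z1 + z2) <= 2 * (sqnormc z1 + sqnormc z2).
Proof.
case: z1 z2 => [a b] [c d]; rewrite /sqnormc/=.
by have := sqr_ge0 (a - c); have := sqr_ge0 (b - d); rewrite !expr2; lra.
Qed.

Lemma sqnormcD3 (z1 z2 z3 : R[i]) :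
  sqnormc (z1 + z2 + z3) <= 3 * (sqnormc z1 + sqnormc z2 + sqnormc z3).
Proof.
case: z1 z2 z3 => [a b] [c d] [e f]; rewrite /sqnormc/=.
have := sqr_ge0 (a - c); have := sqr_ge0 (b - d); have := sqr_ge0 (a - e).
have := sqr_ge0 (b - f); have := sqr_ge0 (c - e); have := sqr_ge0 (d - f).
by rewrite !expr2; lra.
Qed.

Lemma sqnormcMi (a : R) (z : R[i]) : sqnormc ('i%C * a%:C%C * z) = a ^+ 2 * sqnormc z.
Proof. by case: z => b c; rewrite /sqnormc/=; ring. Qed.

End sphere_integrals.

(** Contract s /\ F with s, X and Y: as s is a unit vector orthogonal to X and Y, only F (X, Y)
    remains. *)
Lemma contract_wedge {R : realType} n (s X Y : 'rV[R]_n) (F : 'I_n -> 'I_n -> R) :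
  dot s s = 1 -> dot s X = 0 -> dot s Y = 0 ->
  (forall k i j, s ord0 k * F i j + s ord0 i * F j k + s ord0 j * F k i = 0) ->
  \sum_i \sum_j X ord0 i * Y ord0 j * F i j = 0.
Proof.
move=> ss sX sY H.
have : \sum_k \sum_i \sum_j s ord0 k * (X ord0 i * Y ord0 j) *
    (s ord0 k * F i j + s ord0 i * F j k + s ord0 j * F k i) = 0.
  by apply: big1 => k _; apply: big1 => i _; apply: big1 => j _; rewrite H mulr0.
have -> : \sum_k \sum_i \sum_j s ord0 k * (X ord0 i * Y ord0 j) *
    (s ord0 k * F i j + s ord0 i * F j k + s ord0 j * F k i) =
  dot s s * (\sum_i \sum_j X ord0 i * Y ord0 j * F i j)
  + \sum_k dot s X * (\sum_j s ord0 k * Y ord0 j * F j k)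
  + \sum_k \sum_i s ord0 k * X ord0 i * F k i * dot s Y.
  rewrite /dot mulr_suml -!big_split/=; apply: eq_bigr => k _.
  rewrite mulr_sumr mulr_suml -!big_split/=; apply: eq_bigr => i _.
  rewrite !mulr_sumr -!big_split/=; apply: eq_bigr => j _.
  by ring.
rewrite ss sX sY mul1r [X in _ + X + _]big1 => [|k _]; last by rewrite mul0r.
rewrite [X in _ + X = _]big1 ?addr0// => k _.
by apply: big1 => i _; rewrite mulr0.
Qed.

(** * From nu = 0 to flatness *)

Section reduction.
Context {R : realType} {n : nat}.
Notation punct := (@punctured R n).
Notation sint f := (sphere_integral (fun s => (f s)%:E)).
Variables (B : 'rV[R]_n -> 'M[R]_n) (r : R).
Hypotheses (hB : smooth_closed_csupp_2form B) (hr : 0 < r) (n1 : (1 < n)%N).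
Implicit Types (s X : 'rV[R]_n) (u : 'rV[R]_n -> R[i]).
Notation om := (radial_form B r).
Notation a s X := (sphere_potential B r s X).

(** The form is pulled back by a map that is constant along rays. *)
Lemma sum_radial_form s : sphere s -> \sum_l s ord0 l * om l s = 0.
Proof.
move=> ss; rewrite sum_radial_form_derive//; apply: big1 => b _.
have rC := @smooth_map_on_radial R n b.
rewrite derive_partial; last exact: smooth_on_differentiable (@open_punctured R n) rC (sphere_neq0 ss).
by rewrite (@sum_partial_radial _ _ (fun y : 'rV[R]_n => y ord0 b) s rC ss) mulr0.
Qed.

Lemma sphere_potential_tproj s k : sphere s -> a s (tproj s (basis k)) = om k s.
Proof.
move=> ss; rewrite -radial_form_sphere//; last exact: tproj_tangent.
by rewrite (sum_tproj _ (a := fun l => om l s))//; exact: sum_radial_form.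
Qed.

Lemma sqconorm_gauge u s : smooth_on punct (re_part u) -> smooth_on punct (im_part u) ->
  sphere s ->
  sqconorm s (fun X => csphere_diff u s X - 'i%C * (a s X)%:C%C * u s) =
  cov_energy om (re_part u) (im_part u) s.
Proof.
move=> vC wC ss; apply: eq_bigr => k _.
rewrite csphere_diffE// sphere_potential_tproj//.
rewrite (sum_tproj k (sum_partial_radial vC ss)) (sum_tproj k (sum_partial_radial wC ss)).
rewrite /cov_re /cov_im.
have -> : re_part u s = complex.Re (u s) by rewrite /re_part/= radial_id.
have -> : im_part u s = complex.Im (u s) by rewrite /im_part/= radial_id.
move: (partial k (re_part u) s) (partial k (im_part u) s) (om k s) => p q o.
by case: (u s) => b c; rewrite /sqnormc/=; ring.
Qed.

Lemma sqmod_parts u s : sphere s -> sqmod (re_part u) (im_part u) s = sqnormc (u s).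
Proof. by move=> ss; rewrite /sqmod /re_part /im_part/= radial_id. Qed.

Lemma sphere_energy_bound : exists2 K : R, 0 <= K &
  forall s, sphere s -> \sum_k a s (tproj s (basis k)) ^+ 2 <= K.
Proof.
have [K KP] : exists K, forall s : 'rV[R]_n, sphere s -> `|\sum_k om k s ^+ 2| <= K.
  suff [_ //] : nice (fun s => \sum_k om k s ^+ 2).
  apply: nice_sum => k; under eq_fun do rewrite expr2.
  by apply: niceM; apply/smooth_nice/smooth_on_radial_form.
exists `|K| => // s ss; rewrite (le_trans _ (ler_norm K))// (le_trans _ (KP s ss))//.
under eq_bigr do rewrite sphere_potential_tproj//.
exact: ler_norm.
Qed.

Lemma sphere_mfun_tproj k l : sphere_mfun (fun s => tproj s (basis k) ord0 l : R).
Proof.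
have nx i : nice (fun s : 'rV[R]_n => s ord0 i).
  exact/smooth_nice/smooth_on_coord/open_punctured.
under eq_fun do rewrite tprojE.
by apply: nice_mfun; apply: niceB; [exact: nice_cst|exact: niceM].
Qed.

Lemma Re_covector (w : 'rV[R[i]]_n) X :
  complex.Re (covector w X) = \sum_k complex.Re (w ord0 k) * X ord0 k.
Proof.
rewrite /covector raddf_sum; apply: eq_bigr => k _.
by case: (w ord0 k) => b c /=; rewrite mulr0 subr0.
Qed.

Lemma Im_covector (w : 'rV[R[i]]_n) X :
  complex.Im (covector w X) = \sum_k complex.Im (w ord0 k) * X ord0 k.
Proof.
rewrite /covector raddf_sum; apply: eq_bigr => k _.
by case: (w ord0 k) => b c /=; rewrite mulr0 add0r.
Qed.

Definition csphere_mfun (z : 'rV[R]_n -> R[i]) : Prop :=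
  sphere_mfun (fun s => complex.Re (z s)) /\ sphere_mfun (fun s => complex.Im (z s)).

Lemma csphere_mfunB z1 z2 : csphere_mfun z1 -> csphere_mfun z2 ->
  csphere_mfun (fun s => z1 s - z2 s).
Proof.
move=> [m1 m1'] [m2 m2']; split.
  by under eq_fun do rewrite ReB; exact: @sphere_mfunB.
by under eq_fun do rewrite ImB; exact: @sphere_mfunB.
Qed.

Lemma csphere_mfunMi f z : sphere_mfun f -> csphere_mfun z ->
  csphere_mfun (fun s => 'i%C * (f s)%:C%C * z s).
Proof.
move=> mf [m1 m2]; split.
  apply: (@eq_sphere_mfun _ _ (fun s => -1 * (f s * complex.Im (z s)))) => [s _|].
    by case: (z s) => b c /=; ring.
  by apply: sphere_mfunZ; exact: @sphere_mfunM.
apply: (@eq_sphere_mfun _ _ (fun s => f s * complex.Re (z s))) => [s _|].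
  by case: (z s) => b c /=; ring.
exact: @sphere_mfunM.
Qed.

Lemma sphere_mfun_sqnormc z : csphere_mfun z -> sphere_mfun (fun s => sqnormc (z s)).
Proof. by move=> [m1 m2]; apply: sphere_mfunD; exact: @sphere_mfun_sqr. Qed.

Lemma csphere_mfun_covector (w : 'rV[R]_n -> 'rV[R[i]]_n) l :
  (forall k, csphere_mfun (fun s => w s ord0 k)) ->
  csphere_mfun (fun s => covector (w s) (tproj s (basis l))).
Proof.
move=> mw; split.
  under eq_fun do rewrite Re_covector; apply: sphere_mfun_sum => j.
  by apply: sphere_mfunM; [exact: (mw j).1|exact: @sphere_mfun_tproj].
under eq_fun do rewrite Im_covector; apply: sphere_mfun_sum => j.
by apply: sphere_mfunM; [exact: (mw j).2|exact: @sphere_mfun_tproj].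
Qed.

Section comparison.
Variables (phi u : 'rV[R]_n -> R[i]) (w : 'rV[R]_n -> 'rV[R[i]]_n).
Hypotheses (mphi : csphere_mfun phi) (mw : forall k, csphere_mfun (fun s => w s ord0 k)).
Hypotheses (vC : smooth_on punct (re_part u)) (wC : smooth_on punct (im_part u)).

Let F1 s := sqconorm s (fun X => csphere_diff u s X - covector (w s) X).
Let F2 s := sqconorm s (fun X => covector (w s) X - 'i%C * (a s X)%:C%C * phi s).
Let F3 s := sqnormc (u s - phi s).

Let mF1 : sphere_mfun F1.
Proof.
apply: sphere_mfun_sum => l; apply: sphere_mfun_sqnormc.
apply: csphere_mfunB; last exact: csphere_mfun_covector.
split.
  apply: (@eq_sphere_mfun _ _ (partial l (re_part u))) => [s ss|].
    by rewrite csphere_diffE//= (sum_tproj l (sum_partial_radial vC ss)).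
  exact: (@nice_mfun _ _ _ (smooth_nice (smooth_on_partial l vC))).
apply: (@eq_sphere_mfun _ _ (partial l (im_part u))) => [s ss|].
  by rewrite csphere_diffE//= (sum_tproj l (sum_partial_radial wC ss)).
exact: (@nice_mfun _ _ _ (smooth_nice (smooth_on_partial l wC))).
Qed.

Let mF2 : sphere_mfun F2.
Proof.
apply: sphere_mfun_sum => l; apply: sphere_mfun_sqnormc.
apply: csphere_mfunB; first exact: csphere_mfun_covector.
apply: csphere_mfunMi => //; apply: (@eq_sphere_mfun _ _ (om l)) => [s ss|].
  by rewrite sphere_potential_tproj.
exact: (@nice_mfun _ _ _ (smooth_nice (smooth_on_radial_form r hB l))).
Qed.

Let mF3 : sphere_mfun F3.
Proof.
apply: sphere_mfun_sqnormc; apply: csphere_mfunB => //.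
by split; [exact: (@nice_mfun _ _ _ (sphere_nice vC))|exact: (@nice_mfun _ _ _ (sphere_nice wC))].
Qed.

Let F1_ge0 s : 0 <= F1 s. Proof. exact: sqconorm_ge0. Qed.
Let F2_ge0 s : 0 <= F2 s. Proof. exact: sqconorm_ge0. Qed.
Let F3_ge0 s : 0 <= F3 s. Proof. exact: sqnormc_ge0. Qed.

Let F3C s : sqnormc (phi s - u s) = F3 s.
Proof. by rewrite /F3 /sqnormc; case: (phi s) (u s) => x y [x' y'] /=; ring. Qed.

(** (d' - iA) u is the sum of d'u - w, w - iA phi and iA (phi - u). The square of a sum of three
    terms is at most three times the sum of their squares, and K bounds |A|^2. *)
Lemma sint_cov_energy_le (K : R) : 0 <= K ->
  (forall s, sphere s -> \sum_k a s (tproj s (basis k)) ^+ 2 <= K) ->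
  (sint (cov_energy om (re_part u) (im_part u)) <=
    3%:E * (sint F1 + sint F2 + K%:E * sint F3))%E.
Proof.
move=> K0 KP.
have nE := smooth_nice (smooth_on_cov_energy (smooth_on_radial_form r hB) vC wC).
have mKF := @sphere_mfunZ _ _ K _ mF3; have mF12 := @sphere_mfunD _ _ _ _ mF1 mF2.
have mF := @sphere_mfunD _ _ _ _ mF12 mKF.
have KF_ge0 s : 0 <= K * F3 s by rewrite mulr_ge0.
have energy_le s : sphere s -> cov_energy om (re_part u) (im_part u) s <=
    3 * (F1 s + F2 s + K * F3 s).
  move=> ss; rewrite -(sqconorm_gauge vC wC ss).
  apply: (@le_trans _ _ (3 * (F1 s + F2 s +
      \sum_l a s (tproj s (basis l)) ^+ 2 * F3 s))).
    rewrite /F1 /F2 /sqconorm -!big_split/= mulr_sumr; apply: ler_sum => l _.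
    set X := tproj s _.
    have -> : csphere_diff u s X - 'i%C * (a s X)%:C%C * u s =
      (csphere_diff u s X - covector (w s) X) +
      (covector (w s) X - 'i%C * (a s X)%:C%C * phi s) +
      'i%C * (a s X)%:C%C * (phi s - u s).
      by move: (csphere_diff u s X) (covector _ X) ('i%C * _) => z1 z2 z3; ring.
    by rewrite (le_trans (sqnormcD3 _ _ _))// sqnormcMi F3C.
  by rewrite -mulr_suml ler_wpM2l// lerD2l ler_wpM2r// KP.
apply: (@le_trans _ _ (sint (fun s => 3 * (F1 s + F2 s + K * F3 s)))).
  apply: (le_sint (@nice_mfun _ _ _ nE) (@sphere_mfunZ _ _ 3 _ mF) _ energy_le) => s _.
  exact: cov_energy_ge0.
rewrite (@sintZ _ _ 3 _ (ler0n _ 3) mF) => [|s ss]; last by rewrite !addr_ge0.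
rewrite (@sintD _ _ _ _ mF12 mKF) => [|s _|s _]; [|by rewrite addr_ge0|exact: KF_ge0].
by rewrite (@sintD _ _ _ _ mF1 mF2)// (@sintZ _ _ K _ K0 mF3).
Qed.

Lemma sint_sqnormc_le : (sint (fun s => sqnormc (phi s)) <=
  2%:E * (sint (sqmod (re_part u) (im_part u)) + sint F3))%E.
Proof.
have mr := @nice_mfun _ _ _ (smooth_nice (smooth_on_sqmod vC wC)).
have mrF := @sphere_mfunD _ _ _ _ mr mF3.
have r0 s : sphere s -> 0 <= sqmod (re_part u) (im_part u) s by move=> _; exact: sqmod_ge0.
apply: (@le_trans _ _ (sint (fun s => 2 * (sqmod (re_part u) (im_part u) s + F3 s)))).
  apply: (le_sint (sphere_mfun_sqnormc mphi) (@sphere_mfunZ _ _ 2 _ mrF)) => s ss.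
    exact: sqnormc_ge0.
  rewrite sqmod_parts// -F3C.
  have {1}-> : phi s = u s + (phi s - u s) by rewrite addrC subrK.
  exact: sqnormcD2.
rewrite (@sintZ _ _ 2 _ (ler0n _ 2) mrF) => [|s ss]; last by rewrite addr_ge0// r0.
by rewrite (@sintD _ _ _ _ mr mF3 r0) => [|s _]; last exact: F3_ge0.
Qed.

End comparison.

Lemma nu0_small_energy : nu B r = 0%E -> forall e : R, 0 < e ->
  exists v w, [/\ smooth_on punct v, smooth_on punct w, 0 < smean (sqmod v w) &
    smean (cov_energy om v w) <= e * smean (sqmod v w)].
Proof.
move=> nu0 e e0; have [K K0 KP] := sphere_energy_bound.
(* With c the squared norm of phi, M and ME the means of |u|^2 and of the energy for [u k], and t as
   below, the estimates become n M >= c / 4 and n ME <= 3 c (d + t (1 + K)) <= e c / 4. *)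
pose d := e / 24; have d0 : 0 < d by rewrite divr_gt0.
have : (nu B r < d%:E)%E by rewrite nu0 lte_fin.
move=> /ereal_inf_lt[q [phi [w [[[mphi phifin] mw wfin [u [uC ucvg ducvg]]] N0 ->]]]].
set Q := sphere_integral _; set N := sphere_integral _ in phifin N0 *.
have N_ge0 : (0 <= N)%E by apply: sint_ge0 => s _; exact: sqnormc_ge0.
have [c c0 Nc] : exists2 c : R, 0 < c & N = c%:E.
  exists (fine N); last by rewrite fineK// ge0_fin_numE.
  by apply: fine_gt0; rewrite phifin andbT lt_neqAle eq_sym N0.
rewrite Nc/= lte_pdivrMr// => Qd.
pose t := Num.min (4^-1) (e / (24 * (1 + K))).
have K1 : 0 < 1 + K by rewrite ltr_pwDl.
have t0 : 0 < t by rewrite lt_min invr_gt0 ltr0n/= divr_gt0// mulr_gt0.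
have ct0 : 0 < c * t by rewrite mulr_gt0.
have small (b : nat -> \bar R) : b k @[k --> \oo] --> 0%E ->
    \forall k \near \oo, (b k < (c * t)%:E)%E.
  move=> b0; apply: (b0 [set y | (y < (c * t)%:E)%E]).
  by apply: open_nbhs_nbhs; split; [exact: open_ereal_lt_ereal|rewrite /= lte_fin].
have [k [uk duk]] := filter_ex (filterI (small _ ucvg) (small _ ducvg)).
have [/smooth_on_sphere_radial vC /smooth_on_sphere_radial wC] := uC k.
exists (re_part (u k)), (im_part (u k)).
have mphi' : csphere_mfun phi.
  by case: mphi => m1 m2; split; exact: @sphere_measurable_mfun.
have mw' l : csphere_mfun (fun s => w s ord0 l).
  by have [m1 m2] := mw l; split; exact: @sphere_measurable_mfun.
have := sint_cov_energy_le mphi' mw' vC wC K0 KP.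
have := sint_sqnormc_le mphi' vC wC.
rewrite -/N -/Q Nc.
rewrite (sphere_integralE (smooth_nice (smooth_on_sqmod vC wC))).
rewrite (sphere_integralE (smooth_nice
  (smooth_on_cov_energy (smooth_on_radial_form r hB) vC wC))).
move: (smean (sqmod _ _)) (smean (cov_energy _ _ _)) => M ME E1 E2.
have {}E1 : (c%:E <= 2%:E * ((n%:R * M)%:E + (c * t)%:E))%E.
  by rewrite (le_trans E1)// lee_wpmul2l// leeD2l// ltW.
have {}E2 : ((n%:R * ME)%:E <= 3%:E * ((c * t)%:E + (d * c)%:E + K%:E * (c * t)%:E))%E.
  rewrite (le_trans E2)// lee_wpmul2l// leeD//; last by rewrite lee_wpmul2l// ltW.
  by rewrite leeD// ltW.
have {}E1 : c <= 2 * (n%:R * M + c * t) by rewrite -lee_fin.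
have {}E2 : n%:R * ME <= 3 * (c * t + d * c + K * (c * t)) by rewrite -lee_fin.
have t4 : t <= 4^-1 by rewrite ge_min lexx.
have tK : t * (1 + K) <= e / 24.
  by rewrite -ler_pdivlMr// -mulrA -invfM ge_min lexx orbT.
have n0 : 0 < n%:R :> R by rewrite ltr0n ltnW.
have ct4 : c * t <= c * 4^-1 by rewrite ler_wpM2l// ltW.
have nM : c / 4 <= n%:R * M by lra.
split => //; first by rewrite -(pmulr_rgt0 _ n0) (lt_le_trans _ nM)// divr_gt0.
rewrite -(ler_pM2l n0) (le_trans E2)//.
have ctK : c * (t * (1 + K)) <= c * (e / 24) by rewrite ler_wpM2l// ltW.
have eM : e * (c / 4) <= e * (n%:R * M) by rewrite ler_wpM2l// ltW.
by move: ctK eM; rewrite /d; lra.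
Qed.

Lemma nu0_flat : nu B r = 0%E -> flat_on_sphere B r.
Proof.
move=> nu0 s X Y ss tX tY; have s0 := sphere_neq0 ss.
have H : forall k i j s, sphere s -> tcurv om k i j s = 0.
  apply: small_energy_tcurv0 => // [i|e /andP[e0 _]].
    exact: smooth_on_radial_form.
  by have [v [w [vC wC M0 ME]]] := nu0_small_energy nu0 (exprn_gt0 2 e0); exists v, w.
pose F := \sum_i \sum_j X ord0 i * Y ord0 j * curv om i j s.
have F0 : F = 0.
  have /sphereP ss1 := ss.
  by apply: (contract_wedge ss1 tX tY) => k i j; exact: H.
have dX (Z : 'rV[R]_n) b : tangent s Z ->
    \sum_i Z ord0 i * partial_map i radial s ord0 b = Z ord0 b.
  move=> tZ; rewrite -[RHS](derive_radial_tangent b ss tZ) derive_partial.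
    by apply: eq_bigr => i _; rewrite mxE.
  exact: smooth_on_differentiable (@open_punctured R n) (@smooth_map_on_radial _ _ b) s0.
have E : F = r ^+ 2 * \sum_b \sum_b' B (r *: s) b b' * X ord0 b * Y ord0 b'.
  transitivity (r ^+ 2 * \sum_i \sum_j X ord0 i * Y ord0 j * \sum_b \sum_b'
      B (r *: s) b b' * partial_map i radial s ord0 b * partial_map j radial s ord0 b').
    rewrite mulr_sumr; apply: eq_bigr => i _.
    rewrite mulr_sumr; apply: eq_bigr => j _.
    by rewrite /curv radial_form_ext_deriv// radial_id// mulrCA.
  rewrite -(sum_bilinear _ (fun i => partial_map i radial s ord0)).
  by under eq_bigr do under eq_bigr do rewrite !dX//.
move: E; rewrite F0 => /esym/eqP.
by rewrite mulf_eq0 expf_eq0/= gt_eqF//= => /eqP.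
Qed.

End reduction.

(** * Exactness, parallel functions and nu = 0 *)

Section equivalences.
Context {R : realType}.

(** The k-th derivative of cos is its shift by k pi / 2, which gives the sequence of derivatives
    that [smooth_on_sphere_comp] asks for. *)
Lemma is_derive_cos_shift (k : nat) (y : R) :
  is_derive y 1 (fun y : R => cos (y + (pi / 2) *+ k)) (cos (y + (pi / 2) *+ k.+1)).
Proof.
have := is_derive_translate (is_derive_cos (y + (pi / 2) *+ k)).
by rewrite -cosDpihalf -addrA -mulrSr.
Qed.

Lemma is_derive_sin_shift (k : nat) (y : R) :
  is_derive y 1 (fun y : R => sin (y + (pi / 2) *+ k)) (sin (y + (pi / 2) *+ k.+1)).
Proof.
have := is_derive_translate (is_derive_sin (y + (pi / 2) *+ k)).
by rewrite -sinDpihalf -addrA -mulrSr.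
Qed.

Section dimension.
Context {n : nat}.
Notation punct := (@punctured R n).
Let op : open punct := @open_punctured R n.
Implicit Types (s X : 'rV[R]_n).

Lemma smooth_on_sphere_comp (h : nat -> R -> R) (f : 'rV[R]_n -> R) :
  (forall k (y : R), is_derive y 1 (h k) (h k.+1 y)) ->
  smooth_on_sphere f -> smooth_on_sphere (fun x => h 0%N (f x)).
Proof.
move=> hd fC s ss; have [W [F [oW Ws FC fF]]] := fC s ss.
exists W, (fun x => h 0%N (F x)); split => //.
  by apply: (@smooth_on_comp1 _ _ W setT h F 0%N) => // k y _; exact: hd.
by move=> x Wx sx; rewrite fF.
Qed.

Lemma sphere_diff_comp (h : R -> R) (l : R) (f : 'rV[R]_n -> R) s X :
  smooth_on_sphere f -> sphere s -> is_derive (f s) 1 h l ->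
  sphere_diff (fun x => h (f x)) s X = l * sphere_diff f s X.
Proof.
move=> fC ss hl.
have fd : derivable (f \o radial) s X.
  exact: smooth_on_derivable op (smooth_on_sphere_radial fC) (sphere_neq0 ss).
have hl' : is_derive ((f \o radial) s) 1 h l by rewrite /= radial_id.
by have [_ E] := is_derive_comp1 fd hl'; exact: E.
Qed.

Lemma exact_parallel (A : 'rV[R]_n -> 'rV[R]_n -> R) (f : 'rV[R]_n -> R) s0 : sphere s0 ->
  smooth_on_sphere f ->
  (forall s X, sphere s -> tangent s X -> A s X = sphere_diff f s X) ->
  exists phi : 'rV[R]_n -> R[i],
    [/\ csmooth_on_sphere phi, exists s, sphere s /\ phi s != 0 &
        forall s X, sphere s -> tangent s X ->
          csphere_diff phi s X - 'i%C * (A s X)%:C%C * phi s = 0].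
Proof.
move=> ss0 fC fA; exists (fun x => Complex (cos (f x)) (sin (f x))); split.
- split.
    have := smooth_on_sphere_comp is_derive_cos_shift fC.
    by under eq_fun do rewrite mulr0n addr0.
  have := smooth_on_sphere_comp is_derive_sin_shift fC.
  by under eq_fun do rewrite mulr0n addr0.
- exists s0; split => //; apply/eqP => -[c0 s1].
  have := cos2Dsin2 (f s0); rewrite c0 s1 expr0n/= addr0 => /eqP.
  by rewrite eq_sym oner_eq0.
- move=> s X ss tX; rewrite fA// /csphere_diff/=.
  rewrite (sphere_diff_comp X fC ss (is_derive_cos _)) (sphere_diff_comp X fC ss (is_derive_sin _)).
  move: (sphere_diff f s X) (cos (f s)) (sin (f s)) => a c d.
  by apply/eqP; rewrite eq_complex/=; apply/andP; split; apply/eqP; ring.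
Qed.

End dimension.

Section flat_exact.
Context {n : nat}.
Variables (B : 'rV[R]_n.+3 -> 'M[R]_n.+3) (r : R).
Hypotheses (hB : smooth_closed_csupp_2form B) (hr : 0 < r).
Notation punct := (@punctured R n.+3).
Let op : open punct := @open_punctured R n.+3.

Lemma flat_exact : flat_on_sphere B r -> exists f : 'rV[R]_n.+3 -> R,
  smooth_on_sphere f /\ forall s X, sphere s -> tangent s X ->
    sphere_potential B r s X = sphere_diff f s X.
Proof.
move=> fl; have omC := smooth_on_radial_form r hB.
have [f [fC fE]] := closed_punctured_exact omC
  (fun i j x => @flat_radial_form_closed _ _ _ _ hB i j x fl).
exists f; split.
  by move=> s ss; exists punct, f; split; [exact: @open_punctured|exact: sphere_neq0| |].
move=> s X ss tX; have s0 := sphere_neq0 ss.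
rewrite -radial_form_sphere// /sphere_diff.
have [_ E] := smooth_map_is_derive X op op (@smooth_map_on_radial _ _) fC s0
  (sphere_neq0 (radial_sphere s0)).
rewrite [RHS]E; apply: eq_bigr => l _.
by rewrite derive_radial_tangent// radial_id// fE// mulrC.
Qed.

End flat_exact.

Section parallel.
Context {n : nat}.
Variables (B : 'rV[R]_n -> 'M[R]_n) (r : R).
Notation sint f := (sphere_integral (fun s => (f s)%:E)).
Notation punct := (@punctured R n).
Let op : open punct := @open_punctured R n.

Lemma nu_ge0 : (0 <= nu B r)%E.
Proof.
apply/ereal_infP => q [phi [w [_ _ ->]]]; apply: mule_ge0.
  by apply: sint_ge0 => s _; exact: sqconorm_ge0.
rewrite lee_fin invr_ge0 fine_ge0//.
by apply: sint_ge0 => s _; exact: sqnormc_ge0.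
Qed.

(** phi itself has Rayleigh quotient 0. It belongs to H^1 through the constant sequence, with the
    gradient of its extension as differential, and [smean_gt0] keeps the denominator away from 0. *)
Lemma parallel_nu0 (phi : 'rV[R]_n -> R[i]) : csmooth_on_sphere phi ->
  (exists s, sphere s /\ phi s != 0) ->
  (forall s X, sphere s -> tangent s X ->
    csphere_diff phi s X - 'i%C * (sphere_potential B r s X)%:C%C * phi s = 0) ->
  nu B r = 0%E.
Proof.
move=> phiC [s0 [ss0 phi0]] par.
have [/smooth_on_sphere_radial vC /smooth_on_sphere_radial wC] := phiC.
have [mR _] := sphere_nice vC; have [mI _] := sphere_nice wC.
have rC := smooth_on_sqmod vC wC; have nr := smooth_nice rC.
have modE s : sphere s -> sqnormc (phi s) = sqmod (re_part phi) (im_part phi) s.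
  by move=> ss; rewrite sqmod_parts.
pose w s := \row_k Complex (partial k (re_part phi) s) (partial k (im_part phi) s).
have wE s X : sphere s -> covector (w s) X = csphere_diff phi s X.
  move=> ss; rewrite csphere_diffE//; apply/eqP; rewrite eq_complex Re_covector Im_covector/=.
  by apply/andP; split; apply/eqP; apply: eq_bigr => k _; rewrite mxE/= mulrC.
have sint_mod : sint (fun s => sqnormc (phi s)) =
    (n%:R * smean (sqmod (re_part phi) (im_part phi)))%:E.
  by rewrite -(sphere_integralE nr); exact: eq_sint.
have wN s : sphere s ->
    sqconorm s (covector (w s)) = \sum_k (partial k (re_part phi) s ^+ 2 + partial k (im_part phi) s ^+ 2).
  move=> ss; apply: eq_bigr => k _; rewrite (wE _ _ ss) (csphere_diffE _ vC wC ss).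
  by rewrite (sum_tproj k (sum_partial_radial vC ss)) (sum_tproj k (sum_partial_radial wC ss)).
have nP k : nice (partial k (re_part phi)) by exact/smooth_nice/smooth_on_partial.
have nQ k : nice (partial k (im_part phi)) by exact/smooth_nice/smooth_on_partial.
(* The surface integral carries the factor n; a point of the sphere excludes n = 0. *)
have n0 : (0 < n)%N.
  rewrite lt0n; apply/eqP => n0; move/sphereP : ss0.
  rewrite /dot big1 => [/eqP|i _]; first by rewrite eq_sym oner_eq0.
  by have := ltn_ord i; rewrite [X in (_ < X)%N]n0.
apply/eqP; rewrite eq_le nu_ge0 andbT; apply: ereal_inf_lbound.
exists phi, w; split.
- split.
  + split; first by split.
    by rewrite sint_mod ltry.
  + move=> k; split.
      have [mP _] := nP k.
      by rewrite /sphere_measurable; under eq_fun do rewrite mxE.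
    have [mQ _] := nQ k.
    by rewrite /sphere_measurable; under eq_fun do rewrite mxE.
  + rewrite (eq_sint wN) sphere_integralE ?ltry//.
    apply: nice_sum => k; apply: niceD; under eq_fun do rewrite expr2; exact: niceM.
  + exists (fun=> phi); split.
    * by [].
    * rewrite sint0; first exact: cvg_cst.
      by move=> s _; rewrite subrr /sqnormc/= expr0n/= addr0.
    * rewrite sint0; first exact: cvg_cst.
      move=> s ss; apply: big1 => k _.
      by rewrite wE// subrr /sqnormc/= expr0n/= addr0.
- rewrite sint_mod eqe mulf_neq0// ?pnatr_eq0 -?lt0n//.
  rewrite gt_eqF//; apply: smean_gt0 (ss0) _.
  + by move=> x x0; exact: smooth_on_continuous op rC x0.
  + by move=> s _; exact: sqmod_ge0.
  + rewrite -modE// /sqnormc lt_neqAle addr_ge0 ?sqr_ge0// andbT eq_sym.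
    rewrite paddr_eq0 ?sqr_ge0// !sqrf_eq0.
    by move: phi0; rewrite eq_complex.
- rewrite sint0 ?mul0e// => s ss; apply: big1 => k _.
  by rewrite wE// par//; [rewrite /sqnormc/= expr0n/= addr0|exact: tproj_tangent].
Qed.

End parallel.
End equivalences.

(* The dimension is d = n.+3 and the sphere S^(d-1) sits in 'rV_(n.+3). *)
Theorem proposition1p1 (R : realType) (n : nat)
    (B : 'rV[R]_n.+3 -> 'M[R]_n.+3) (r : R)
    (hB : smooth_closed_csupp_2form B) (hr : 0 < r) :
  [<->
    nu B r = 0%E;
    exists phi : 'rV[R]_n.+3 -> R[i],
      [/\ csmooth_on_sphere phi,
          exists s, sphere s /\ phi s != 0 &
          forall s X, sphere s -> tangent s X ->
            csphere_diff phi s X - 'i%C * (sphere_potential B r s X)%:C%C * phi s = 0];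
    exists f : 'rV[R]_n.+3 -> R,
      smooth_on_sphere f /\
      forall s X, sphere s -> tangent s X ->
        sphere_potential B r s X = sphere_diff f s X;
    forall (U : set 'rV[R]_n.+2) T, sphere_coordinates U T ->
      forall q, U q -> coord_ext_deriv T (sphere_potential B r) q = 0;
    forall (U : set 'rV[R]_n.+2) T, sphere_coordinates U T ->
      forall q, U q -> forall l : n.-tuple 'I_n.+2,
        hodge_2form (pullback_metric T q)
          (coord_ext_deriv T (sphere_potential B r) q) l = 0;
    forall (U : set 'rV[R]_n.+2) T, sphere_coordinates U T ->
      forall q, U q -> forall l : n.-tuple 'I_n.+2,
        let p := spherical_point q r in
        hodge_2form (pullback_metric (spherical_coordinates T) p)
          (pullback_2form (spherical_coordinates T) B p)
          [tuple of rcons (map_tuple (lift ord_max) l) ord_max] = 0 ].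
Proof.
have s0 : @sphere R n.+3 (basis ord0).
  by apply/sphereP; rewrite dot_basis mxE !eqxx.
have flat_nu (fl : flat_on_sphere B r) : nu B r = 0%E.
  have [f [fC fE]] := flat_exact hB fl.
  by have [phi [phiC phi0 par]] := exact_parallel s0 fC fE; exact: parallel_nu0 par.
tfae.
- move=> /(nu0_flat hB hr isT)/(flat_exact hB)[f [fC fE]].
  exact: exact_parallel s0 fC fE.
- move=> [phi [phiC phi0 par]].
  exact: (flat_exact hB (nu0_flat hB hr isT (parallel_nu0 phiC phi0 par))).
- move=> [f [fC fE]] U T UT q Uq.
  (* Instead of computing d'd'f in a chart, the parallel function exp (i f) gives nu = 0, and
     flatness follows. *)
  have [phi [phiC phi0 par]] := exact_parallel s0 fC fE.
  exact: (flat_chart_ext_deriv hB UT (nu0_flat hB hr isT (parallel_nu0 phiC phi0 par)) Uq).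
- move=> H U T UT q Uq l; rewrite (H U T UT q Uq) /hodge_2form.
  by rewrite big1 ?mulr0// => j _; apply: big1 => k _; rewrite mxE mulr0.
- move=> H U T UT q Uq l; exact: (flat_hodge hB l (flat_of_sphere_hodge hB hr H) UT Uq).
- by move=> /(flat_of_hodge hB hr)/flat_nu.
Qed.
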